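(* Suppose that $\mathfrak p=(p_d)_{d\ge1}$ and $\mathfrak q=(q_d)_{d\ge1}$, with $p_d,q_d\in\mathcal P_d(\mathbb R)$, are two sequences of polynomials with infinitesimal distributions $(\mu,\mu')$ and $(\nu,\nu')$, respectively, where $\nu$ is supported on $[0,\infty)$. Then the finite-free multiplicative convolution $\mathfrak p\boxtimes\mathfrak q=(p_d\boxtimes_d q_d)_{d\ge1}$ has infinitesimal distribution $(\rho,\rho')$, where $\rho=\mu\boxtimes\nu$ and $\rho'$ has Cauchy transform $G_{\rho'}$ determined by $$G_{\rho'}=-(\widehat R_{\mathfrak p\boxtimes\mathfrak q}\circ G_{\mu\boxtimes\nu})\cdot G'_{\mu\boxtimes\nu}-H_{\mu\boxtimes\nu},$$ with $\widehat R_{\mathfrak p\boxtimes\mathfrak q}(z)=\sum_{n=1}^\infty\widehat r_n(\mathfrak p\boxtimes\mathfrak q)\,z^{n-1}$ and, for each $n\ge1$, $$\widehat r_n(\mathfrak p\boxtimes\mathfrak q)=\sum_{\pi\in NC(n)}\Bigl(\sum_{V\in\pi}\widehat r_{|V|}(\mathfrak p)\,r_{\pi\setminus V}(\mu)\cdot r_{Kr(\pi)}(\nu)+\sum_{W\in Kr(\pi)}r_\pi(\mu)\cdot\widehat r_{|W|}(\mathfrak q)\,r_{Kr(\pi)\setminus W}(\nu)\Bigr)-\frac n2\sum_{\substack{t+s=n\\ \sigma\in S_{NC}(t,s)}}\frac{r_\sigma(\mu)\,r_{Kr_{t,s}(\sigma)}(\nu)}{ts}.$$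
   Context: $\mathcal P_d(\mathbb R)$ is the set of monic real polynomials of degree $d$ with only real roots. For a monic real polynomial $p_d$ of degree $d$ with (complex) roots $\lambda_1,\dots,\lambda_d$ with multiplicity, $m_n(p_d)=\frac1d\sum_k\lambda_k^n$. Write $p_d(x)=\sum_{k=0}^d x^{d-k}(-1)^k\binom dk\mathsf e_k(p_d)$. The finite-free multiplicative convolution is $[p_d\boxtimes_d q_d](x)=\sum_{k=0}^d x^{d-k}(-1)^k\binom dk\,\mathsf e_k(p_d)\,\mathsf e_k(q_d)$ (real-rooted when, in addition, one of the factors has no negative roots). The finite-free cumulants are $\kappa_n(p_d)=\frac{(-d)^{n-1}}{(n-1)!}\sum_{\pi\in P(n)}(-1)^{|\pi|-1}(|\pi|-1)!\prod_{V\in\pi}\mathsf e_{|V|}(p_d)$, $1\le n\le d$, with $P(n)$ the set of partitions of $[n]=\{1,\dots,n\}$ and $|\pi|$ the number of blocks. A sequence $\mathfrak p=(p_d)$ of monic polynomials, $\deg p_d=d$, has infinitesimal distribution $(\mu,\mu')$ if $\mu$ is a probability distribution on $\mathbb R$ with finite moments $m_n(\mu)$ of all orders, $m_n(p_d)\to m_n(\mu)$ for all $n\ge0$, the limits $m_n'(\mathfrak p)=\lim_{d\to\infty}d\,(m_n(p_d)-m_n(\mu))$ exist for all $n\ge1$, and $\mu':\mathbb R[x]\to\mathbb R$ is the linear functional with $\mu'(1)=0$, $\mu'(x^n)=m_n'(\mathfrak p)$. The cumulant fluctuations of such $\mathfrak p$ are the numbers $\widehat r_n(\mathfrak p)$ with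 $\kappa_n(p_d)=r_n(\mu)+\frac1d\widehat r_n(\mathfrak p)+o(1/d)$ as $d\to\infty$ (they always exist). $NC(n)$ is the set of non-crossing partitions of $[n]$. For a sequence $(u_n)$: $u_\pi=\prod_{V\in\pi}u_{|V|}$, $u_{\pi\setminus V}=\prod_{W\in\pi,W\neq V}u_{|W|}$, $u_\sigma=\prod_c u_{|c|}$ over cycles $c$ (fixed points included) of a permutation $\sigma$. For $\pi\in NC(n)$, $Kr(\pi)\in NC(n)$ is the Kreweras complement: viewing $\pi$ as the permutation whose cycles are its blocks in increasing order and $\gamma_n=(1,2,\dots,n)$, $Kr(\pi)$ is the partition whose blocks are the cycles of $\pi^{-1}\gamma_n$. Free cumulants $r_n(\mu)$ are defined recursively by $m_n(\mu)=\sum_{\pi\in NC(n)}r_\pi(\mu)$. Throughout, only distributions determined by their moments are considered; for $\nu$ supported on $[0,\infty)$, $\mu\boxtimes\nu$ is the probability measure with $r_n(\mu\boxtimes\nu)=\sum_{\pi\in NC(n)}r_\pi(\mu)\,r_{Kr(\pi)}(\nu)$ for all $n\ge1$. For $t,s\ge1$ let $\gamma_{t,s}=(1,\dots,t)(t+1,\dots,t+s)\in S_{t+s}$; $S_{NC}(t,s)$ is the set of $\sigma\in S_{t+s}$ such that $\langle\sigma,\gamma_{t,s}\rangle$ acts transitively on $[t+s]$ and $|\sigma|+|\sigma^{-1}\gamma_{t,s}|=t+s$, $|\cdot|$ counting cycles including fixed points; $Kr_{t,s}(\sigma)=\sigma^{-1}\gamma_{t,s}$. Sums over $t+s=n$ run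 over ordered pairs of integers $t,s\ge1$. Formal power series (all identities, compositions and derivatives are formal): $G_\mu(z)=\sum_{n\ge0}m_n(\mu)z^{-n-1}$; for a linear functional $\mu'$ on $\mathbb R[x]$, $G_{\mu'}(z)=\sum_{n\ge0}\mu'(x^n)z^{-n-1}$; $H_\mu(z)=\sum_{n\ge2}h_n(\mu)z^{-n-1}$ with $h_n(\mu)=\frac n2\sum_{t+s=n,\ \sigma\in S_{NC}(t,s)}\frac{r_\sigma(\mu)}{ts}$. *)

(* Defs.v *)
From HB Require Import structures.
From mathcomp Require Import all_boot all_order all_fingroup all_algebra complex.
Set Implicit Arguments.
Unset Strict Implicit.
Unset Printing Implicit Defensive.

Import Order.TTheory GRing.Theory Num.Theory.

Local Open Scope ring_scope.

(* The set [n] = {1, ..., n} is represented by 'I_n = {0, ..., n-1}. *)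

Definition set_partitions (n : nat) : {set {set {set 'I_n}}} :=
  [set P | partition P [set: 'I_n]]%SET.

Definition crossing (n : nat) (V W : {set 'I_n}) : bool :=
  [exists a in V, exists b in W, exists c in V, exists e in W,
     [&& a < b, b < c & c < e]%N].

Definition NC (n : nat) : {set {set {set 'I_n}}} :=
  [set P in set_partitions n |
     [forall V in P, forall W in P, (V != W) ==> ~~ crossing V W]]%SET.

(* The permutation whose cycles are the blocks of P in increasing order
   ([enum] of a set of ordinals is increasing).  The default value 1 is never
   used when P is a partition, see [part_permE]. *)
Definition part_perm (n : nat) (P : {set {set 'I_n}}) : {perm 'I_n} :=
  insubd (1%g : {perm 'I_n}) [ffun x => next (enum (pblock P x)) x].

Lemma part_permE (n : nat) (P : {set {set 'I_n}}) (x : 'I_n) :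
  partition P [set: 'I_n]%SET -> part_perm P x = next (enum (pblock P x)) x.
Proof.
move=> partP; have [covP tI _] := and3P partP.
have cov y : y \in cover P by rewrite (eqP covP) inE.
have uE (A : {set 'I_n}) : uniq (enum A) by exact: enum_uniq.
have inj : injectiveb [ffun y => next (enum (pblock P y)) y].
  apply/injectiveP => y z; rewrite !ffunE => eqn.
  have yP : next (enum (pblock P y)) y \in pblock P y.
    by rewrite -mem_enum mem_next mem_enum mem_pblock.
  have zP : next (enum (pblock P z)) z \in pblock P z.
    by rewrite -mem_enum mem_next mem_enum mem_pblock.
  have e : pblock P y = pblock P z.
    by rewrite -(same_pblock tI yP) -(same_pblock tI zP) eqn.
  move: eqn; rewrite e => eqn.
  by rewrite -(prev_next (uE (pblock P z)) y) eqn prev_next.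
rewrite /part_perm /insubd (insubT (fun f : {ffun 'I_n -> 'I_n} => injectiveb f) inj) /=.
by rewrite -[LHS]/(fun_of_perm _ x) unlock /= ffunE.
Qed.

(* (1, 2, ..., n) *)
Definition gamma (n : nat) : {perm 'I_n} := perm (@ordS_inj n).

(* (1, ..., t)(t+1, ..., t+s) *)
Definition gamma2_fun (t s : nat) (x : 'I_(t + s)) : 'I_(t + s) :=
  match fintype.split x with
  | inl i => lshift s (ordS i)
  | inr j => rshift t (ordS j)
  end.

Lemma gamma2_inj (t s : nat) : injective (@gamma2_fun t s).
Proof.
move=> x y; rewrite /gamma2_fun -{2}(splitK x) -{2}(splitK y).
case: (fintype.split x) => i; case: (fintype.split y) => j /=.
- by move=> /lshift_inj/ordS_inj ->.
- by move/eqP; rewrite eq_lrshift.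
- by move/eqP; rewrite eq_rlshift.
- by move=> /rshift_inj/ordS_inj ->.
Qed.

Definition gamma2 (t s : nat) : {perm 'I_(t + s)} := perm (@gamma2_inj t s).

(* In [fingroup], (a * b) x = b (a x); hence [gamma * s^-1] is the permutation
   written s^-1 gamma with the usual right-to-left composition. *)
Definition Kr (n : nat) (P : {set {set 'I_n}}) : {set {set 'I_n}} :=
  porbits (gamma n * (part_perm P)^-1)%g.

Definition Kr2 (t s : nat) (sigma : {perm 'I_(t + s)}) : {perm 'I_(t + s)} :=
  (gamma2 t s * sigma^-1)%g.

Definition SNC (t s : nat) : {set {perm 'I_(t + s)}} :=
  [set sigma |
     [transitive <<[set sigma; gamma2 t s]>>, on [set: 'I_(t + s)] | 'P]%act
     && (#|porbits sigma| + #|porbits (Kr2 sigma)| == t + s)%N]%SET.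

(* u_P, the product of u_|V| over the blocks V of P *)
Definition block_prod (R : comNzRingType) (T : finType) (u : nat -> R)
    (P : {set {set T}}) : R :=
  \prod_(V in P) u #|V|.

From mathcomp Require Import all_classical all_reals all_analysis.
Import numFieldNormedType.Exports.
Local Open Scope classical_set_scope.

(* The annular sum (n / 2) \sum u_sigma v_(Kr sigma) / (t s), over ordered pairs
   t, s >= 1 with t + s = n and sigma in S_NC(t, s); here s is n - t. *)
Definition annular_sum (R : realType) (u v : nat -> R) (n : nat) : R :=
  n%:R / 2 *
  \sum_(1 <= t < n) \sum_(sigma in SNC t (n - t))
    block_prod u (porbits sigma) * block_prod v (porbits (Kr2 sigma))
      / (t%:R * (n - t)%:R).

Definition croots (R : realType) (p : {poly R}) : seq R[i] :=
  projT1 (closed_field_poly_normal (map_poly (real_complex R) p)).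

Definition monic_of_degree (R : realType) (d : nat) (p : {poly R}) : Prop :=
  p \is monic /\ size p = d.+1.

Definition real_rooted (R : realType) (d : nat) (p : {poly R}) : Prop :=
  monic_of_degree d p /\
  forall z : R[i], root (map_poly (real_complex R) p) z -> complex.Im z = 0.

(* The power sums of the roots are real, see [pmomentE], so that taking the real
   part only changes the type. *)
Definition pmoment (R : realType) (d : nat) (p : {poly R}) (n : nat) : R :=
  complex.Re (d%:R^-1 * \sum_(z <- croots p) z ^+ n).

Lemma pmomentE (R : realType) (d : nat) (p : {poly R}) (n : nat) : p != 0 ->
  real_complex R (pmoment d p n) = d%:R^-1 * \sum_(z <- croots p) z ^+ n.
Proof.
move=> p0; rewrite /pmoment; set S := (X in complex.Re X).
have ReE (z : R[i]) : conjc z = z -> real_complex R (complex.Re z) = z.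
  case: z => a b [] /eqP.
  by rewrite eq_sym -addr_eq0 -mulr2n mulrn_eq0 /= => /eqP ->.
apply: ReE.
suff rP : perm_eq (map conjc (croots p)) (croots p).
  rewrite /S rmorphM fmorphV rmorph_nat rmorph_sum /=; congr (_ * _).
  under eq_bigr do rewrite rmorphXn /=.
  by rewrite -(big_map conjc xpredT (fun z => z ^+ n)); exact: perm_big.
apply: prod_XsubC_eq.
rewrite /croots; case: closed_field_poly_normal => r /= pE.
have cp : map_poly conjc (map_poly (real_complex R) p)
          = map_poly (real_complex R) p.
  by rewrite -map_poly_comp; apply: eq_map_poly => x /=; exact: conjc_real.
have cl : conjc (lead_coef (map_poly (real_complex R) p))
          = lead_coef (map_poly (real_complex R) p).
  by rewrite lead_coef_map /=; exact: conjc_real.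
have l0 : lead_coef (map_poly (real_complex R) p) != 0.
  by rewrite lead_coef_eq0 map_poly_eq0.
move: cp; rewrite {1 2}pE map_polyZ /= cl => /(scalerI l0) cp.
rewrite -[RHS]cp rmorph_prod /= big_map.
by apply: eq_bigr => z _; rewrite map_polyXsubC.
Qed.

(* p = \sum_(k <= d) x^(d-k) (-1)^k 'C(d, k) e_k(p) *)
Definition fe (R : realType) (d : nat) (p : {poly R}) (k : nat) : R :=
  (-1) ^+ k * p`_(d - k) / 'C(d, k)%:R.

Definition ffmul (R : realType) (d : nat) (p q : {poly R}) : {poly R} :=
  \sum_(k < d.+1)
    ((-1) ^+ k * 'C(d, k)%:R * (fe d p k * fe d q k)) *: 'X^(d - k).

(* Only meaningful for 1 <= n <= d. *)
Definition ffcumulant (R : realType) (d : nat) (p : {poly R}) (n : nat) : R :=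
  (- d%:R) ^+ n.-1 / (n.-1)`!%:R *
  \sum_(P in set_partitions n)
    (-1) ^+ (#|P|.-1) * (#|P|.-1)`!%:R * block_prod (fe d p) P.

Definition finite_moments (R : realType)
    (mu : probability (measurableTypeR R) R) : Prop :=
  forall n : nat, mu.-integrable [set: R] (fun x : R => (x ^+ n)%:E).

Definition moment (R : realType)
    (mu : probability (measurableTypeR R) R) (n : nat) : R :=
  \int[mu]_x (x ^+ n).

Definition moment_determined (R : realType)
    (mu : probability (measurableTypeR R) R) : Prop :=
  forall nu : probability (measurableTypeR R) R,
    finite_moments nu -> (forall n, moment nu n = moment mu n) ->
    forall A : set (measurableTypeR R), measurable A -> nu A = mu A.

(* The free cumulants r_0, ..., r_n of a moment sequence m (with r_0 a dummy
   value), obtained by solving m_n = \sum_(P in NC n) r_P for r_n. *)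
Fixpoint free_cumulants_upto (R : realType) (m : nat -> R) (n : nat) : seq R :=
  if n is k.+1 then
    let r := free_cumulants_upto m k in
    rcons r (m n - \sum_(P in NC n | P != [set [set: 'I_n]]%SET)
                     block_prod (nth 0 r) P)
  else [:: 0].

Definition free_cumulant (R : realType)
    (mu : probability (measurableTypeR R) R) (n : nat) : R :=
  nth 0 (free_cumulants_upto (moment mu) n) n.

Lemma free_cumulantE (R : realType) (mu : probability (measurableTypeR R) R)
    (n : nat) : (0 < n)%N ->
  moment mu n = \sum_(P in NC n) block_prod (free_cumulant mu) P.
Proof.
case: n => // n _; set m := moment mu.
have szE k : size (free_cumulants_upto m k) = k.+1.
  by elim: k => //= k IH; rewrite size_rcons IH.
have nthE k j : (j <= k)%N -> nth 0 (free_cumulants_upto m k) j = free_cumulant mu j.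
  elim: k => [|k IH]; first by rewrite leqn0 => /eqP ->.
  rewrite leq_eqVlt => /orP[/eqP -> //|jk].
  by rewrite /= nth_rcons szE jk IH.
have top : [set [set: 'I_n.+1]]%SET \in NC n.+1.
  rewrite !inE; apply/andP; split.
    apply/and3P; split; first by rewrite /finset.cover big_set1.
      by rewrite /finset.trivIset /finset.cover !big_set1.
    by rewrite inE eq_sym; apply/finset.set0Pn; exists ord0; rewrite inE.
  apply/forall_inP => V /set1P ->; apply/forall_inP => W /set1P ->.
  by rewrite eqxx.
rewrite (bigD1 _ top) /= {1}/block_prod big_set1 cardsT card_ord.
rewrite /free_cumulant /= nth_rcons szE ltnn eqxx.
rewrite (eq_bigr (block_prod (free_cumulant mu))) ?subrK // => P.
rewrite !inE => /andP[/andP[partP _] neP]; apply: eq_bigr => V VP.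
apply: nthE; rewrite -ltnS.
have [covP tI n0] := and3P partP.
suff : (#|V| < #|[set: 'I_n.+1]%SET|)%N by rewrite cardsT card_ord.
apply: proper_card; rewrite finset.properT.
apply: contra neP => /eqP VT; apply/eqP/finset.setP => W; rewrite !inE.
apply/idP/eqP => [WP|->]; last by rewrite -VT.
apply/eqP; apply: contraT => WV; have := finset.trivIsetP tI _ _ WP VP.
rewrite VT => /(_ WV); rewrite -finset.setI_eq0 finset.setIT => /eqP W0.
by move: n0; rewrite -W0 WP.
Qed.

Definition free_mult_conv (R : realType)
    (mu nu rho : probability (measurableTypeR R) R) : Prop :=
  [/\ finite_moments rho, moment_determined rho &
      forall n : nat, (0 < n)%N ->
        free_cumulant rho n =
        \sum_(P in NC n) block_prod (free_cumulant mu) P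
                         * block_prod (free_cumulant nu) (Kr P)].

Definition infinitesimal_distribution (R : realType) (p : nat -> {poly R})
    (mu : probability (measurableTypeR R) R)
    (mu' : {scalar {poly R}}) : Prop :=
  [/\ forall d, (0 < d)%N -> monic_of_degree d (p d),
      finite_moments mu,
      forall n, pmoment d (p d) n @[d --> \oo] --> moment mu n,
      forall n, (0 < n)%N ->
        d%:R * (pmoment d (p d) n - moment mu n) @[d --> \oo] --> mu' 'X^n &
      mu' 1 = 0].

Definition cumulant_fluctuations (R : realType) (p : nat -> {poly R})
    (mu : probability (measurableTypeR R) R) (rhat : nat -> R) : Prop :=
  forall n, (0 < n)%N ->
    (fun d : nat => ffcumulant d (p d) n
       - (free_cumulant mu n + d%:R^-1 * rhat n) : R^o)
    =o_\oo (fun d : nat => d%:R^-1 : R^o).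

Definition fluctuation_mul (R : realType) (r rhat s shat : nat -> R)
    (n : nat) : R :=
  \sum_(P in NC n)
    (\sum_(V in P)
        rhat #|V| * block_prod r (P :\ V)%SET * block_prod s (Kr P)
     + \sum_(W in Kr P)
         block_prod r P * (shat #|W| * block_prod s (Kr P :\ W)%SET))
  - annular_sum r s n.

(* A sequence a : nat -> R stands either for \sum_k a_k z^k or for
   \sum_k a_k z^-k. *)

Definition fs_mul (R : realType) (a b : nat -> R) : nat -> R :=
  fun k => \sum_(i < k.+1) a i * b (k - i)%N.

Definition fs_exp (R : realType) (a : nat -> R) (n : nat) : nat -> R :=
  iter n (fs_mul a) (fun k => (k == 0)%N%:R).

(* The composition a o b, for b without constant term: then b ^ i has no term of
   order < i, so that the coefficient k of the sum of the a_i b^i only involves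
   i <= k. *)
Definition fs_comp (R : realType) (a b : nat -> R) : nat -> R :=
  fun k => \sum_(i < k.+1) a i * fs_exp b i k.

(* The derivative d/dz of \sum_k a_k z^-k *)
Definition fs_derivV (R : realType) (a : nat -> R) : nat -> R :=
  fun k => if k is j.+1 then - (j%:R * a j) else 0.

(* \sum_n m_n z^(-n-1), in powers of z^-1 *)
Definition cauchy_series (R : realType) (m : nat -> R) : nat -> R :=
  fun k => if k is n.+1 then m n else 0.

Definition G_ (R : realType) (mu : probability (measurableTypeR R) R) :
    nat -> R :=
  cauchy_series (moment mu).

Definition G_fun (R : realType) (mu' : {scalar {poly R}}) : nat -> R :=
  cauchy_series (fun n => mu' 'X^n).

Definition h_ (R : realType) (mu : probability (measurableTypeR R) R)
    (n : nat) : R :=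
  n%:R / 2 *
  \sum_(1 <= t < n) \sum_(sigma in SNC t (n - t))
    block_prod (free_cumulant mu) (porbits sigma) / (t%:R * (n - t)%:R).

Definition H_ (R : realType) (mu : probability (measurableTypeR R) R) :
    nat -> R :=
  cauchy_series (fun n => if (2 <= n)%N then h_ mu n else 0).

(* Main.v *)
Require Import Defs.
From HB Require Import structures.
From mathcomp Require Import all_boot all_order all_fingroup all_algebra complex.
From mathcomp Require Import zify ring reals.

(** Put c = -d. The sum over set partitions in the definition of the finite-free
    cumulants is a logarithm; inverting it gives
      e_n(p) = c^(-n) sum_(sigma in S_n) c^|sigma| kappa_sigma(p),
    so that a polynomial is described by a sum over all permutations of its
    cumulants multiplied along the cycles ([fe_perm_sum]). The product of two such
    sums is a sum over pairs of permutations, and decomposing [n] into the orbits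
    of the group generated by a pair shows that its logarithm is the sum over the
    pairs that act transitively ([transitive_sum_set_exp]). As
    e_n(p [x] q) = e_n(p) e_n(q), the cumulants of the product are given exactly by
      kappa_n(p [x] q) = 1/(n-1)! sum c^(|sigma| + |tau| - n - 1)
                                      kappa_sigma(p) kappa_tau(q),
    over the transitive pairs (sigma, tau) ([ffcumulant_ffmul]). The moments obey
    the same formula with all kappa_k(q) replaced by 1, because of Newton's
    identities and of sum_sigma c^|sigma| = (-1)^n n! binomial(d, n)
    ([pmoment_avg]). One asymptotic expansion therefore serves for both.

    For a transitive pair, |sigma| + |tau| + |sigma tau| is at most n + 2 and has
    the parity of n ([genus_ineq], [genus_parity]). Hence the pairs with exponent
    0 are those of genus 0 whose product is a long cycle, and those with exponent
    -1 have a product with two cycles. Conjugating the product to the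
    standard permutation turns these two families into the non-crossing partitions
    with their Kreweras complements and into the annular non-crossing permutations
    ([transitive_avg_expansion]):
      T_n(u, v) = sum_(pi in NC(n)) u_pi v_Kr(pi) - (annular sum) / d + O(1/d^2).
    When u and v have expansions r + rhat / d + o(1/d), the product rule turns this
    into the announced formula for the fluctuations ([transitive_avg_first_order]).
    The hypothesis is about moments instead of cumulants, but T_n(u, 1) is affine in
    u_n with a coefficient that tends to 1, so that expansions of the moments can be
    transferred to the cumulants by induction ([cumulants_first_order]).

    Applied once more to p [x] q, the expansion gives
    rho'(x^n) = D_n - h_n, where D_n is the derivative of sum_(pi in NC(n)) r_pi in
    the direction rhat. It remains to see that the D_n have generating series
    - (Rhat o G) G' ([moment_variationE]). This is implicit differentiation of the
    functional equation M = 1 + sum_k r_k (x M)^k between moments and free cumulants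
    ([free_functional_equation]). That equation is itself obtained as the limit
    d -> oo of an exact relation between the numbers T_n(r, 1) and the coefficients
    of the formal series of which they are the normalised power sums. *)

Set Implicit Arguments.
Unset Strict Implicit.
Unset Printing Implicit Defensive.
Import Order.TTheory GRing.Theory Num.Theory.

Local Open Scope ring_scope.

(** * The exponential formula for set functions *)
Section SetExponential.
Variables (R : comNzRingType) (T : finType).
Implicit Types (S V W : {set T}) (L E : {set T} -> R).

(** The relation E = exp L for set functions multiplied by disjoint union, in the
    form of the differential equation E' = L' E: the block that contains a chosen
    point is split off. Functions of an actual set, instead of exponential generating
    series, allow L and E to be sums over permutations of that set. *)
Definition set_exp L E : Prop :=
  E set0 = 1 /\ forall S a, a \in S ->
    E S = \sum_(V : {set T} | (V \subset S) && (a \in V)) L V * E (S :\: V).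

Lemma sum_over_block L E S a : a \in S -> E set0 = 1 ->
  \sum_(V : {set T} | (V \subset S) && (a \in V)) L V * E (S :\: V) =
  L S + \sum_(V : {set T} | (V \proper S) && (a \in V)) L V * E (S :\: V).
Proof.
move=> aS E0; rewrite (bigD1 S) /= ?subxx ?aS // setDv E0 mulr1; congr (_ + _).
apply: eq_bigl => V; rewrite finset.properEneq.
by case: (V != S); case: (V \subset S); case: (a \in V).
Qed.

(** Uniqueness of the logarithm: two combinatorial descriptions of the same E give
    an identity between their connected parts. The exact formulas for
    cumulants and moments are obtained in this way. *)
Lemma set_exp_log L L' E : set_exp L E -> set_exp L' E ->
  forall S, S != set0 -> L S = L' S.
Proof.
move=> [E0 LE] [_ L'E] S; have [k] := ubnP #|S|.
elim: k S => // k IH S ltSk /set0Pn[a aS].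
have := LE _ _ aS; rewrite (L'E _ _ aS) !sum_over_block //.
rewrite (eq_bigr (fun V => L V * E (S :\: V))) => [/addIr/esym//|V /andP[pV aV]].
rewrite IH //; last by apply/set0Pn; exists a.
by apply: leq_trans (proper_card pV) _; rewrite -ltnS.
Qed.

Lemma set_exp_uniq L L' E E' : (forall S, S != set0 -> L S = L' S) ->
  set_exp L E -> set_exp L' E' -> E =1 E'.
Proof.
move=> eqL [E0 LE] [E0' L'E] S; have [k] := ubnP #|S|.
elim: k S => // k IH S ltSk; have [->|/set0Pn[a aS]] := eqVneq S set0.
  by rewrite E0.
rewrite (LE _ _ aS) (L'E _ _ aS); apply: eq_bigr => V /andP[VS aV].
rewrite eqL; last by apply/set0Pn; exists a.
congr (_ * _); apply: IH; rewrite cardsDS //.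
have V0 : (0 < #|V|)%N by apply/card_gt0P; exists a.
have := subset_leq_card VS; move: ltSk V0; case: #|V| => // v; rewrite ltnS => le1 _ le2.
by apply: leq_trans le1; rewrite ltn_subrL /=; exact: leq_trans le2.
Qed.

Lemma sum_pointed_subsets (f : nat -> R) S a : a \in S ->
  \sum_(V : {set T} | (V \subset S) && (a \in V)) f #|V| =
  \sum_(k < #|S|) 'C(#|S|.-1, k)%:R * f k.+1.
Proof.
move=> aS; rewrite (reindex_onto (fun W => a |: W) (fun V => V :\ a)) /=; last first.
  by move=> V /andP[_ aV]; rewrite setD1K.
rewrite (eq_bigl (fun W => W \subset S :\ a)) => [|W]; last first.
  rewrite subUset sub1set aS setU11 andbT /= subsetD1.
  have [aW|aW] := boolP (a \in W); last by rewrite setU1K // eqxx.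
  rewrite andbF; apply/andP=> -[_ /eqP eqW]; move: aW; rewrite -eqW.
  by rewrite !inE eqxx.
rewrite (eq_bigr (fun W => f #|W|.+1)) => [|W]; last first.
  by rewrite subsetD1 => /andP[_ aW]; rewrite cardsU1 aW.
have cS : #|S :\ a| = #|S|.-1 by rewrite [in RHS](cardsD1 a) aS.
have S0 : (0 < #|S|)%N by apply/card_gt0P; exists a.
rewrite (partition_big (fun W => inord #|W| : 'I_(#|S|.-1.+1)) predT) //=.
rewrite -[in RHS](prednK S0) /=; apply: eq_bigr => k _.
rewrite (eq_bigr (fun=> f k.+1)) => [|W /andP[WS /eqP <-]]; last first.
  by rewrite inordK // ltnS -cS subset_leq_card.
rewrite sumr_const mulr_natl; congr (_ *+ _).
have -> : 'C(#|S|.-1, k) = 'C(#|S :\ a|, k) by rewrite cS.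
rewrite -cards_draws.
rewrite cardsE; apply: eq_card => W; rewrite -!topredE /=.
have [WS|] //= := boolP (W \subset _).
rewrite -val_eqE /= inordK // ltnS -cS; exact: subset_leq_card.
Qed.

Lemma sum_pointed_proper_subsets (f : nat -> R) S a : a \in S ->
  \sum_(V : {set T} | (V \proper S) && (a \in V)) f #|V| =
  \sum_(k < #|S|.-1) 'C(#|S|.-1, k)%:R * f k.+1.
Proof.
move=> aS; have := sum_pointed_subsets f aS; rewrite (bigD1 S) /= ?subxx ?aS //.
have : (0 < #|S|)%N by apply/card_gt0P; exists a.
case: #|S| => // n _; rewrite big_ord_recr /= binn mul1r addrC => /addIr <-.
apply: eq_bigl => V; rewrite finset.properEneq.
by case: (V != S); case: (V \subset S); case: (a \in V).
Qed.

(** For functions of the cardinality the relation is the usual recursion between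
    the coefficients of exponential generating series. *)
Lemma set_exp_numeric (l e : nat -> R) : e 0%N = 1 ->
  (forall n, e n.+1 = \sum_(k < n.+1) 'C(n, k)%:R * (l k.+1 * e (n - k)%N)) ->
  set_exp (fun S => l #|S|) (fun S => e #|S|).
Proof.
move=> e0 rec; split=> [|S a aS]; first by rewrite cards0.
rewrite (eq_bigr (fun V => (fun k => l k * e (#|S| - k)%N) #|V|)).
  rewrite (sum_pointed_subsets (fun k => l k * e (#|S| - k)%N)) //.
  have : (0 < #|S|)%N by apply/card_gt0P; exists a.
  by case: #|S| => // n _; rewrite rec.
by move=> V /andP[VS _]; rewrite cardsDS.
Qed.

End SetExponential.

(** * The logarithm as an alternating sum over set partitions *)
Section PartitionLog.
Variables (R : comNzRingType) (u : nat -> R).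

Definition part_sum (T : finType) (f : nat -> R) (S : {set T}) : R :=
  \sum_(P | partition P S) f #|P| * block_prod u P.

Lemma notin_partitionD (T : finType) (P : {set {set T}}) (S V : {set T}) :
  V != set0 -> partition P (S :\: V) -> V \notin P.
Proof.
move=> V0 partP; have [/eqP cov _ _] := and3P partP.
apply/negP => VP; have [a aV] := set0Pn _ V0.
have : a \in cover P by apply/bigcupP; exists V.
by rewrite cov inE aV.
Qed.

Lemma partition_block_sum (T : finType) (F : {set {set T}} -> R) (S V : {set T}) :
  V \subset S -> V != set0 ->
  \sum_(P | partition P S && (V \in P)) F P =
  \sum_(P | partition P (S :\: V)) F (V |: P).
Proof.
move=> VS V0; rewrite (reindex_onto (fun P => V |: P) (fun P => P :\ V)) /=; last first.
  by move=> P /andP[_ VP]; rewrite setD1K.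
apply: eq_bigl => P; rewrite setU11 andbT; apply/andP/idP => [[partP /eqP eqP']|partP].
  by rewrite -{1}eqP'; apply: partitionD1; rewrite ?setU11.
split; last by rewrite setU1K // (notin_partitionD V0 partP).
have [/eqP cov tI n0] := and3P partP; apply/and3P; split.
- by rewrite /cover bigcup_setU big_set1 -/(cover P) cov setDE setUIr setUCr setIT; apply/eqP/setUidPr.
- have [] // := trivIsetU1 _ tI n0 (A := V) => B BP.
  rewrite -setI_eq0; apply/eqP/setP => x; rewrite !inE; apply/andP=> -[xV xB].
  have : x \in cover P by apply/bigcupP; exists B.
  by rewrite cov inE xV.
- by rewrite !inE negb_or eq_sym V0.
Qed.

Lemma block_prodU1 (T : finType) (P : {set {set T}}) V : V \notin P ->
  block_prod u (V |: P) = u #|V| * block_prod u P.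
Proof. by move=> VP; rewrite /block_prod big_setU1. Qed.

(** Removing the block of a lowers the number of blocks by one, which shifts the
    weight f. *)
Lemma part_sum_pointed (T : finType) (f : nat -> R) (S : {set T}) a : a \in S ->
  part_sum f S = \sum_(V : {set T} | (V \subset S) && (a \in V))
     u #|V| * part_sum (fun j => f j.+1) (S :\: V).
Proof.
move=> aS; rewrite /part_sum.
rewrite (partition_big (fun P => pblock P a)
          (fun V => (V \subset S) && (a \in V))) /=; last first.
  move=> P partP; have [/eqP cov _ _] := and3P partP.
  rewrite mem_pblock cov aS andbT -cov; apply: (bigcup_sup (pblock P a)).
  by rewrite pblock_mem // cov.
apply: eq_bigr => V /andP[VS aV]; have V0 : V != set0 by apply/set0Pn; exists a.
rewrite (eq_bigl (fun P => partition P S && (V \in P))) => [|P]; last first.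
  apply: andb_id2l => partP; have [/eqP cov tI _] := and3P partP.
  apply/eqP/idP => [<-|VP]; first by rewrite pblock_mem // cov.
  exact: def_pblock.
rewrite partition_block_sum // mulr_sumr; apply: eq_bigr => P partP.
have VP := notin_partitionD V0 partP.
by rewrite block_prodU1 // cardsU1 VP mulrCA.
Qed.

Hypothesis u0 : u 0%N = 1.

Lemma part_sum_set0 (T : finType) (f : nat -> R) : part_sum f (set0 : {set T}) = f 0%N.
Proof.
rewrite /part_sum (eq_bigl (pred1 set0)) => [|P]; last first.
  by rewrite partition_set0.
by rewrite big_pred1_eq cards0 /block_prod big_set0 mulr1.
Qed.

(** The weight (-1)^j j! describes 1 / E, since 1 / (1 + x) = sum (-1)^j x^j and a
    set of j blocks can be ordered in j! ways. In the convolution of E with 1 / E, a term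
    is a partition with at most one marked block, and the partitions with k + 1 blocks
    contribute (k + 1) (-1)^k k! + (-1)^(k+1) (k+1)! = 0. *)
Lemma part_sum_inverse (T : finType) (S : {set T}) : S != set0 ->
  \sum_(V : {set T} | V \subset S)
     u #|V| * part_sum (fun j => (-1) ^+ j * j`!%:R) (S :\: V) = 0.
Proof.
move=> S0; rewrite (bigD1 set0) ?sub0set //= cards0 u0 mul1r setD0.
rewrite (eq_bigr (fun V => \sum_(P | partition P S && (V \in P))
     (-1) ^+ (#|P|.-1) * (#|P|.-1)`!%:R * block_prod u P)); last first.
  move=> V /andP[VS V0]; rewrite partition_block_sum // /part_sum mulr_sumr.
  apply: eq_bigr => P partP.
  have VP := notin_partitionD V0 partP.
  by rewrite block_prodU1 // cardsU1 VP /= mulrCA.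
rewrite (exchange_big_dep (fun P => partition P S)) /=; last by move=> V P _ /andP[].
rewrite -big_split /=; apply: big1 => P partP.
rewrite (eq_bigl (fun V => V \in P)) => [|V]; last first.
  rewrite partP /=; have [VP|] := boolP (V \in P); last by rewrite andbF.
  have [/eqP cov _ n0] := and3P partP.
  rewrite -cov /cover bigcup_sup //=.
  by rewrite andbT; apply: contraNneq n0 => <-.
rewrite sumr_const.
have : (0 < #|P|)%N.
  rewrite card_gt0; apply: contraNneq S0 => P0.
  by move: partP; rewrite P0 => /cover_partition; rewrite /cover big_set0 => <-.
case: #|P| => // k _ /=; rewrite exprS factS natrM -mulr_natl.
by rewrite !mulN1r !mulNr -!mulrA mul1r -[X in _ + X]mulr_natl [k.+1%:R * (_ * (_ * _))]mulrCA addNr.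
Qed.

Definition part_log (T : finType) : {set T} -> R :=
  part_sum (fun j => (-1) ^+ j.-1 * j.-1`!%:R).

(** As formal series (log E)' = E' / E. Splitting off from the partition the block B of
    a leaves the weights (-1)^j j! of 1 / E; convolved with E they sum to 0 unless B
    is all of S. *)
Lemma part_log_set_exp (T : finType) :
  set_exp (@part_log T) (fun S : {set T} => u #|S|).
Proof.
split=> [|S a aS]; first by rewrite cards0.
under eq_bigr => V /andP[VS aV].
  rewrite /part_log (part_sum_pointed _ aV) mulr_suml.
  over.
rewrite (exchange_big_dep (fun B : {set T} => (B \subset S) && (a \in B))) /=; last first.
  by move=> V B /andP[VS _] /andP[BV ->]; rewrite (subset_trans BV).
have conv (B : {set T}) : B \subset S -> a \in B ->
    \sum_(V : {set T} | ((V \subset S) && (a \in V)) && ((B \subset V) && (a \in B)))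
      u #|B| * part_sum (fun j => (-1) ^+ j * j`!%:R) (V :\: B) * u #|S :\: V| =
    u #|B| * \sum_(D : {set T} | D \subset S :\: B)
      u #|D| * part_sum (fun j => (-1) ^+ j * j`!%:R) ((S :\: B) :\: D).
  move=> BS aB; rewrite mulr_sumr.
  have SDD (V : {set T}) : V \subset S -> S :\: (S :\: V) = V.
    by move=> VS; rewrite setDDr setDv set0U; apply/setIidPr.
  rewrite (reindex_onto (fun D => S :\: D) (fun V => S :\: V)) /=; last first.
    by move=> V /andP[/andP[VS _] _]; exact: SDD.
  apply: eq_big => [D|D /andP[_ /eqP ->]].
    rewrite subsetDl aB !inE aS !andbT /= !subsetD BS /=.
    apply/idP/idP => [/andP[/andP[aD BD] /eqP eD]|/andP[DS BD]].
      by rewrite disjoint_sym BD andbT -eD subsetDl.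
    rewrite disjoint_sym BD SDD // eqxx !andbT.
    by apply: contraL aB => aD; rewrite (disjointFr BD).
  by rewrite -mulrA [_ * u #|D|]mulrC !setDDl setUC.
rewrite (bigD1 S) /=; last by rewrite subxx aS.
rewrite conv // setDv (big_pred1 set0) => [|D]; last first.
  by rewrite /= subset0.
rewrite cards0 u0 mul1r set0D part_sum_set0 expr0 !mulr1 big1 ?addr0 //.
move=> B /andP[/andP[BS aB] neBS]; rewrite conv // part_sum_inverse ?mulr0 //.
by rewrite setD_eq0; apply: contra neBS => SB; rewrite eqEsubset BS.
Qed.

End PartitionLog.

(** * Set functions that depend only on the cardinality *)
Section Numeric.
Variable R : comNzRingType.

Lemma set_exp_recursion (l e : nat -> R) n :
  set_exp (fun S : {set 'I_n.+1} => l #|S|) (fun S => e #|S|) ->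
  e n.+1 = \sum_(k < n.+1) 'C(n, k)%:R * (l k.+1 * e (n - k)%N).
Proof.
move=> [_ LE]; have := LE _ _ (in_setT ord0); rewrite cardsT card_ord => ->.
have := sum_pointed_subsets (fun k => l k * e (n.+1 - k)%N) (in_setT (@ord0 n)).
rewrite cardsT card_ord /= => <-; apply: eq_bigr => V _.
by rewrite cardsDS ?subsetT // cardsT card_ord.
Qed.

(** Used to move between the blocks of a set and the standard set with as many
    elements, on which the cumulants are defined. By induction on S, since the recursion
    for L only sees the cardinality. *)
Lemma set_exp_log_card (L : forall T : finType, {set T} -> R) (e : nat -> R) :
  (forall T, set_exp (L T) (fun S : {set T} => e #|S|)) ->
  forall (T : finType) (S : {set T}), S != set0 -> L T S = L _ [set: 'I_#|S|].
Proof.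
move=> LE T S; pose l k := L _ [set: 'I_k].
have [k] := ubnP #|S|; elim: k T S => // k IH T S ltSk S0.
have loc (T' : finType) (S' : {set T'}) b : #|S'| = #|S| -> b \in S' ->
    e #|S| = L _ S' + \sum_(j < #|S|.-1)
      'C(#|S|.-1, j)%:R * (l j.+1 * e (#|S| - j.+1)%N).
  move=> cS' bS'; have [E0 LE'] := LE T'.
  rewrite -cS' [LHS](LE' _ _ bS').
  rewrite (sum_over_block _ bS' (E := fun V => e #|V|)) //; congr (_ + _).
  rewrite -(sum_pointed_proper_subsets (fun j => l j * e (#|S'| - j)%N) bS').
  apply: eq_bigr => V /andP[pV bV].
  rewrite /= cardsDS ?proper_sub // IH //; last by apply/set0Pn; exists b.
  by apply: leq_trans (proper_card pV) _; rewrite cS' -ltnS.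
have [a aS] := set0Pn _ S0.
have S1 : (0 < #|S|)%N by rewrite card_gt0.
have := loc _ _ a erefl aS.
rewrite (loc _ [set: 'I_#|S|] (Ordinal S1)) ?cardsT ?card_ord ?inE //.
by move/addIr => ->.
Qed.

Lemma set_exp_card (l : nat -> R) (E : forall T : finType, {set T} -> R) :
  (forall T, set_exp (fun S : {set T} => l #|S|) (E T)) ->
  forall (T : finType) (S : {set T}), E T S = E _ [set: 'I_#|S|].
Proof.
move=> LE T S; pose e k := E _ [set: 'I_k].
have [k] := ubnP #|S|; elim: k T S => // k IH T S ltSk.
have [S0|S0] := eqVneq S set0.
  rewrite S0 (LE T).1 cards0 (_ : setT = set0) ?(LE _).1 //.
  by apply/setP => -[].
have loc (T' : finType) (S' : {set T'}) b : #|S'| = #|S| -> b \in S' ->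
    E _ S' = \sum_(j < #|S|) 'C(#|S|.-1, j)%:R * (l j.+1 * e (#|S| - j.+1)%N).
  move=> cS' bS'; rewrite ((LE T').2 _ _ bS') -cS'.
  rewrite -(sum_pointed_subsets (fun j => l j * e (#|S'| - j)%N) bS').
  apply: eq_bigr => V /andP[VS bV]; rewrite /e -cardsDS // IH //.
  have V0 : (0 < #|V|)%N by apply/card_gt0P; exists b.
  rewrite cardsDS // cS'; apply: leq_trans (_ : #|S| <= k)%N; last by rewrite -ltnS.
  by rewrite ltn_subrL V0 card_gt0.
have [a aS] := set0Pn _ S0.
have S1 : (0 < #|S|)%N by rewrite card_gt0.
by rewrite (loc _ _ a) // (loc _ [set: 'I_#|S|] (Ordinal S1)) ?cardsT ?card_ord.
Qed.

End Numeric.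

Lemma part_log_card (R : comNzRingType) (u : nat -> R) (T : finType) (S : {set T}) :
  u 0%N = 1 -> S != set0 -> part_log u S = part_log u [set: 'I_#|S|].
Proof.
by move=> u0; apply: (set_exp_log_card (L := part_log u) (part_log_set_exp u0)).
Qed.

(** * Pairs of permutations and their orbits *)
Section Perms.
Variable T : finType.
Implicit Types (s t : {perm T}) (S V : {set T}).

Definition perm_gen s t : {set {perm T}} := <<[set s; t]>>%g.

Definition transitive_on S s t : bool := [transitive perm_gen s t, on S | 'P]%act.

Lemma stableP V s : reflect {in V, forall x, s x \in V} (s \in 'N(V | 'P))%g.
Proof.
apply: (iffP idP) => [sV x xV|sV].
  by have := astabs_act x sV; rewrite xV.
by rewrite !inE; apply/subsetP => x xV; rewrite !inE /= apermE sV.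
Qed.

Lemma orbit_perm_gen_sub s t V a : a \in V ->
  (s \in 'N(V | 'P))%g -> (t \in 'N(V | 'P))%g -> orbit 'P (perm_gen s t) a \subset V.
Proof.
move=> aV sV tV; have acts : (<<[set s; t]>> \subset 'N(V | 'P))%g.
  by rewrite gen_subG subUset !sub1set sV tV.
by rewrite (acts_sub_orbit a acts).
Qed.

Lemma stable_orbit s t a :
  (s \in 'N(orbit 'P (perm_gen s t) a | 'P))%g /\
  (t \in 'N(orbit 'P (perm_gen s t) a | 'P))%g.
Proof.
have := acts_orbit 'P a (subsetT <<[set s; t]>>%g).
by rewrite gen_subG subUset !sub1set => /andP[].
Qed.

Lemma eq_orbit_perm_gen s t s' t' V a : a \in V ->
  (s \in 'N(V | 'P))%g -> (t \in 'N(V | 'P))%g ->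
  {in V, s =1 s'} -> {in V, t =1 t'} ->
  orbit 'P (perm_gen s t) a = orbit 'P (perm_gen s' t') a.
Proof.
move=> aV sV tV es et.
have s'V : (s' \in 'N(V | 'P))%g.
  by apply/stableP => x xV; rewrite -es //; move/stableP: sV; apply.
have t'V : (t' \in 'N(V | 'P))%g.
  by apply/stableP => x xV; rewrite -et //; move/stableP: tV; apply.
have incl s1 t1 s2 t2 : (s1 \in 'N(V | 'P))%g -> (t1 \in 'N(V | 'P))%g ->
    {in V, s1 =1 s2} -> {in V, t1 =1 t2} ->
    orbit 'P (perm_gen s2 t2) a \subset orbit 'P (perm_gen s1 t1) a.
  move=> s1V t1V e1 e2; have [O1 O2] := stable_orbit s1 t1 a.
  have sub := subsetP (orbit_perm_gen_sub aV s1V t1V).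
  apply: orbit_perm_gen_sub; first exact: orbit_refl.
    apply/stableP => x xO; rewrite -e1 ?sub //; by move/stableP: O1; apply.
  apply/stableP => x xO; rewrite -e2 ?sub //; by move/stableP: O2; apply.
apply/eqP; rewrite eqEsubset !incl // => x xV; by rewrite ?es ?et.
Qed.

Lemma transitive_onE S s t a : a \in S ->
  transitive_on S s t = (orbit 'P (perm_gen s t) a == S).
Proof.
move=> aS; apply/idP/eqP => [tr|<-]; first exact: (atransP tr).
by rewrite /transitive_on /atrans imset_f // orbit_refl.
Qed.

Lemma porbit_gen s a : porbit s a = orbit 'P (perm_gen s s) a.
Proof. by rewrite porbitE /perm_gen finset.setUid. Qed.

Lemma porbit_sub s V a : a \in V -> (s \in 'N(V | 'P))%g -> porbit s a \subset V.
Proof. by move=> aV sV; rewrite porbit_gen orbit_perm_gen_sub. Qed.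

Lemma eq_porbit s s' V a : a \in V -> (s \in 'N(V | 'P))%g -> {in V, s =1 s'} ->
  porbit s a = porbit s' a.
Proof. by move=> aV sV es; rewrite !porbit_gen (eq_orbit_perm_gen aV sV sV es es). Qed.

Lemma Sym_stable S s : s \in Sym S -> (s \in 'N(S | 'P))%g.
Proof. by rewrite inE => on; apply/stableP => x xS; rewrite perm_closed. Qed.

Lemma permM_on S V s1 s2 x : s1 \in Sym V -> s2 \in Sym (S :\: V) ->
  (s1 * s2)%g x = if x \in V then s1 x else s2 x.
Proof.
rewrite !inE permM => on1 on2; case: ifP => xV.
  by rewrite (out_perm on2) // !inE perm_closed // xV.
by rewrite (out_perm on1) ?xV.
Qed.

Lemma permM_stable S V s1 s2 : s1 \in Sym V -> s2 \in Sym (S :\: V) ->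
  ((s1 * s2)%g \in 'N(V | 'P))%g.
Proof.
move=> S1 S2; apply/stableP => x xV; rewrite (permM_on _ S1 S2) xV.
by rewrite inE in S1; rewrite perm_closed.
Qed.

(** Restriction to V and to its complement is inverse to multiplication. *)
Lemma Sym_decomp (R : nmodType) (F : {perm T} -> R) S V : V \subset S ->
  \sum_(s in Sym S | s \in 'N(V | 'P)%g) F s =
  \sum_(s1 in Sym V) \sum_(s2 in Sym (S :\: V)) F (s1 * s2)%g.
Proof.
move=> VS; rewrite pair_big_dep /=.
pose r U := restr_perm U : {perm T} -> {perm T}.
have rE U s x : (s \in 'N(U | 'P))%g -> r U s x = if x \in U then s x else x.
  move=> sU; case: ifP => xU; first by rewrite /r restr_permE.
  by rewrite (out_perm (restr_perm_on U s)) ?xU.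
rewrite (reindex_onto (fun p : {perm T} * {perm T} => (p.1 * p.2)%g)
   (fun s => (r V s, r (S :\: V) s))) /=; last first.
  move=> s /andP[SymS sV]; have sS := Sym_stable SymS.
  have sD : (s \in 'N(S :\: V | 'P))%g.
    apply/stableP => y; rewrite !inE => /andP[yV yS].
    by rewrite -!apermE (astabs_act y sV) (astabs_act y sS) yV.
  apply/permP => x; rewrite (@permM_on S V) ?inE ?restr_perm_on // !rE // !inE.
  case: (boolP (x \in V)) => //= xV; case: ifP => // xS.
  by rewrite inE in SymS; rewrite (out_perm SymS) ?xS.
apply: eq_bigl => -[s1 s2] /=; apply/idP/idP => [/andP[_ /eqP[<- <-]]|/andP[S1 S2]].
  by rewrite !inE !restr_perm_on.
have sV := permM_stable S1 S2.
have sD : ((s1 * s2)%g \in 'N(S :\: V | 'P))%g.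
  apply/stableP => x xD; rewrite (permM_on _ S1 S2).
  by case: ifP => xV; [rewrite inE xV in xD | rewrite inE in S2; rewrite perm_closed].
rewrite sV andbT; apply/andP; split.
  rewrite inE; apply/subsetP => x; rewrite !inE (permM_on _ S1 S2).
  rewrite !inE in S1 S2; case: ifP => xV; first by move=> _; exact: (subsetP VS).
  by apply: contraR => xS; rewrite (out_perm S2) // inE xV.
apply/eqP; congr (_, _); apply/permP => x; rewrite rE // (permM_on _ S1 S2).
  by case: (boolP (x \in V)) => // xV; rewrite inE in S1; rewrite (out_perm S1).
rewrite inE in S2; rewrite !inE; case: (boolP (x \in V)) => /= xV.
  by rewrite (out_perm S2) // !inE xV.
by case: (boolP (x \in S)) => xS //; rewrite (out_perm S2) // !inE (negPf xS) andbF.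
Qed.

Variable R : comNzRingType.
Implicit Types u v : nat -> R.

Definition cycle_prod u S s : R := block_prod u (porbit s @: S).

Definition perm_sum u S : R := \sum_(s in Sym S) cycle_prod u S s.

Definition transitive_sum u v S : R :=
  \sum_(s in Sym S) \sum_(t in Sym S | transitive_on S s t)
    cycle_prod u S s * cycle_prod v S t.

Lemma imset_porbitM S V s1 s2 : V \subset S -> s1 \in Sym V -> s2 \in Sym (S :\: V) ->
  porbit (s1 * s2)%g @: S = porbit s1 @: V :|: porbit s2 @: (S :\: V).
Proof.
move=> VS S1 S2; rewrite -{1}(finset.setID S V).
have /setIidPr -> := VS; rewrite imsetU; congr (_ :|: _); apply: eq_in_imset => x.
  move=> xV; apply/esym/(eq_porbit xV (Sym_stable S1)) => y yV.
  by rewrite (permM_on _ S1 S2) yV.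
move=> xV; apply/esym/(eq_porbit xV (Sym_stable S2)) => y.
by rewrite (permM_on _ S1 S2) inE => /andP[/negPf -> _].
Qed.

Lemma imset_porbit_disjoint S V s1 s2 : s2 \in Sym (S :\: V) ->
  [disjoint porbit s1 @: V & porbit s2 @: (S :\: V)].
Proof.
move=> S2; rewrite -setI_eq0; apply/eqP/setP => W; rewrite !inE; apply/andP.
move=> -[/imsetP[x xV ->] /imsetP[y yD eW]].
have xy : x \in porbit s2 y by rewrite -eW porbit_id.
have := subsetP (porbit_sub yD (Sym_stable S2)) x xy.
by rewrite inE xV.
Qed.

Lemma cycle_prodM u S V s1 s2 : V \subset S -> s1 \in Sym V -> s2 \in Sym (S :\: V) ->
  cycle_prod u S (s1 * s2)%g = cycle_prod u V s1 * cycle_prod u (S :\: V) s2.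
Proof.
move=> VS S1 S2; rewrite /cycle_prod /block_prod (imset_porbitM VS S1 S2).
rewrite -bigU /=; first by apply: eq_bigl => W; rewrite !inE.
exact: imset_porbit_disjoint.
Qed.

Lemma perm_sum0 u : perm_sum u set0 = 1.
Proof.
rewrite /perm_sum (big_pred1 1%g) => [|s].
  by rewrite /cycle_prod imset0 /block_prod big_set0.
rewrite /= inE; apply/idP/eqP => [on|->]; last exact: perm_on1.
by apply: perm_on_id on _; rewrite cards0.
Qed.

(** The pairs of permutations of S are sorted by the orbit V of a under the group
    generated by the pair: they restrict to a transitive pair on V and to an arbitrary
    pair on the complement, and cycle products are multiplicative. *)
Lemma transitive_sum_set_exp u v :
  set_exp (transitive_sum u v) (fun S => perm_sum u S * perm_sum v S).
Proof.
split=> [|S a aS]; first by rewrite !perm_sum0 mulr1.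
rewrite /perm_sum big_distrlr /=.
pose O s t := orbit 'P (perm_gen s t) a.
pose w s t := cycle_prod u S s * cycle_prod v S t.
have OS s t : s \in Sym S -> t \in Sym S -> O s t \subset S.
  by move=> /Sym_stable ? /Sym_stable ?; exact: orbit_perm_gen_sub.
(* Both permutations stabilise the orbit V, so the condition of stabilising V may be
   imposed on each of them separately before Sym_decomp is applied. *)
transitivity (\sum_(V : {set T} | (V \subset S) && (a \in V))
    \sum_(s in Sym S | s \in 'N(V | 'P)%g)
    \sum_(t in Sym S | t \in 'N(V | 'P)%g) (O s t == V)%:R * w s t).
  under [RHS]eq_bigr => V _ do rewrite big_mkcondr /=.
  rewrite [RHS]exchange_big /=; apply: eq_bigr => s Ss.
  under [RHS]eq_bigr => V _.
    rewrite (_ : (if _ then _ else _) =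
      \sum_(t in Sym S) (O s t == V)%:R * w s t); last first.
      case: ifPn => sV; last first.
        rewrite big1 // => t St; have [sO _] := stable_orbit s t a.
        case: eqP => [eV|]; last by rewrite mul0r.
        by move: sO; rewrite -/(O s t) eV (negPf sV).
      rewrite big_mkcondr /=; apply: eq_bigr => t St; case: ifPn => // tV.
      have [_ tO] := stable_orbit s t a.
      case: eqP => [eV|]; last by rewrite mul0r.
      by move: tO; rewrite -/(O s t) eV (negPf tV).
    over.
  rewrite [RHS]exchange_big /=; apply: eq_bigr => t St.
  rewrite (bigD1 (O s t)) /=; last by rewrite OS //= orbit_refl.
  rewrite eqxx mul1r big1 ?addr0 // => V /andP[_ neV].
  by rewrite eq_sym (negPf neV) mul0r.
apply: eq_bigr => V /andP[VS aV].
rewrite Sym_decomp // /transitive_sum.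
under [LHS]eq_bigr => s1 _. under eq_bigr => s2 _ do rewrite Sym_decomp //. over.
rewrite mulr_suml; apply: eq_bigr => s1 S1.
rewrite [LHS]exchange_big /= big_mkcondr mulr_suml /=.
apply: eq_bigr => t1 T1.
rewrite [X in X * _](_ : _ = (transitive_on V s1 t1)%:R *
  (cycle_prod u V s1 * cycle_prod v V t1)); last by case: ifP; rewrite ?mul1r ?mul0r.
rewrite big_distrlr mulr_sumr /=; apply: eq_bigr => s2 S2.
rewrite mulr_sumr; apply: eq_bigr => t2 T2.
rewrite /w !(@cycle_prodM _ _ V) // (transitive_onE _ _ aV) /O.
rewrite (@eq_orbit_perm_gen (s1 * s2)%g (t1 * t2)%g s1 t1 V) ?permM_stable //.
- by rewrite -[RHS]mulrA; congr (_ * _); exact: mulrACA.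
- exact: permM_stable S1 S2.
- exact: permM_stable T1 T2.
- by move=> x xV; rewrite (permM_on _ S1 S2) xV.
- by move=> x xV; rewrite (permM_on _ T1 T2) xV.
Qed.

(** The weight that is 1 on fixed points and 0 on longer cycles forces the second
    permutation to be the identity, so that statements on pairs specialise to
    statements on a single permutation. *)
Lemma cycle_prod_id S s : s \in Sym S ->
  cycle_prod (fun k => (k == 1)%N%:R) S s = (s == 1%g)%:R.
Proof.
move=> Ss; have [->|s1] := eqVneq s 1%g.
  rewrite /cycle_prod /block_prod big1 // => W /imsetP[x _ ->].
  have := subset_leq_card (porbit_sub (set11 x) (group1 'N([set x] | 'P)%G)).
  by rewrite cards1; case: #|_| (card_porbit_neq0 1 x) => [|[]].
have [x sx] : exists x, s x != x.
  apply/existsP; move: s1; apply: contraR; rewrite negb_exists => /forallP id_s.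
  by apply/eqP/permP => x; rewrite perm1; apply/eqP; rewrite -[_ == _]negbK.
have xS : x \in S by rewrite inE in Ss; exact: (subsetP Ss).
rewrite /cycle_prod /block_prod (bigD1 (porbit s x)) ?imset_f //=.
case: eqP => [/eqP/cards1P[y ey]|]; last by rewrite mul0r.
have := porbit_id s x; have := mem_porbit s 1 x.
rewrite ey !inE expg1 => /eqP exy /eqP xy.
by move: sx; rewrite exy xy eqxx.
Qed.

Lemma perm_sum_id S : perm_sum (fun k => (k == 1)%N%:R) S = 1.
Proof.
rewrite /perm_sum (eq_bigr _ (fun s => @cycle_prod_id S s)).
rewrite (bigD1 1%g) /=; last by rewrite inE perm_on1.
by rewrite eqxx big1 ?addr0 // => s /andP[_ /negPf ->].
Qed.

Definition long_cycles S : {set {perm T}} := [set s in Sym S | S \in porbit s @: S].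

Lemma long_cyclesE S s a : a \in S ->
  (s \in long_cycles S) = (s \in Sym S) && (porbit s a == S).
Proof.
move=> aS; rewrite inE; apply: andb_id2l => _; apply/imsetP/eqP => [[x xS eS]|eS].
  by apply/esym; rewrite {1}eS; apply/eqP; rewrite eq_porbit_mem porbit_sym -eS.
by exists a; rewrite ?eS.
Qed.

Lemma cycle_prod_long u S s : S != set0 -> s \in long_cycles S ->
  cycle_prod u S s = u #|S|.
Proof.
move=> S0; have [a aS] := set0Pn _ S0; rewrite (long_cyclesE _ aS) => /andP[_ /eqP eS].
rewrite /cycle_prod /block_prod (_ : porbit s @: S = [set S]) ?big_set1 //.
apply/setP => W; rewrite !inE; apply/imsetP/eqP => [[x xS ->]|->]; last by exists a.
by apply/eqP; rewrite -[X in _ == X]eS eq_porbit_mem eS.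
Qed.

Lemma transitive_sum_id u S : S != set0 ->
  transitive_sum u (fun k => (k == 1)%N%:R) S = u #|S| * #|long_cycles S|%:R.
Proof.
move=> S0; have [a aS] := set0Pn _ S0.
have gen1 s : perm_gen s 1 = <[s]>%g.
  apply/eqP; rewrite eqEsubset gen_subG subUset !sub1set cycle_id group1 /=.
  by rewrite cycle_subG mem_gen // !inE eqxx.
rewrite /transitive_sum; transitivity (\sum_(s in long_cycles S) u #|S|).
  rewrite [RHS](eq_bigl _ _ (fun s => long_cyclesE s aS)) [RHS]big_mkcondr /=.
  apply: eq_bigr => s Ss.
  rewrite -[porbit s a == S](_ : transitive_on S s 1 = _); last first.
    by rewrite (transitive_onE _ _ aS) gen1 -porbitE.
  rewrite big_mkcondr /= (bigD1 1%g) /=; last by rewrite inE perm_on1.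
  rewrite [X in _ + X]big1 ?addr0; last first.
    move=> t /andP[St t1]; rewrite cycle_prod_id // (negPf t1) mulr0.
    by case: ifP.
  case: ifP => // tr; rewrite cycle_prod_id ?inE ?perm_on1 // eqxx mulr1.
  apply: cycle_prod_long => //; rewrite (long_cyclesE _ aS) Ss.
  by rewrite porbitE -gen1 -transitive_onE.
by rewrite sumr_const mulr_natr.
Qed.

Lemma long_cycles_set_exp u :
  set_exp (fun S => u #|S| * #|long_cycles S|%:R) (perm_sum u).
Proof.
have [E0 LE] := transitive_sum_set_exp u (fun k => (k == 1)%N%:R).
split=> [|S a aS]; first exact: perm_sum0.
have := LE _ _ aS; rewrite /= perm_sum_id mulr1 => ->.
apply: eq_bigr => V /andP[VS aV]; rewrite perm_sum_id mulr1 transitive_sum_id //.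
by apply/set0Pn; exists a.
Qed.

End Perms.

(** Both the numbers of long cycles and the (n-1)! are logarithms of n!. *)
Lemma card_long_cycles (T : finType) (S : {set T}) : S != set0 ->
  #|long_cycles S| = (#|S|.-1)`!.
Proof.
move=> S0; apply/eqP; rewrite -(eqr_nat rat); apply/eqP.
have [E0 LE] := long_cycles_set_exp T (fun=> 1 : rat).
have sE (U : {set T}) : perm_sum (fun=> 1 : rat) U = (#|U|`!)%:R.
  rewrite /perm_sum (eq_bigr (fun=> 1)) ?sumr_const ?card_Sym // => s _.
  by rewrite /cycle_prod /block_prod big1.
have H1 : set_exp (fun U : {set T} => #|long_cycles U|%:R : rat) (fun U => (#|U|`!)%:R).
  split=> [|U a aU]; first by rewrite cards0.
  by rewrite -sE (LE _ _ aU); apply: eq_bigr => V _; rewrite mul1r sE.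
have H2 : set_exp (fun U : {set T} => (#|U|.-1`!)%:R : rat) (fun U => (#|U|`!)%:R).
  apply: (@set_exp_numeric _ _ (fun n => n.-1`!%:R) (fun n => n`!%:R)) => // n.
  rewrite (eq_bigr (fun=> n`!%:R)) ?sumr_const ?card_ord ?factS ?natrM ?mulr_natl //.
  move=> k _; rewrite -!natrM; congr (_%:R); rewrite /=.
  by apply: bin_fact; rewrite -ltnS.
exact: (set_exp_log H1 H2).
Qed.

(** A permutation is a set of cycles, and a block of size k carries (k-1)! of them. *)
Lemma perm_sum_set_exp (R : comNzRingType) (T : finType) (u : nat -> R) :
  set_exp (fun S : {set T} => (#|S|.-1)`!%:R * u #|S|) (perm_sum u).
Proof.
have [E0 LE] := long_cycles_set_exp T u.
split=> // S a aS; rewrite (LE _ _ aS); apply: eq_bigr => V /andP[_ aV].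
have V0 : V != set0 by apply/set0Pn; exists a.
by rewrite card_long_cycles // [u _ * _]mulrC.
Qed.

(** * Newton's identities *)
Section Newton.
Variable R : comNzRingType.
Implicit Types (s : seq R) (z : R).

Definition rev_prod s : {poly R} := \prod_(z <- s) (1 - z *: 'X).

Lemma coef_rev_prod_cons0 z s : (rev_prod (z :: s))`_0 = (rev_prod s)`_0.
Proof.
by rewrite /rev_prod big_cons mulrBl mul1r coefB -scalerAl coefZ coefXM mulr0 subr0.
Qed.

Lemma coef_rev_prod_consS z s k :
  (rev_prod (z :: s))`_k.+1 = (rev_prod s)`_k.+1 - z * (rev_prod s)`_k.
Proof. by rewrite /rev_prod big_cons mulrBl mul1r coefB -scalerAl coefZ coefXM. Qed.

Lemma coef0_rev_prod s : (rev_prod s)`_0 = 1.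
Proof.
elim: s => [|z s IH]; first by rewrite /rev_prod big_nil coef1.
by rewrite coef_rev_prod_cons0.
Qed.

(** This is x P' = - (sum of z x / (1 - z x)) P for P the product of the 1 - z x; the
    induction adds one root at a time. *)
Lemma newton_identity s k :
  k.+1%:R * (rev_prod s)`_k.+1 =
  - \sum_(i < k.+1) (\sum_(z <- s) z ^+ i.+1) * (rev_prod s)`_(k - i).
Proof.
elim: s k => [|z s IH] k.
  rewrite /rev_prod big_nil coef1 mulr0 big1 ?oppr0 // => i _.
  by rewrite big_nil mul0r.
set a := rev_prod s in IH *; set b := rev_prod (z :: s).
have geo j : \sum_(i < j.+1) z ^+ i.+1 * b`_(j - i) = z * a`_j.
  elim: j => [|j IHj].
    by rewrite big_ord_recl big_ord0 addr0 expr1 coef_rev_prod_cons0.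
  rewrite big_ord_recl /= expr1 subn0 coef_rev_prod_consS.
  under eq_bigr => i _ do rewrite /bump /= add1n subSS exprS -mulrA.
  by rewrite -mulr_sumr IHj; ring.
under eq_bigr => i _ do rewrite big_cons mulrDl.
rewrite big_split /= geo coef_rev_prod_consS -/a mulrBr IH.
case: k => [|k] in geo *.
  by rewrite !big_ord_recl !big_ord0 /= coef_rev_prod_cons0 -/a; ring.
rewrite [in RHS]big_ord_recr [in LHS]big_ord_recr /= subnn coef_rev_prod_cons0 -/a.
have -> : \sum_(i < k.+1) (\sum_(w <- s) w ^+ i.+1) * b`_(k.+1 - i) =
    \sum_(i < k.+1) (\sum_(w <- s) w ^+ i.+1) * a`_(k.+1 - i) -
    z * \sum_(i < k.+1) (\sum_(w <- s) w ^+ i.+1) * a`_(k - i).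
  rewrite mulr_sumr -sumrB; apply: eq_bigr => i _.
  by rewrite subSn -1?ltnS // coef_rev_prod_consS -/a; ring.
rewrite -[\sum_(i < k.+1) _ * a`_(k - i)]opprK -IH.
by rewrite -[k.+2%:R]natr1; ring.
Qed.

Lemma size_rev_prod s : (size (rev_prod s) <= (size s).+1)%N.
Proof.
apply/leq_sizeP; elim: s => [|z s IH] j.
  by rewrite /rev_prod big_nil coef1; case: j.
case: j => // j; rewrite ltnS => lt_sj.
by rewrite coef_rev_prod_consS !IH ?mulr0 ?subr0 // leqW.
Qed.

Lemma coef_prod_XsubC_rev s k : (k <= size s)%N ->
  (\prod_(z <- s) ('X - z%:P))`_(size s - k) = (rev_prod s)`_k.
Proof.
elim: s k => [|z s IH] k.
  by rewrite leqn0 => /eqP ->; rewrite /rev_prod !big_nil.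
have top : (\prod_(w <- s) ('X - w%:P))`_(size s).+1 = 0.
  by rewrite nth_default // size_prod_XsubC.
rewrite big_cons mulrBl coefB coefXM coefCM /=; case: k => [|k] lek.
  by rewrite subn0 top mulr0 subr0 /= coef_rev_prod_cons0 -IH ?subn0.
rewrite subSS coef_rev_prod_consS -(IH k) //; congr (_ - _).
move: lek; rewrite ltnS leq_eqVlt => /orP[/eqP ->|ltk].
  by rewrite subnn /= nth_default //; exact: size_rev_prod.
rewrite -IH //; have -> : (size s - k)%N = (size s - k.+1).+1 by rewrite subnSK.
by [].
Qed.

(** Newton's identities say that minus the power sums form the logarithm of the
    product of the 1 - z x. *)
Lemma newton_set_exp (T : finType) s :
  set_exp (fun S : {set T} => - ((#|S|.-1)`!%:R * \sum_(z <- s) z ^+ #|S|))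
          (fun S => #|S|`!%:R * (rev_prod s)`_#|S|).
Proof.
apply: (@set_exp_numeric _ _ (fun n => - (n.-1`!%:R * \sum_(z <- s) z ^+ n))
    (fun n => n`!%:R * (rev_prod s)`_n)).
  by rewrite coef0_rev_prod mulr1.
move=> n; rewrite factS natrM [_ * n`!%:R]mulrC -mulrA newton_identity mulrN mulr_sumr.
rewrite -sumrN; apply: eq_bigr => k _ /=.
rewrite -(@bin_fact n k) ?natrM; last by rewrite -ltnS.
ring.
Qed.

End Newton.

Lemma set_exp_scale (R : comNzRingType) (T : finType) (z : R) (L E : {set T} -> R) :
  set_exp L E -> set_exp (fun S => z ^+ #|S| * L S) (fun S => z ^+ #|S| * E S).
Proof.
move=> [E0 LE]; split=> [|S a aS]; first by rewrite cards0 mul1r.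
rewrite (LE _ _ aS) mulr_sumr; apply: eq_bigr => V /andP[VS _].
by rewrite -(cardsID V S) (finset.setIidPr VS) exprD mulrACA.
Qed.

(** Newton's identities for d roots equal to 1, with product (1 - x)^d. This identifies
    the binomial coefficients in the definition of the e_k(p) with a sum over
    permutations. *)
Lemma perm_sum_const (R : comNzRingType) (T : finType) (d : nat) (S : {set T}) :
  perm_sum (fun=> - d%:R : R) S = #|S|`!%:R * ((-1) ^+ #|S| * 'C(d, #|S|)%:R).
Proof.
have H := perm_sum_set_exp T (fun=> - d%:R : R).
have H' := newton_set_exp T (nseq d (1 : R)).
have -> : (-1) ^+ #|S| * 'C(d, #|S|)%:R = (rev_prod (nseq d (1 : R)))`_#|S|.
  rewrite /rev_prod big_nseq scale1r; elim: d #|S| {H H'} => [|d IH] [|k] //=.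
  - by rewrite coef1 bin0 mul1r.
  - by rewrite coef1 mulr0.
  - by rewrite mulrBl [1 * iter _ _ _]mul1r coefB coefXM /= subr0 -IH !bin0.
  - rewrite mulrBl [1 * iter _ _ _]mul1r coefB coefXM /= -!IH binS natrD exprS; ring.
apply: set_exp_uniq H H' S => V _.
rewrite big_nseq (_ : iter _ _ _ = d%:R) ?mulrN //.
by elim: d => //= d ->; rewrite expr1n nat1r.
Qed.

Lemma card_porbits_gt0 (T : finType) (x : T) (s : {perm T}) : (0 < #|porbits s|)%N.
Proof. by apply/card_gt0P; exists (porbit s x); exact: imset_f. Qed.

Lemma transitive_onC (T : finType) (S : {set T}) s t :
  transitive_on S s t = transitive_on S t s.
Proof. by rewrite /transitive_on /perm_gen finset.setUC. Qed.

(** * The genus inequality for transitive pairs *)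
Section Genus.
Variable n : nat.
Implicit Types s t : {perm 'I_n}.
Let P s : 'M[rat]_n := perm_mx s.

Lemma mul_vec_perm (v : 'rV[rat]_n) s j : (v *m perm_mx s) 0 j = v 0 (s^-1%g j).
Proof. by rewrite -[s in LHS]invgK -col_permE mxE. Qed.

(** The indicator functions of the cycles are linearly independent and fixed by P s, hence
    in the kernel of 1 - P s. *)
Lemma rank_sub_perm_mx s : (\rank (1%:M - P s)%R + #|porbits s| <= n)%N.
Proof.
pose c (k : 'I_#|porbits s|) : {set 'I_n} := enum_val k.
have [rep repP] : exists rep : 'I_#|porbits s| -> 'I_n, forall k, c k = porbit s (rep k).
  have ex k : exists x, c k == porbit s x.
    by have /imsetP[x _ ex] := enum_valP k; exists x; rewrite /c ex.
  by exists (fun k => xchoose (ex k)) => k; apply/eqP/(xchooseP (ex k)).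
pose M : 'M[rat]_(#|porbits s|, n) := \matrix_(k, x) (x \in c k)%:R.
have freeM : row_free M.
  apply/row_freeP; exists (\matrix_(x, k) (x == rep k)%:R).
  apply/matrixP => k l; rewrite !mxE (bigD1 (rep l)) //= !mxE eqxx mulr1 big1 ?addr0.
    rewrite repP -eq_porbit_mem -!repP; congr (_%:R); congr nat_of_bool.
    by apply/eqP/eqP => [/enum_val_inj|->].
  by move=> x /negPf neq; rewrite !mxE neq mulr0.
have kerM : (M <= kermx (1%:M - P s)%R)%MS.
  apply/sub_kermxP; rewrite mulmxBr mulmx1; apply/eqP; rewrite subr_eq0; apply/eqP.
  apply/row_matrixP => k; rewrite row_mul; apply/rowP => j; rewrite mul_vec_perm !mxE.
  rewrite repP -!eq_porbit_mem; congr (_%:R); congr nat_of_bool; congr (_ == _).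
  by have := porbit_perm s 1 (s^-1 j)%g; rewrite expg1 permKV.
have := mxrankS kerM; rewrite mxrank_ker; move/eqP: freeM => ->.
have := rank_leq_row (1%:M - P s); lia.
Qed.

Lemma rank_row_mx_ge m (A : 'M[rat]_(n, m)) (B : 'M[rat]_n) :
  (forall v : 'rV_n, v *m A = 0 -> v *m B = 0 -> forall i j, v 0 i = v 0 j) ->
  (n <= (\rank (row_mx A B)).+1)%N.
Proof.
move=> const; have : (\rank (kermx (row_mx A B)) <= 1)%N.
  apply: leq_trans (rank_leq_row (const_mx 1 : 'rV[rat]_n)).
  apply: mxrankS; apply/row_subP => i.
  have [H1 H2] : row i (kermx (row_mx A B)) *m A = 0 /\ row i (kermx (row_mx A B)) *m B = 0.
    apply: eq_row_mx; rewrite -mul_mx_row row_mx0 -row_mul; apply/rowP => j.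
    by rewrite mulmx_ker !mxE.
  set v := row i _ in H1 H2 *; have cv := const v H1 H2.
  apply/sub_rVP; exists (v 0 (Ordinal (leq_ltn_trans (leq0n _) (ltn_ord i)))).
  by apply/rowP => j; rewrite [RHS]mxE [const_mx _ _ _]mxE mulr1; exact: cv.
rewrite mxrank_ker; lia.
Qed.

Lemma fixed_const (v : 'rV[rat]_n) s t : transitive_on setT s t ->
  (forall j, v 0 (s j) = v 0 j) -> (forall j, v 0 (t j) = v 0 j) ->
  forall i j, v 0 i = v 0 j.
Proof.
move=> tr vs vt i j.
have : orbit 'P (perm_gen s t) j \subset [set x | v 0 x == v 0 j].
  apply: orbit_perm_gen_sub; first by rewrite inE.
    by apply/stableP => x; rewrite !inE vs.
  by apply/stableP => x; rewrite !inE vt.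
have /eqP -> := etrans (esym (transitive_onE s t (finset.in_setT j))) tr.
by move/subsetP/(_ i); rewrite !inE => /(_ isT)/eqP.
Qed.

(** The rank of 1 - P s is at most n - |s|. Frobenius' rank inequality
    rk(X Y) + rk(Y Z) <= rk(Y) + rk(X Y Z), for X = (1, P s), Y = diag (1 - P s, 1 - P t)
    and Z = (1, 1)^T, has X Y Z = 1 - P (s t) since the middle terms cancel. By
    transitivity only constant vectors are killed by X Y or by Y Z, so that both have
    rank at least n - 1. *)
Lemma genus_ineq s t : transitive_on setT s t ->
  (#|porbits s| + #|porbits t| + #|porbits (s * t)%g| <= n.+2)%N.
Proof.
move=> tr.
have fixP (v : 'rV[rat]_n) r : v *m (1%:M - P r) = 0 -> forall j, v 0 (r j) = v 0 j.
  move/eqP; rewrite mulmxBr mulmx1 subr_eq0 => /eqP vE j.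
  by rewrite {1}vE mul_vec_perm permK.
have := mxrank_Frobenius (row_mx 1%:M (P s))
  (block_mx (1%:M - P s) 0 0 (1%:M - P t)) (col_mx 1%:M 1%:M).
rewrite mul_row_block mul_block_col mul_row_col !mul1mx !mulmx0 !mulmx1 ?mul0mx.
rewrite !addr0 !add0r rank_diag_block_mx mulmxBr mulmx1 -perm_mxM subrKA -[perm_mx (s * t)]/(P _).
have r1 : (n <= (\rank (row_mx (1%:M - P s)%R (P s - P (s * t)%g)%R)).+1)%N.
  apply: rank_row_mx_ge => v H1 H2; apply: (fixed_const tr); first exact: fixP.
  apply: fixP; apply/eqP; rewrite mulmxBr mulmx1 subr_eq0; apply/eqP.
  move/eqP: H1; rewrite mulmxBr mulmx1 subr_eq0 => /eqP vs.
  move/eqP: H2; rewrite mulmxBr -vs subr_eq0 [P (s * t)%g]perm_mxM mulmxA -vs.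
  by move/eqP.
have r2 : (n <= (\rank (col_mx (1%:M - P s)%R (1%:M - P t)%R)).+1)%N.
  rewrite -mxrank_tr tr_col_mx; apply: rank_row_mx_ge => v.
  have fixV r : v *m (1%:M - P r)^T = 0 -> forall j, v 0 (r j) = v 0 j.
    rewrite linearB /= trmx1 tr_perm_mx => /fixP H j.
    by rewrite -[in RHS](permK r j) H.
  by move=> H1 H2; apply: (fixed_const tr); exact: fixV.
have := rank_sub_perm_mx s; have := rank_sub_perm_mx t.
have := rank_sub_perm_mx (s * t)%g.
move: r1 r2; move: (\rank (row_mx _ _)) (\rank (col_mx _ _)) => a b.
move: (\rank (_ - P s)) (\rank (_ - P t)) (\rank (_ - P _)) => x y z.
move: #|porbits s| #|porbits t| #|porbits (s * t)%g| => i j k; lia.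
Qed.

(** The signature of s is (-1)^(n - |s|), and it is multiplicative. *)
Lemma genus_parity s t :
  odd (#|porbits s| + #|porbits t| + #|porbits (s * t)%g|) = odd n.
Proof.
have := odd_permM s t; rewrite /odd_perm card_ord !oddD.
by case: (odd n); case: (odd #|porbits s|); case: (odd #|porbits t|);
   case: (odd #|porbits (s * t)%g|).
Qed.

End Genus.

(** * Permutations with increasing cycles *)
Local Open Scope nat_scope.

Lemma partition_porbits (T : finType) (s : {perm T}) : partition (porbits s) setT.
Proof.
rewrite (_ : porbits s = [set orbit 'P <[s]>%g x | x in setT]).
  by apply: orbit_partition; apply/subsetP => r _; apply/stableP.
by apply/setP => V; apply/imsetP/imsetP => -[x _ ->]; exists x; rewrite // porbitE.
Qed.

Lemma pblock_porbits (T : finType) (s : {perm T}) x : pblock (porbits s) x = porbit s x.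
Proof.
apply: def_pblock (porbit_id s x); last exact: imset_f.
exact: partition_trivIset (partition_porbits s).
Qed.

Section IncreasingCycles.
Variable n : nat.
Implicit Types (s t : {perm 'I_n}) (V W : {set 'I_n}) (P : {set {set 'I_n}}) (x y z : 'I_n).

Let ltI : rel 'I_n := fun i j => (i < j)%N.

Lemma sorted_enum_set V : sorted ltI (enum V).
Proof.
rewrite /enum_mem; apply: sorted_filter; first by move=> y x z; exact: ltn_trans.
by have := iota_ltn_sorted 0 n; rewrite -val_enum_ord sorted_map enumT.
Qed.

Lemma index_enum_lt V x y : x \in V -> y \in V ->
  (index x (enum V) < index y (enum V))%N = (x < y)%N.
Proof.
move=> xV yV; have lx : (index x (enum V) < size (enum V))%N by rewrite index_mem mem_enum.
have ly : (index y (enum V) < size (enum V))%N by rewrite index_mem mem_enum.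
have tr : transitive ltI by move=> b a c; exact: ltn_trans.
have lt := sorted_ltn_nth tr x (sorted_enum_set V).
have nx : nth x (enum V) (index x (enum V)) = x by rewrite nth_index ?mem_enum.
have ny : nth x (enum V) (index y (enum V)) = y by rewrite nth_index ?mem_enum.
case: (ltngtP (index x (enum V)) (index y (enum V))) => cmp; apply/esym.
- by have := lt _ _ lx ly cmp; rewrite nx ny.
- by have := lt _ _ ly lx cmp; rewrite nx ny /ltI; lia.
- by rewrite -nx cmp ny; lia.
Qed.

Lemma next_enum V x : x \in V ->
  let y := next (enum V) x in
  [/\ y \in V, (y <= x)%N -> {in V, forall z, (z <= x)%N} &
      (x < y)%N -> {in V, forall z, (x < z)%N -> (y <= z)%N}].
Proof.
move=> xV; have idx := index_enum_lt xV.
have memE z : (z \in V) = (z \in enum V) by rewrite mem_enum.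
move=> y; have yV : y \in V by rewrite memE mem_next -memE.
have := next_nth (enum V) x; rewrite -memE xV -/y.
case eV : (enum V) => [|h e]; first by move: xV; rewrite memE eV.
set i := index x (h :: e) => yE.
have ile : (i <= size e)%N by rewrite -ltnS -[(size e).+1]/(size (h :: e)) index_mem -eV -memE.
have idxz z : z \in V -> (index z (enum V) <= size e)%N.
  by move=> zV; rewrite -ltnS -[(size e).+1]/(size (h :: e)) -eV index_mem -memE.
have [ilt|ige] := ltnP i (size e).
  have ey : index y (enum V) = i.+1.
    have := index_uniq h (s := enum V) (i := i.+1).
    rewrite [in nth _ _ _]eV [nth _ _ _]/= -yE; apply; last exact: enum_uniq.
    by rewrite eV.
  have xy : (x < y)%N by rewrite -idx // ey eV.
  split=> // [yx|_ z zV xz]; first by move: xy; rewrite ltnNge yx.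
  rewrite leqNgt -(index_enum_lt zV yV) ey; move: xz; rewrite -idx // eV -/i; lia.
have mx : {in V, forall z, (z <= x)%N}.
  move=> z zV; rewrite leqNgt -idx // eV -/i -leqNgt.
  by apply: leq_trans ige; rewrite -eV idxz.
split=> // xy z zV xz; have := mx z zV; lia.
Qed.

(** The only weak descent of each cycle leads from its maximum to its minimum. The
    permutations attached to set partitions are the ones with this property. *)
Definition increasing_cycles s : Prop :=
  forall x, (s x <= x)%N -> {in porbit s x, forall y, (y <= x)%N}.

Lemma porbit_part_perm P x : partition P setT -> porbit (part_perm P) x = pblock P x.
Proof.
move=> partP; have [/eqP cov tI _] := and3P partP.
have xV : x \in pblock P x by rewrite mem_pblock cov inE.
have cyc : fcycle (part_perm P) (enum (pblock P x)).
  have := cycle_next (enum_uniq (mem (pblock P x))).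
  apply: sub_in_cycle (allss _) => y z; rewrite !mem_enum => yV _ /eqP <-.
  by apply/eqP; rewrite part_permE // (same_pblock tI yV).
have xe : x \in enum (pblock P x) by rewrite mem_enum.
apply/setP => y; rewrite -[RHS]mem_enum -(fconnect_cycle cyc xe).
apply/porbitP/idP => [[i ->]|/iter_findex <-]; first by rewrite permX fconnect_iter.
by exists (findex (part_perm P) x y); rewrite permX.
Qed.

Lemma porbits_part_perm P : partition P setT -> porbits (part_perm P) = P.
Proof.
move=> partP; have [/eqP cov tI n0] := and3P partP.
apply/setP => V; apply/imsetP/idP => [[x _ ->]|VP].
  by rewrite porbit_part_perm // pblock_mem // cov inE.
have [x xV] : exists x, x \in V by apply/set0Pn; apply: contraNneq n0 => <-.
by exists x => //; rewrite porbit_part_perm // (def_pblock tI VP).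
Qed.

Lemma part_perm_next P x (y := part_perm P x) : partition P setT ->
  [/\ y \in pblock P x, (y <= x)%N -> {in pblock P x, forall z, (z <= x)%N} &
      (x < y)%N -> {in pblock P x, forall z, (x < z)%N -> (y <= z)%N}].
Proof.
move=> partP; have [/eqP cov tI n0] := and3P partP.
by rewrite /y part_permE //; apply: next_enum; rewrite mem_pblock cov inE.
Qed.

Lemma increasing_part_perm P : partition P setT -> increasing_cycles (part_perm P).
Proof.
move=> partP x; have [_ mx _] := part_perm_next x partP.
by rewrite porbit_part_perm.
Qed.

Definition weak_descents s : {set 'I_n} := [set x | (s x <= x)%N].

(** The maximum of a cycle is a weak descent. *)
Lemma porbits_weak_descents s : porbits s = porbit s @: weak_descents s.
Proof.
apply/setP => V; apply/imsetP/imsetP => [[x _ ->]|[x _ ->]]; last by exists x.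
have [m /= mx max] := arg_maxnP (fun y : 'I_n => y : nat) (porbit_id s x).
exists m; last by apply/esym/eqP; rewrite eq_porbit_mem.
rewrite inE; apply: max; rewrite -(_ : porbit s m = porbit s x).
  by have := mem_porbit s 1 m; rewrite expg1.
by apply/eqP; rewrite eq_porbit_mem.
Qed.

Lemma card_porbits_le s : (#|porbits s| <= #|weak_descents s|)%N.
Proof. by rewrite porbits_weak_descents leq_imset_card. Qed.

(** Each cycle has at least the weak descent at its maximum; equality means that it has
    no other one. *)
Lemma card_porbits_increasing s :
  #|porbits s| = #|weak_descents s| <-> increasing_cycles s.
Proof.
rewrite porbits_weak_descents; split=> [/eqP/imset_injP inj x sx y yx|inc].
  have [m /= mx max] := arg_maxnP (fun y : 'I_n => y : nat) (porbit_id s x).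
  have em : porbit s m = porbit s x by apply/eqP; rewrite eq_porbit_mem.
  rewrite (_ : x = m); first exact: max.
  apply: inj; rewrite ?inE //; apply: max; rewrite -em.
  by have := mem_porbit s 1 m; rewrite expg1.
apply/eqP/imset_injP => x y; rewrite !inE => sx sy exy; apply/val_inj/eqP.
have xy : (x <= y)%N by apply: inc; rewrite // -exy porbit_id.
have yx : (y <= x)%N by apply: inc; rewrite // exy porbit_id.
by rewrite eqn_leq xy.
Qed.

(** Starting from the minimum m of a cycle, an early descent would be the maximum of the
    cycle before the cycle is exhausted; hence the iterates of m list the cycle in
    increasing order. *)
Lemma increasing_part_permE s : increasing_cycles s -> s = part_perm (porbits s).
Proof.
move=> inc; apply/permP => x; have partP := partition_porbits s.
rewrite part_permE // pblock_porbits; set V := porbit s x.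
have [m /= mx min] := arg_minnP (fun y : 'I_n => y : nat) (porbit_id s x).
have em : porbit s m = V by apply/eqP; rewrite eq_porbit_mem.
set k := #|V|; have iterV i : iter i s m \in V.
  by rewrite -em -permX mem_porbit.
have iterk : iter k s m = m by rewrite /k -em iter_porbit.
have k0 : (0 < k)%N by rewrite lt0n /k card_porbit_neq0.
have uniqk : uniq (traject s m k) by rewrite /k -em uniq_traject_porbit.
have incr i : (i.+1 < k)%N -> (iter i s m < iter i.+1 s m)%N.
  move=> ik; rewrite ltnNge; apply/negP => /= desc.
  have porbV j : porbit s (iter j s m) = V by rewrite -permX porbit_perm.
  have last_desc : (s (iter k.-1 s m) <= iter k.-1 s m)%N.
    by rewrite -iterS prednK // iterk; apply: min; exact: iterV.
  have eqI : iter i s m = iter k.-1 s m.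
    apply/val_inj/eqP; rewrite eqn_leq (inc _ last_desc) ?porbV // (inc _ desc) ?porbV //.
  have lti : (i < k)%N by apply: ltn_trans ik.
  have ltk : (k.-1 < k)%N by rewrite prednK.
  have /eqP := eqI; rewrite -(nth_traject s lti) -(nth_traject s ltk).
  rewrite nth_uniq ?size_traject // => /eqP eik; lia.
have enumV : enum V = traject s m k.
  apply: (@irr_sorted_eq _ ltI) => //.
  - by move=> y z t; exact: ltn_trans.
  - by move=> y; rewrite /ltI ltnn.
  - exact: sorted_enum_set.
  - apply/(sortedP m) => i; rewrite size_traject => ik.
    by rewrite !nth_traject //; [exact: incr | exact: ltnW].
  - by move=> y; rewrite mem_enum /k -em porbit_traject.
rewrite enumV; apply/eqP; have : fcycle s (traject s m k).
  move: k0 iterk; case: (k) => // j _ iterj.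
  rewrite /= -[X in rcons _ X]iterj iterSr -trajectSr; exact: fpath_traject.
move=> cyc; apply: (next_cycle cyc).
by rewrite -enumV mem_enum porbit_id.
Qed.

End IncreasingCycles.

(** * Geodesics are the non-crossing partitions *)
Section Geodesics.
Variable m : nat.
Local Notation n := m.+1.
Implicit Types (s t : {perm 'I_n}) (V W : {set 'I_n}) (P : {set {set 'I_n}}) (x y z : 'I_n).

Lemma gamma_val x : gamma n x = (if x < m then x.+1 else 0) :> nat.
Proof.
rewrite permE /=; case: ltnP => [lt|ge]; first by rewrite modn_small.
have -> : x.+1 = n by have := ltn_ord x; lia.
exact: modnn.
Qed.

Definition complement s : {perm 'I_n} := (gamma n * s^-1)%g.

Lemma complementE s x : s (complement s x) = gamma n x.
Proof. by rewrite permM permKV. Qed.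

(** For x other than the last point, t x is a weak descent of s when
    s (t x) = x + 1 <= t x, that is, when x is not a weak descent of t. The last point is
    always a weak descent of t, and so is its image for s, as s (t x) = 0. *)
Lemma weak_descents_complement s :
  (#|weak_descents s| + #|weak_descents (complement s)| = n.+1)%N.
Proof.
set t := complement s.
have -> : weak_descents t = ord_max |: t @^-1: ~: weak_descents s.
  apply/setP => x; rewrite !inE -val_eqE /= complementE gamma_val.
  have := ltn_ord x; have := ltn_ord (t x); case: ifP => xm; lia.
rewrite cardsU1 !inE complementE gamma_val /= ltnn /=.
rewrite on_card_preimset; last first.
  exact: onW_bij (Bijective (permK t) (permKV t)).
by rewrite addnCA cardsC card_ord.
Qed.

(** s lies on a geodesic from the identity to the long cycle gamma in the Cayley graph
    generated by the transpositions, where the distance to the identity is n - |s|. *)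
Definition geodesic s : bool := (#|porbits s| + #|porbits (complement s)| == n.+1)%N.

Lemma card_porbits_complement_le s : (#|porbits s| + #|porbits (complement s)| <= n.+1)%N.
Proof. by rewrite -(weak_descents_complement s) leq_add // card_porbits_le. Qed.

(** |s| and |t| are bounded by numbers of weak descents that add up to n + 1. *)
Lemma geodesicP s :
  geodesic s <-> increasing_cycles s /\ increasing_cycles (complement s).
Proof.
rewrite /geodesic -(weak_descents_complement s) -!card_porbits_increasing.
have := card_porbits_le s; have := card_porbits_le (complement s).
move: #|_| #|_| #|_| #|_| => a b c d; lia.
Qed.

Lemma NC_partition P : P \in NC n -> partition P setT.
Proof. by rewrite !inE => /andP[]. Qed.

Lemma NC_noncrossing P V W (a b c e : 'I_n) : P \in NC n -> V \in P -> W \in P -> V != W ->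
  a \in V -> c \in V -> b \in W -> e \in W -> (a < b)%N -> (b < c)%N -> (c < e)%N -> False.
Proof.
rewrite inE => /andP[_ /forall_inP nc] VP WP VW aV cV bW eW ab bc ce.
have := forall_inP (nc V VP) W WP; rewrite VW /= => /negP; apply.
apply/exists_inP; exists a => //; apply/exists_inP; exists b => //.
by apply/exists_inP; exists c => //; apply/exists_inP; exists e; rewrite ?ab ?bc.
Qed.

(** If the complement t goes down from x to y = t x, then the interval [y, x] is stable
    under t: the arc from y to s y = x + 1 (or s y = 0 if x is the last point) separates
    the blocks inside from those outside. Therefore x is the maximum of its cycle under t, and t has increasing
    cycles. *)
Lemma NC_geodesic P : P \in NC n -> geodesic (part_perm P).
Proof.
move=> PNC; have partP := NC_partition PNC; have [/eqP cov tI _] := and3P partP.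
apply/geodesicP; split; first exact: increasing_part_perm.
set s := part_perm P; set t := complement s => x.
set y := t x => yx; pose I := [set z : 'I_n | (y <= z)%N && (z <= x)%N].
(* The cycle of x stays in the interval I, whose maximum is x. *)
suff It : (t \in 'N(I | 'P))%g.
  move=> z; have xI : x \in I by rewrite inE yx leqnn.
  by move/(subsetP (porbit_sub xI It)); rewrite inE => /andP[].
apply/stableP => z; rewrite inE => /andP[yz zx].
have [->|zx'] := eqVneq z x; first by rewrite inE leqnn.
have ltzx : (z < x)%N by rewrite ltn_neqAle zx'.
set w := gamma n z; have wE : w = z.+1 :> nat.
  by rewrite gamma_val ifT //; have := ltn_ord x; lia.
have sy : s y = gamma n x by rewrite complementE.
have st : s (t z) = w by rewrite complementE.
have inP u : pblock P u \in P by rewrite pblock_mem // cov inE.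
have inb u : u \in pblock P u by rewrite mem_pblock cov inE.
have pb u : pblock P (s u) = pblock P u.
  by have [yV _ _] := part_perm_next u partP; exact: same_pblock.
have [syV symax synext] := part_perm_next y partP; rewrite -/s sy in syV symax synext.
set W := pblock P w; set V := pblock P y.
have tW : t z \in W by rewrite /W -st pb inb.
have WV : V != W.
  apply/eqP => eVW; have wV : w \in V by rewrite eVW inb.
  have [lt|ge] := ltnP y (gamma n x).
    have := synext lt w wV; rewrite wE; move: lt; rewrite gamma_val; case: ifP; lia.
  by have := symax ge w wV; rewrite wE; lia.
have disj u : u \in V -> u \in W -> False.
  move=> uV uW; move/eqP: WV; apply.
  exact: etrans (esym (def_pblock tI (inP y) uV)) (def_pblock tI (inP w) uW).
have yV := inb y; rewrite -/V in yV.
have wW := inb w; rewrite -/W in wW.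
have gE := gamma_val x.
have ty : t z != y by apply/eqP => e; apply: (disj y) => //; rewrite -e.
have tg : t z != gamma n x by apply/eqP => e; apply: (disj (t z)) => //; rewrite e.
have WV' : W != V by rewrite eq_sym.
move: ty tg; rewrite -!val_eqE /= => ty tg.
rewrite inE; apply/andP; split; rewrite leqNgt; apply/negP => lt.
  move: gE; case: ifP => xm gE.
    by apply: (NC_noncrossing PNC (inP w) (inP y) WV' tW wW yV syV); lia.
  by apply: (NC_noncrossing PNC (inP y) (inP w) WV syV yV tW wW); lia.
have xm : (x < m)%N by have := ltn_ord (t z); lia.
rewrite xm in gE.
by apply: (NC_noncrossing PNC (inP y) (inP w) WV yV syV wW tW); lia.
Qed.

End Geodesics.

Section GeodesicNoncrossing.
Variable m : nat.
Local Notation n := m.+1.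
Implicit Types (s t : {perm 'I_n}) (V W : {set 'I_n}) (P : {set {set 'I_n}}) (x y z : 'I_n).

Lemma card_porbits_gamma : #|porbits (gamma n)| = 1%N.
Proof.
apply/eqP; rewrite eqn_leq (card_porbits_gt0 ord0) andbT.
apply: leq_trans (card_porbits_le _) _.
rewrite -(cards1 (ord_max : 'I_n)); apply/subset_leq_card/subsetP => x.
rewrite !inE gamma_val -val_eqE /=; have := ltn_ord x; case: ifP; lia.
Qed.

Definition crossing_arcs s y z : Prop :=
  (y < z)%N /\ (z < s y)%N /\ ((s y < s z)%N \/ (s z < y)%N).

(** Making x a fixed point multiplies s by a transposition of two points of the same
    cycle. This adds a cycle to s and removes at most one from the complement, so the
    geodesic inequality remains an equality. *)
Lemma split_off_geodesic s x : geodesic s -> s x != x ->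
  let s' := (tperm x (s^-1 x) * s)%g in
  [/\ geodesic s', (#|porbits s'| = #|porbits s|.+1)%N &
      forall y, y != x -> s y != x -> s' y = s y].
Proof.
move=> /eqP geo sx s'.
have nex : x != (s^-1)%g x.
  by apply: contra sx => /eqP e; rewrite {1}e permKV.
have xs : x \in porbit s (s^-1 x)%g.
  by have := mem_porbit s 1 (s^-1 x)%g; rewrite expg1 permKV.
have card_s' : #|porbits s'| = #|porbits s|.+1.
  by have := porbits_mul_tperm s x (s^-1 x)%g; rewrite nex xs /= addn0 addn1.
split=> //.
  rewrite /geodesic eqn_leq card_porbits_complement_le /= card_s' -geo.
  have -> : porbits (complement s') = porbits (tperm x (s^-1 x) * (complement s)^-1)%g.
    by rewrite -porbitsV /complement !invMg !invgK mulgA.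
  have /= := porbits_mul_tperm (complement s)^-1%g x (s^-1 x)%g.
  rewrite porbitsV nex; move: #|porbits (tperm x _ * _)%g| #|porbits (complement s)| #|porbits s|.
  by move=> i j k; case: (_ \notin _) => /=; lia.
move=> y yx syx; rewrite permM tpermD // eq_sym //.
by apply: contra syx => /eqP ->; rewrite permKV.
Qed.

(** Not being the identity, the product has fewer than n cycles, so its complement would
    need at least two. It has only one: (a c) splits gamma^(-1) into two cycles, one of
    which contains b and not e, and (b e) joins them again. *)
Lemma crossing_transpositions (a b c e : 'I_n) : (a < b)%N -> (b < c)%N ->
  (c < e)%N \/ (e < a)%N -> ~~ geodesic (tperm a c * tperm b e)%g.
Proof.
move=> ab bc he; apply/negP => /eqP geo.
set r := (tperm a c * (gamma n)^-1)%g.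
have gamma_inv x y : x = y.+1 :> nat -> (gamma n)^-1%g x = y.
  move=> xy; apply: (@perm_inj _ (gamma n)); rewrite permKV; apply: val_inj => /=.
  by rewrite xy gamma_val ifT //; have := ltn_ord x; lia.
pose I := [set x : 'I_n | (a <= x)%N && (x < c)%N].
have Ir : (r \in 'N(I | 'P))%g.
  apply/stableP => x; rewrite !inE => /andP[ax xc]; rewrite permM.
  have pred (w : 'I_n) : (0 < w)%N -> exists2 v : 'I_n, w = v.+1 :> nat & (gamma n)^-1%g w = v.
    move=> w0; have lt : (w.-1 < n)%N by have := ltn_ord w; lia.
    by exists (Ordinal lt); [rewrite /=; lia | apply: gamma_inv => /=; lia].
  have [->|neq] := eqVneq x a.
    by rewrite tpermL; have [|v cv ->] := pred c; lia.
  rewrite tpermD ?[_ == x]eq_sym //; last by rewrite -val_eqE /=; lia.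
  move: neq; rewrite -val_eqE /= => neq.
  by have [|v cv ->] := pred x; lia.
have bI : b \in I by rewrite inE ltnW.
have ebr : (e \notin porbit r b).
  apply/negP => /(subsetP (porbit_sub bI Ir)); rewrite inE; lia.
have tE : (tperm a c * tperm b e * (gamma n)^-1)%g = (tperm b e * r)%g.
  rewrite /r mulgA; congr (_ * _)%g; apply/permP => x; rewrite !permM.
  have [ea eb ec ee] : [/\ (a == b) = false, (a == e) = false, (c == b) = false & (c == e) = false].
    by rewrite -!val_eqE /=; split; lia.
  have [->|xa] := eqVneq x a.
    by rewrite tpermL [tperm b e a]tpermD ?tpermL ?tpermD // 1?eq_sym ?ea ?ee ?ec ?eb.
  have [->|xc] := eqVneq x c.
    by rewrite tpermR [tperm b e c]tpermD ?tpermR ?tpermD // 1?eq_sym ?ea ?ee ?ec ?eb.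
  rewrite [tperm a c x]tpermD 1?eq_sym //.
  case: tpermP => [_|_|_ _]; rewrite tpermD ?ea ?eb ?ec ?ee //.
    by rewrite eq_sym.
  by rewrite eq_sym.
have card_r : (#|porbits r| <= 2)%N.
  have /= := porbits_mul_tperm (gamma n)^-1%g a c.
  rewrite porbitsV card_porbits_gamma -/r; move: #|porbits r| => k.
  by case: (a != c); case: (_ \notin _) => /=; lia.
have cardt : (#|porbits (complement (tperm a c * tperm b e))| <= 1)%N.
  rewrite -porbitsV /complement invMg invgK tE.
  have /= := porbits_mul_tperm r b e; rewrite porbit_sym ebr /=.
  move=> H; rewrite -(leq_add2r 1.*2) H (leq_add card_r) //; exact: leq_b1.
have : (#|weak_descents (tperm a c * tperm b e)%g| < n)%N.
  rewrite -[n in X in (_ < X)%N](card_ord n) -cardsT; apply: proper_card.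
  apply/properP; split; first exact: subsetT.
  have bc' : b != c by rewrite -val_eqE /=; lia.
  have ec' : e != c by rewrite -val_eqE /=; lia.
  by exists a => //; rewrite inE permM tpermL tpermD // -ltnNge; lia.
have := card_porbits_le (tperm a c * tperm b e)%g; lia.
Qed.

(** Splitting off points outside the two arcs keeps both arcs, by induction until only
    their four ends move. What is left is a product of two crossing transpositions or
    a single cycle through both arcs, which is not increasing. *)
Lemma geodesic_no_crossing_arcs s y z : geodesic s -> ~ crossing_arcs s y z.
Proof.
have [k] := ubnP (n - #|porbits s|)%N.
elim: k s => // k IH s ltk geo cross.
have [x /and3P[xy xz /and3P[sxy sxz sx]]|fixd] :=
  pickP (fun x => [&& x != y, x != z & [&& x != s y, x != s z & s x != x]]).
  have [geo' card' eq'] := split_off_geodesic geo sx.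
  apply: (IH _ _ geo').
    have := card_porbits_complement_le (tperm x (s^-1 x) * s)%g.
    have := card_porbits_gt0 ord0 (complement (tperm x (s^-1 x) * s)%g).
    rewrite card'; move: ltk; move: #|porbits s| #|porbits (complement _)| => p q; lia.
  by rewrite /crossing_arcs !eq' // eq_sym.
(* From here on only the four ends y, z, s y, s z of the arcs can move. *)
have fixE x : x != y -> x != z -> x != s y -> x != s z -> s x = x.
  move=> h1 h2 h3 h4; apply/eqP; rewrite -[_ == _]negbK.
  by have := fixd x; rewrite h1 h2 h3 h4 /= => ->.
case: cross => yz [zsy out].
have [inc _] := (geodesicP s).1 geo.
have inj x w : s x = s w -> x = w by exact: perm_inj.
have nfix x : s x != x -> s (s x) != s x by apply: contra => /eqP/inj ->.
have back x : s x != x -> s x != y -> s x != z -> s x != s y -> s x != s z -> False.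
  by move=> sx h1 h2 h3 h4; have := nfix x sx; rewrite fixE ?eqxx.
have neq (x w : 'I_n) : (x < w)%N || (w < x)%N -> (x != w) && (w != x).
  by rewrite -!val_eqE /=; lia.
have ysy := ltn_trans yz zsy.
have [z_sz ysz sysz] : [/\ (s z < z) || (z < s z), (s z < y) || (y < s z) &
    (s y < s z) || (s z < s y)]%N.
  case: out => out; first by rewrite out (ltn_trans zsy out) (ltn_trans ysy out) !orbT.
  by rewrite out (ltn_trans out yz) (ltn_trans out ysy) !orbT.
have /andP[ya ay] := neq _ _ (introT orP (or_introl ysy)).
have /andP[az za] := neq _ _ z_sz.
have /andP[yz' zy'] := neq _ _ (introT orP (or_introl yz)).
have /andP[szy yz''] := neq _ _ ysz.
have /andP[zsy' syz] := neq _ _ (introT orP (or_introl zsy)).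
have /andP[ss ss'] := neq _ _ sysz.
have img x : s x != x -> x != y -> x != z -> (s x == y) || (s x == z).
  move=> sx xy xz; apply: contraT; rewrite negb_or => /andP[h1 h2].
  by case: (back x sx h1 h2); [apply: contra xy | apply: contra xz] => /eqP/inj ->.
have := img (s y) (nfix _ ay) ay syz; have := img (s z) (nfix _ az) szy az.
have orb x : s x \in porbit s x by have := mem_porbit s 1 x; rewrite expg1.
have orb2 x : porbit s (s x) = porbit s x by have := porbit_perm s 1 x; rewrite expg1.
case/orP=> /eqP ssz; last first.
  case/orP=> /eqP ssy; last by have := ss; rewrite (inj (s y) (s z)) ?eqxx // ssy.
  have sE : s = (tperm y (s y) * tperm z (s z))%g.
    apply/permP => x; rewrite permM.
    have [->|xy] := eqVneq x y; first by rewrite tpermL tpermD // eq_sym.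
    have [->|xsy] := eqVneq x (s y); first by rewrite tpermR tpermD ?ssy // eq_sym.
    rewrite [tperm y _ x]tpermD 1?eq_sym //.
    have [->|xz] := eqVneq x z; first by rewrite tpermL.
    have [->|xsz] := eqVneq x (s z); first by rewrite tpermR.
    by rewrite tpermD 1?eq_sym // fixE.
  have := crossing_transpositions yz zsy out.
  by rewrite -sE geo.
case/orP=> /eqP ssy; first by have := ss; rewrite (inj (s y) (s z)) ?eqxx // ssy.
case: out => out.
  have desc : (s (s y) <= s y)%N by rewrite ssy ltnW.
  have : s (s (s y)) \in porbit s (s y) by rewrite -[porbit s (s y)]orb2 orb.
  by rewrite ssy => /(inc _ desc); rewrite leqNgt out.
have desc : (s z <= z)%N by rewrite (leq_trans (ltnW out)) // ltnW.
have : s (s (s z)) \in porbit s z.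
  by rewrite -[porbit s z]orb2 -[porbit s (s z)]orb2 orb.
by rewrite ssz => /(inc _ desc); rewrite leqNgt zsy.
Qed.

(** Suppose that a, c in V and b, e in W with a < b < c < e. The arc of V over b starts
    at the last point y of V before b; the cycle W contains b under the arc and e beyond
    it, so it has to leave the arc at some z. *)
Lemma geodesic_NC s : geodesic s -> porbits s \in NC n.
Proof.
move=> geo; have [inc _] := (geodesicP s).1 geo.
have partP := partition_porbits s.
rewrite !inE partP; apply/forall_inP => V VP; apply/forall_inP => W WP.
apply/implyP => VW; apply/negP.
case/exists_inP=> a aV /exists_inP[b bW /exists_inP[c cV /exists_inP[e eW]]].
case/and3P=> ab bc ce.
have sE := increasing_part_permE inc.
have tI := partition_trivIset partP.
have blk x U : U \in porbits s -> x \in U -> porbit s x = U.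
  by move=> UP xU; rewrite -pblock_porbits (def_pblock tI UP xU).
have [y /= /andP[yV yb] maxy] := arg_maxnP (P := fun y => (y \in V) && (y < b)%N)
   (fun y : 'I_n => y : nat) (introT andP (conj aV ab)).
have := part_perm_next y partP; rewrite -sE pblock_porbits (blk y V VP yV).
move=> [syV symax synext].
have disj x : x \in V -> x \in W -> False.
  by move=> xV xW; move/eqP: VW; apply; rewrite -(blk x V VP xV) (blk x W WP xW).
have sy : (y < s y)%N.
  rewrite ltnNge; apply/negP => le.
  by have := symax le c cV; rewrite leqNgt (ltn_trans yb bc).
have bsy : (b < s y)%N.
  rewrite ltn_neqAle; apply/andP; split.
    by apply/eqP => /val_inj eb; apply: (disj b) => //; rewrite eb.
  rewrite leqNgt; apply/negP => lt.
  by have /= := maxy (s y); rewrite syV lt => /(_ isT); rewrite leqNgt sy.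
pose I := [set x : 'I_n | (y < x)%N && (x < s y)%N].
have eI : e \notin I.
  rewrite inE negb_and -!leqNgt; apply/orP; right.
  exact: leq_trans (synext sy c cV (ltn_trans yb bc)) (ltnW ce).
have [z /andP[zW zI] szI] : exists2 z, (z \in W) && (z \in I) & s z \notin I.
  apply/exists_inP; apply: contraT => /exists_inPn none.
  have stab : (s \in 'N(W :&: I | 'P))%g.
    apply/stableP => x; rewrite !(finset.in_setI) => /andP[xW xI].
    have sxI := none x (introT andP (conj xW xI)); rewrite negbK in sxI.
    rewrite sxI andbT.
    by rewrite -(blk x W WP xW); have := mem_porbit s 1 x; rewrite expg1.
  have bWI : b \in W :&: I by rewrite !inE bW yb bsy.
  have := subsetP (porbit_sub bWI stab) e.
  by rewrite (blk b W WP bW) eW !finset.in_setI (negPf eI) andbF => /(_ isT).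
have szW : s z \in W.
  by rewrite -(blk z W WP zW); have := mem_porbit s 1 z; rewrite expg1.
apply: (@geodesic_no_crossing_arcs s y z geo).
have ney : (s z != y :> nat).
  by apply/eqP => /val_inj ez; apply: (disj y) => //; rewrite -ez.
have nesy : (s z != s y :> nat).
  by apply/eqP => /val_inj ez; apply: (disj (s y)) => //; rewrite -ez.
move: zI szI; rewrite !inE => /andP[yz zsy] szI; rewrite /crossing_arcs yz zsy.
by split=> //; split=> //; move: szI ney nesy; clear; lia.
Qed.

Lemma sum_NC_geodesic (R : nmodType) (F : {set {set 'I_n}} -> {set {set 'I_n}} -> R) :
  (\sum_(P in NC n) F P (Kr P) =
   \sum_(s | geodesic s) F (porbits s) (porbits (complement s)))%R.
Proof.
rewrite (reindex_onto (@part_perm n) (@porbits _)) /=.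
  apply: eq_big => [P|P PNC]; last first.
    by rewrite porbits_part_perm // NC_partition.
  apply/idP/andP => [PNC|[geo /eqP <-]]; last exact: geodesic_NC.
  by rewrite NC_geodesic // porbits_part_perm ?NC_partition.
move=> s geo; have [inc _] := (geodesicP s).1 geo.
by rewrite -increasing_part_permE.
Qed.

End GeodesicNoncrossing.

Local Open Scope ring_scope.

(** * Sums over pairs of permutations with a given product *)
Section Conjugation.
Variable T : finType.
Implicit Types s t g C : {perm T}.

Lemma porbit_conj s g x : porbit (s ^ g)%g (g x) = g @: porbit s x.
Proof.
apply/setP => y; apply/porbitP/imsetP => [[i ->]|[z /porbitP[i ->] ->]].
  by exists ((s ^+ i)%g x); rewrite ?mem_porbit // -conjXg permJ.
by exists i; rewrite -conjXg permJ.
Qed.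

Lemma porbits_conj s g : porbits (s ^ g)%g = (fun V : {set T} => g @: V) @: porbits s.
Proof.
rewrite [in RHS]/porbits -imset_comp; apply/setP => V.
apply/imsetP/imsetP => -[x _ ->]; last by exists (g x); rewrite //= porbit_conj.
by exists (g^-1 x)%g; rewrite //= -porbit_conj permKV.
Qed.

Lemma card_porbits_conj s g : #|porbits (s ^ g)%g| = #|porbits s|.
Proof. by rewrite porbits_conj card_imset //; apply/imset_inj/perm_inj. Qed.

Lemma block_prod_conj (R : comNzRingType) (u : nat -> R) s g :
  block_prod u (porbits (s ^ g)%g) = block_prod u (porbits s).
Proof.
rewrite porbits_conj /block_prod big_imset /=; last first.
  by move=> V W _ _; apply/imset_inj/perm_inj.
by apply: eq_bigr => V _; rewrite card_imset //; exact: perm_inj.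
Qed.

Lemma transitive_on_conj s t g :
  transitive_on setT (s ^ g)%g (t ^ g)%g = transitive_on setT s t.
Proof.
have half s1 t1 h : transitive_on setT s1 t1 -> transitive_on setT (s1 ^ h)%g (t1 ^ h)%g.
  move=> /imsetP[a _ tr]; rewrite (transitive_onE _ _ (in_setT (h a))).
  set O := orbit _ _ _; pose U := h @^-1: O.
  have [O1 O2] := stable_orbit (s1 ^ h)%g (t1 ^ h)%g (h a).
  have : orbit 'P (perm_gen s1 t1) a \subset U.
    apply: orbit_perm_gen_sub; first by rewrite inE orbit_refl.
      by apply/stableP => x; rewrite !inE -permJ => xO; move/stableP: O1; apply.
    by apply/stableP => x; rewrite !inE -permJ => xO; move/stableP: O2; apply.
  rewrite -tr => /subsetP TU; apply/eqP/setP => x; rewrite [RHS]inE.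
  by have := TU (h^-1 x)%g (in_setT _); rewrite inE permKV.
apply/idP/idP; last exact: half.
by move/(half _ _ g^-1%g); rewrite !conjgK.
Qed.

Lemma perm_conjE s C g : (forall x, C (g x) = g (s x)) -> C = (s ^ g)%g.
Proof. by move=> H; apply/permP => x; rewrite -[x](permKV g) permJ H. Qed.

Lemma perm_iter_ordS C x (i : 'I_#|porbit C x|) : C (iter i C x) = iter (ordS i) C x.
Proof.
have := ltn_ord i; rewrite leq_eqVlt => /orP[/eqP e|lt].
  by rewrite /= -iterS e modnn iter_porbit.
by rewrite /= modn_small.
Qed.

Lemma perm_iter_inj C x : injective (fun i : 'I_#|porbit C x| => iter i C x).
Proof.
move=> i j eij; apply/val_inj/eqP; have li := ltn_ord i; have lj := ltn_ord j.
rewrite -(nth_uniq x _ _ (uniq_traject_porbit C x)) ?size_traject //.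
by rewrite !nth_traject //; apply/eqP.
Qed.

Lemma iter_in_porbit C x i : iter i C x \in porbit C x.
Proof. by rewrite -permX mem_porbit. Qed.

Lemma card_porbits1 C : #|porbits C| = 1%N -> forall x, porbit C x = setT.
Proof.
move=> /eqP/cards1P[U CU] x.
have eU y : porbit C y = U by apply/set1P; rewrite -CU imset_f.
by apply/setP => y; rewrite in_setT eU -(eU y) porbit_id.
Qed.

Lemma card_porbits2 C x : #|porbits C| = 2%N ->
  exists y, porbit C y = ~: porbit C x.
Proof.
move=> C2; have [y yx] : exists y, y \notin porbit C x.
  apply/existsP; apply: contraT => /existsPn all_x.
  suff : porbits C = [set porbit C x] by move=> E; move: C2; rewrite E cards1.
  apply/setP => U; rewrite inE; apply/imsetP/eqP => [[y _ ->]|->]; last by exists x.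
  by apply/eqP; rewrite eq_porbit_mem -[_ \in _]negbK all_x.
exists y; have nxy : porbit C x != porbit C y by rewrite eq_porbit_mem porbit_sym.
have E : porbits C = [set porbit C x; porbit C y].
  apply/esym/eqP; rewrite eqEcard C2 cards2 nxy andbT; apply/subsetP => U.
  by rewrite !inE => /orP[] /eqP ->; exact: imset_f.
apply/setP => z; rewrite inE.
have : porbit C z \in porbits C by exact: imset_f.
rewrite E !inE !eq_porbit_mem => /orP[] zin; rewrite ?zin //.
  apply/negbTE; apply: contra yx => zy; rewrite porbit_sym in zin.
  by rewrite -eq_porbit_mem in zin; rewrite (eqP zin) porbit_sym.
apply/esym; apply: contra yx => zx.
by move: zin zx; rewrite -!eq_porbit_mem => /eqP <- ->.
Qed.

End Conjugation.

(** A long cycle is conjugate to gamma by the enumeration of its points along the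
    cycle. *)
Lemma conj_gamma n (C : {perm 'I_n}) : #|porbits C| = 1%N ->
  exists g, C = (gamma n ^ g)%g.
Proof.
case: n C => [|m] C C1.
  by exists 1%g; apply/permP => -[].
have e : #|porbit C ord0| = m.+1 by rewrite card_porbits1 // cardsT card_ord.
have inj : injective (fun i : 'I_m.+1 => iter i C ord0).
  by move=> i j; have := @perm_iter_inj _ C ord0; rewrite e; apply.
exists (perm inj); apply: perm_conjE => x; rewrite !permE.
by have := @perm_iter_ordS _ C ord0; rewrite e; apply.
Qed.

Lemma conj_gamma2 t s (C : {perm 'I_(t + s)}) x : #|porbits C| = 2%N ->
  #|porbit C x| = t -> exists g, C = (gamma2 t s ^ g)%g.
Proof.
move=> C2 ex; have [y eyx] := card_porbits2 x C2.
have ey : #|porbit C y| = s.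
  by have := cardsC (porbit C x); rewrite -eyx ex card_ord => /addnI.
pose g (i : 'I_(t + s)) := match fintype.split i with inl j => iter j C x | inr j => iter j C y end.
have injx : injective (fun i : 'I_t => iter i C x).
  by move=> i j; have := @perm_iter_inj _ C x; rewrite ex; apply.
have injy : injective (fun i : 'I_s => iter i C y).
  by move=> i j; have := @perm_iter_inj _ C y; rewrite ey; apply.
have neq i j : iter i C x != iter j C y.
  apply/eqP => E; have := iter_in_porbit C y j.
  by rewrite eyx -E inE iter_in_porbit.
have inj : injective g.
  move=> i j; rewrite /g -{2}(splitK i) -{2}(splitK j).
  case: (fintype.split i) => i'; case: (fintype.split j) => j' /=.
  - by move/injx ->.
  - by move/eqP; rewrite (negPf (neq _ _)).
  - by move/eqP; rewrite eq_sym (negPf (neq _ _)).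
  - by move/injy ->.
exists (perm inj); apply: perm_conjE => z; rewrite !permE /gamma2_fun /g.
case: (fintype.split z) => j.
  rewrite -[lshift s _]/(unsplit (inl _)) unsplitK.
  by have := @perm_iter_ordS _ C x; rewrite ex; apply.
rewrite -[rshift t _]/(unsplit (inr _)) unsplitK.
by have := @perm_iter_ordS _ C y; rewrite ey; apply.
Qed.

Section ProductSums.
Variables (R : realType) (u v : nat -> R).

(** A pair (s, t) with product C is determined by s, and it is transitive exactly when
    (s, C) is. In this form the sum is visibly invariant under conjugation of C. *)
Definition product_sum n e (C : {perm 'I_n}) : R :=
  \sum_(s | transitive_on setT s C
             && (#|porbits s| + #|porbits (C * s^-1)%g| == e)%N)
     block_prod u (porbits s) * block_prod v (porbits (C * s^-1)%g).

Lemma product_sum_conj n e (C g : {perm 'I_n}) :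
  product_sum e (C ^ g)%g = product_sum e C.
Proof.
rewrite /product_sum (reindex_inj (conjg_inj g)) /=; apply: eq_big => [s|s _].
  by rewrite transitive_on_conj -conjVg -conjMg !card_porbits_conj.
by rewrite -conjVg -conjMg !block_prod_conj.
Qed.

Lemma transitive_on_mul n (s C : {perm 'I_n}) :
  transitive_on setT s (C * s^-1)%g = transitive_on setT s C.
Proof.
rewrite /transitive_on (_ : perm_gen s (C * s^-1)%g = perm_gen s C) //.
have gs t : s \in perm_gen s t by rewrite mem_gen // !inE eqxx.
have gt t : t \in perm_gen s t by rewrite mem_gen // !inE eqxx orbT.
apply/eqP; rewrite eqEsubset !gen_subG !subUset !sub1set !gs /=.
rewrite groupM ?groupV ?gs ?gt //=.
by rewrite -[C in C \in _](mulgKV s) groupM ?gs ?gt.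
Qed.

Lemma sum_product_sum n e :
  \sum_(s : {perm 'I_n}) \sum_(t | transitive_on setT s t
       && (#|porbits s| + #|porbits t| == e)%N)
     block_prod u (porbits s) * block_prod v (porbits t) =
  \sum_C @product_sum n e C.
Proof.
rewrite [RHS](exchange_big_dep predT) //=; apply: eq_bigr => s _.
rewrite (reindex_inj (mulIg s^-1%g)) /=; apply: eq_bigl => C.
by rewrite transitive_on_mul.
Qed.

(** By the genus inequality, n + 1 - k cycles in s and t leave at most k + 1 of them
    for C; parity excludes k cycles, and 0 cycles are impossible. *)
Lemma product_sum_eq0 n (C : {perm 'I_n}) e k : (0 < n)%N -> (e + k = n.+1)%N ->
  (k < 2)%N -> #|porbits C| != k.+1 -> product_sum e C = 0.
Proof.
move=> n0 ek k2 Ck; rewrite /product_sum big1 // => s /andP[tr /eqP cs].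
have tr' : transitive_on setT (C * s^-1)%g s by rewrite transitive_onC transitive_on_mul.
have := genus_ineq tr'; have := genus_parity (C * s^-1)%g s.
rewrite mulgKV [(#|porbits (_ * _)%g| + _)%N]addnC cs oddD => par le.
have C0 := card_porbits_gt0 (Ordinal n0) C.
have := congr1 odd ek; move: par le Ck C0; rewrite oddD /= -ek.
move: k2; case: k ek => [|[|//]] ek _; rewrite ?addn0 ?addn1.
  by case: #|porbits C| => [|[|j]] //; lia.
case: #|porbits C| => [|[|[|j]]] //=; last by lia.
by rewrite /=; case: (odd e); case: (odd n).
Qed.

Lemma sum_NC_product_sum m :
  \sum_(P in NC m.+1) block_prod u P * block_prod v (Kr P) =
  product_sum m.+2 (gamma m.+1).
Proof.
rewrite (sum_NC_geodesic (fun P Q => block_prod u P * block_prod v Q)).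
apply: eq_bigl => s; rewrite /geodesic; case: eqP => _; rewrite ?andbF // andbT.
apply/esym; rewrite (transitive_onE _ _ (in_setT ord0)) eqEsubset subsetT /=.
have [_ gO] := stable_orbit s (gamma m.+1) ord0.
rewrite -(card_porbits1 (card_porbits_gamma m) ord0).
by apply: porbit_sub gO; exact: orbit_refl.
Qed.

(** Only long cycles contribute, all of them as much as gamma, and there are m! of
    them. *)
Lemma product_sum_leading m :
  \sum_(C : {perm 'I_m.+1}) product_sum m.+2 C =
  m`!%:R * \sum_(P in NC m.+1) block_prod u P * block_prod v (Kr P).
Proof.
rewrite sum_NC_product_sum (bigID (fun C => #|porbits C| == 1%N)) /=.
rewrite [X in _ + X]big1 ?addr0; last first.
  by move=> C C1; apply: (product_sum_eq0 (k := 0)) => //; rewrite addn0.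
rewrite (eq_bigr (fun=> product_sum m.+2 (gamma m.+1))); last first.
  by move=> C /eqP/conj_gamma[g ->]; rewrite product_sum_conj.
rewrite sumr_const mulr_natl; congr (_ *+ _).
rewrite -[m in RHS]/(m.+1.-1) -[m.+1 in RHS](card_ord m.+1) -cardsT.
rewrite -card_long_cycles; last by apply/set0Pn; exists ord0; rewrite inE.
apply: eq_card => C; rewrite (long_cyclesE _ (in_setT ord0)) inE.
rewrite -[_ \in _]/(_ == _); apply/eqP/andP => [C1|[_ /eqP C1]].
  by rewrite (card_porbits1 C1) eqxx; split=> //; apply/subsetP => x; rewrite inE.
apply/eqP/cards1P; exists setT; apply/setP => U; rewrite inE.
apply/imsetP/eqP => [[x _ ->]|->]; last by exists ord0; rewrite ?C1.
by apply/eqP; rewrite -C1 eq_porbit_mem C1 inE.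
Qed.

End ProductSums.

Lemma long_cycles_imset (T : finType) (V : {set T}) (s : {perm T}) :
  V != set0 -> s \in Sym V -> (s \in long_cycles V) = (#|porbit s @: V| == 1%N).
Proof.
move=> V0 Vs; have [a aV] := set0Pn _ V0; rewrite (long_cyclesE _ aV) Vs /=.
apply/eqP/cards1P => [eV|[U eU]].
  exists V; apply/setP => W; rewrite inE; apply/imsetP/eqP => [[x xV ->]|->].
    by apply/eqP; rewrite -[X in _ == X]eV eq_porbit_mem eV.
  by exists a.
have eW x : x \in V -> porbit s x = U by move=> xV; apply/set1P; rewrite -eU imset_f.
apply/eqP; rewrite eqEsubset (porbit_sub aV (Sym_stable Vs)) /=.
by apply/subsetP => x xV; rewrite (eW a) // -(eW x) // porbit_id.
Qed.

(** The second cycle is a long cycle on the complement of V. *)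
Lemma card_two_cycles (T : finType) (a : T) (V : {set T}) : V \proper setT -> a \in V ->
  #|[set C : {perm T} | (#|porbits C| == 2%N) && (porbit C a == V)]| =
  ((#|V|.-1)`! * (#|T| - #|V|).-1`!)%N.
Proof.
move=> Vp aV; have VT := proper_sub Vp.
have V0 : V != set0 by apply/set0Pn; exists a.
have cD : #|setT :\: V| = (#|T| - #|V|)%N by rewrite setTD cardsCs setCK.
have D0 : setT :\: V != set0.
  by rewrite -card_gt0 cD subn_gt0 -cardsT proper_card.
rewrite -cD -!card_long_cycles //.
pose F C : nat := (#|porbits C| == 2%N) && (porbit C a == V).
have cardL (U : {set T}) : #|long_cycles U| = (\sum_(s in Sym U) (s \in long_cycles U))%N.
  rewrite -sum1_card [LHS]big_mkcond [RHS]big_mkcond /=; apply: eq_bigr => s _.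
  by rewrite [_ \in long_cycles U]inE; case: (s \in Sym U) => //=; case: (_ \in _).
transitivity (\sum_(C in Sym setT | C \in 'N(V | 'P)%g) F C)%N.
  rewrite -sum1_card [LHS]big_mkcond [RHS]big_mkcond; apply: eq_bigr => C _ /=.
  rewrite inE /F.
  have -> : C \in Sym setT by rewrite inE; apply/subsetP => x; rewrite inE.
  case: andP => [[_ /eqP eV]|_]; last by case: ifP.
  rewrite ifT //= -eV porbit_gen.
  by have [] := stable_orbit C C a.
rewrite (@Sym_decomp _ nat) // (cardL V) (cardL (setT :\: V)) big_distrlr /=.
apply: eq_bigr => s1 S1; apply: eq_bigr => s2 S2; rewrite /F.
rewrite -[porbits _]/(porbit (s1 * s2)%g @: T).
have -> : porbit (s1 * s2)%g @: T = porbit (s1 * s2)%g @: setT.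
  by apply/setP => W; apply/imsetP/imsetP => -[x _ ->]; exists x.
rewrite (imset_porbitM VT S1 S2) cardsU.
have := imset_porbit_disjoint s1 S2; rewrite -setI_eq0 => /eqP ->.
rewrite cards0 subn0 (long_cyclesE _ aV) S1 /=.
have -> : porbit (s1 * s2)%g a = porbit s1 a.
  by apply: eq_porbit aV (permM_stable S1 S2) _ => x xV; rewrite (permM_on _ S1 S2) xV.
have [eV|] := eqVneq (porbit s1 a) V; last by rewrite andbF mul0n.
rewrite andbT mul1n (long_cycles_imset D0 S2).
have : s1 \in long_cycles V by rewrite (long_cyclesE _ aV) S1 eV eqxx.
by rewrite (long_cycles_imset V0 S1) => /eqP ->.
Qed.

Section Subleading.
Variables (R : realType) (u v : nat -> R).

Definition annular_term t s : R :=
  \sum_(sigma in SNC t s) block_prod u (porbits sigma) * block_prod v (porbits (Kr2 sigma)).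

(** A permutation with two cycles is conjugate to the standard one with the same cycle
    lengths. The chosen point decides which cycle comes first. *)
Lemma product_sum_two n (C : {perm 'I_n}) x : #|porbits C| = 2%N ->
  product_sum u v n C = annular_term #|porbit C x| (n - #|porbit C x|).
Proof.
move=> C2; set t := #|porbit C x|; set s := (n - t)%N.
have en : n = (t + s)%N.
  by rewrite /s subnKC // /t -[X in (_ <= X)%N]card_ord max_card.
have et : #|porbit C x| = t by [].
clearbody t s; subst n.
have [g ->] := conj_gamma2 C2 et; rewrite product_sum_conj.
by apply: eq_bigl => sigma; rewrite inE.
Qed.

(** Only permutations C with two cycles contribute. With V the cycle of 0 and t = |V|,
    there are binomial(n-1, t-1) (t-1)! (n-t-1)! = (n-1)! / (n-t) of them. The two orders
    of the cycles give the same value, and averaging over t and n - t replaces 1 / (n-t)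
    by (1/t + 1/(n-t)) / 2 = n / (2 t (n-t)), which is the weight in the annular sum. *)
Lemma product_sum_subleading m :
  \sum_(C : {perm 'I_m.+1}) product_sum u v m.+1 C = m`!%:R * annular_sum u v m.+1.
Proof.
rewrite (bigID (fun C => #|porbits C| == 2%N)) /= [X in _ + X]big1 ?addr0; last first.
  by move=> C C1; apply: (@product_sum_eq0 R u v _ C _ 1) => //; rewrite addn1.
pose n := m.+1; pose G t := annular_term t (n - t)%N.
pose H t := annular_term (n - t)%N t.
pose f t := ((t.-1)`! * (n - t).-1`!)%N%:R * ((G t + H t) / 2).
rewrite (partition_big (fun C : {perm 'I_n} => porbit C ord0)
   (fun V => (V \proper setT) && (ord0 \in V))) /=; last first.
  move=> C /eqP C2; rewrite porbit_id andbT properT.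
  have [y eyx] := card_porbits2 ord0 C2; apply/eqP => eT.
  by have := porbit_id C y; rewrite eyx eT setCT inE.
have two (V : {set 'I_n}) : (V \proper setT) && (ord0 \in V) ->
   \sum_(C | (#|porbits C| == 2%N) && (porbit C ord0 == V)) product_sum u v n C =
   f #|V|.
  move=> /andP[Vp V0]; rewrite /f.
  rewrite (eq_bigr (fun=> (G #|V| + H #|V|) / 2)) => [|C /andP[/eqP C2 /eqP eV]].
    rewrite sumr_const /= mulr_natl; congr (_ *+ _).
    by have := card_two_cycles Vp V0; rewrite cardsE card_ord.
  have -> : G #|V| = product_sum u v n C by rewrite (product_sum_two ord0) ?eV.
  have [y eyx] := card_porbits2 ord0 C2.
  have -> : H #|V| = product_sum u v n C.
    rewrite (product_sum_two y) // eyx eV /H.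
    have : (#|V| + #|~: V| = m.+1)%N by rewrite cardsC card_ord.
    rewrite /n; move: #|V| #|~: V| => i j ij.
    by congr annular_term; lia.
  by field.
rewrite (eq_bigr _ two) (sum_pointed_proper_subsets f (in_setT ord0)) cardsT card_ord /=.
rewrite /f /=.
rewrite /annular_sum big_add1 big_mkord /= -/n.
have bin_term (k : 'I_m) : 'C(m, k)%:R * (k`! * (n - k.+1).-1`!)%:R = m`!%:R / (m - k)%:R :> R.
  have k0 : (m - k)%:R != 0 :> R by rewrite pnatr_eq0 subn_eq0 -ltnNge.
  apply: (canRL (mulfK k0)); rewrite -!natrM; congr (_%:R).
  rewrite -(bin_fact (ltnW (ltn_ord k))) subSS.
  have : (0 < m - k)%N by rewrite subn_gt0.
  by case: (m - k)%N => // j _; rewrite factS [(j.+1 * _)%N]mulnC !mulnA.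
have HG (k : 'I_m) : H k.+1 = G (m - k)%N.
  rewrite /H /G /n subSS; congr annular_term.
  by have := ltn_ord k; lia.
rewrite (eq_bigr (fun k : 'I_m => m`!%:R / 2 * ((m - k)%:R^-1 * G k.+1) +
   m`!%:R / 2 * ((m - k)%:R^-1 * G (m - k)%N))); last first.
  by move=> k _; rewrite [LHS]mulrA bin_term HG; ring.
rewrite big_split /= [X in _ + X](reindex_inj rev_ord_inj) /= -big_split /=.
rewrite !mulr_sumr; apply: eq_bigr => k _.
rewrite -mulr_suml -/(annular_term k.+1 (m.+1 - k.+1)) -/n -/(G k.+1) subSS.
rewrite subKn //.
have k0 : (m - k)%:R != 0 :> R by rewrite pnatr_eq0 subn_eq0 -ltnNge.
have nE : n%:R = k.+1%:R + (m - k)%:R :> R.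
  by rewrite -natrD; congr (_%:R); have := ltn_ord k; lia.
have k1 : k.+1%:R != 0 :> R by rewrite pnatr_eq0.
rewrite nE; move: k0 k1; move: (m - k)%:R k.+1%:R => b a b0 a0.
by field; rewrite a0 b0.
Qed.

End Subleading.

(** * The expansion in powers of 1/d *)
Section Expansion.
Variables (R : realType) (u v : nat -> R).

(** Normalised by the number (n-1)! of long cycles and by the highest power of c that
    occurs. With c = -d this is the number T_n(u, v) that gives both the cumulants of a
    product and the moments. *)
Definition transitive_avg (c : R) n : R :=
  (n.-1)`!%:R^-1 * c ^- n.+1 *
  transitive_sum (fun k => c * u k) (fun k => c * v k) [set: 'I_n].

Definition cycle_count_sum n e : R :=
  \sum_(s : {perm 'I_n}) \sum_(t | transitive_on setT s t
       && (#|porbits s| + #|porbits t| == e)%N)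
     block_prod u (porbits s) * block_prod v (porbits t).

Definition avg_remainder (c : R) n : R :=
  (n.-1)`!%:R^-1 * \sum_(e < n) c^-1 ^+ (n.-1 - e) * cycle_count_sum n e.

Lemma cycle_prod_setT n (w : nat -> R) (c : R) (s : {perm 'I_n}) :
  cycle_prod (fun k => c * w k) setT s =
  c ^+ #|porbits s| * block_prod w (porbits s).
Proof.
rewrite /cycle_prod (_ : _ @: setT = porbits s); last first.
  by apply/setP => W; apply/imsetP/imsetP => -[x _ ->]; exists x.
by rewrite /block_prod big_split /= prodr_const.
Qed.

Lemma Sym_setT (T : finType) (s : {perm T}) : s \in Sym setT.
Proof. by rewrite inE; apply/subsetP => x; rewrite inE. Qed.

Lemma transitive_sum_cycle_count (c : R) m :
  transitive_sum (fun k => c * u k) (fun k => c * v k) [set: 'I_m.+1] =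
  \sum_(e < m.+3) c ^+ e * cycle_count_sum m.+1 e.
Proof.
rewrite /transitive_sum (eq_bigl predT) => [|s]; last by rewrite Sym_setT.
under [RHS]eq_bigr => e _ do rewrite mulr_sumr.
rewrite [RHS]exchange_big; apply: eq_bigr => s _ /=.
under [RHS]eq_bigr => e _ do rewrite mulr_sumr big_mkcond.
rewrite [RHS]exchange_big big_mkcond /=; apply: eq_bigr => t _.
rewrite Sym_setT /=; case: (boolP (transitive_on setT s t)) => /= tr; last by rewrite big1.
have le : (#|porbits s| + #|porbits t| < m.+3)%N.
  have := genus_ineq tr; have := card_porbits_gt0 ord0 (s * t)%g.
  by move: #|porbits s| #|porbits t| #|porbits (s * t)%g| => i j k; lia.
rewrite (bigD1 (Ordinal le)) //= eqxx big1 => [|e]; last first.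
  by rewrite -val_eqE /= eq_sym => /negPf ->.
by rewrite addr0 !cycle_prod_setT exprD; exact: mulrACA.
Qed.

(** The pairs are sorted by their number e of cycles: e = n + 1 gives the non-crossing
    sum, e = n the annular one, and every other pair carries a factor c^(-2). *)
Lemma transitive_avg_expansion (c : R) m : c != 0 ->
  transitive_avg c m.+1 =
  \sum_(P in NC m.+1) block_prod u P * block_prod v (Kr P)
  + c^-1 * annular_sum u v m.+1 + c^-1 ^+ 2 * avg_remainder c m.+1.
Proof.
move=> c0; rewrite /transitive_avg /avg_remainder transitive_sum_cycle_count /=.
have m0 : m`!%:R != 0 :> R by rewrite pnatr_eq0 -lt0n fact_gt0.
rewrite big_ord_recr big_ord_recr /= /cycle_count_sum !sum_product_sum.
rewrite product_sum_leading product_sum_subleading.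
rewrite [X in _ * (X + _ + _)](_ : _ = c ^+ m * \sum_(e < m.+1) c^-1 ^+ (m - e) * 
    cycle_count_sum m.+1 e); last first.
  rewrite mulr_sumr; apply: eq_bigr => e _; rewrite mulrA; congr (_ * _).
  have em : (e <= m)%N by rewrite -ltnS.
  by rewrite -{2}(subnK em) exprD mulrAC -exprMn divff ?expr1n ?mul1r.
move: (\sum_(P in _) _) (\sum_(e < _) _) (annular_sum _ _ _) => A B C.
rewrite -exprVn !exprS.
have cE : c ^+ m * c^-1 ^+ m = 1 by rewrite -exprMn divff ?expr1n.
move: m0 cE; move: m`!%:R (c ^+ m) (c^-1 ^+ m) => f x y f0 cE.
transitivity ((x * y) * (A + c^-1 * C + c^-1 * (c^-1 * (f^-1 * B)))).
  by field; rewrite f0 c0.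
by rewrite cE mul1r expr0 mulr1 !mulrA.
Qed.

End Expansion.

Lemma eq_set_exp (R : comNzRingType) (T : finType) (L L' E E' : {set T} -> R) :
  (forall S, S != set0 -> L S = L' S) -> E =1 E' -> set_exp L E -> set_exp L' E'.
Proof.
move=> eqL eqE [E0 LE]; split=> [|S a aS]; first by rewrite -eqE.
rewrite -eqE (LE _ _ aS); apply: eq_bigr => V /andP[_ aV].
by rewrite eqL ?eqE //; apply/set0Pn; exists a.
Qed.

(** * Exact formulas for cumulants and moments *)
Section ExactFormulas.
Variables (R : realType) (d : nat).
Hypothesis d_gt0 : (0 < d)%N.
Local Notation c := (- d%:R : R).
Implicit Types (p q : {poly R}) (T : finType).

Let c_neq0 : c != 0.
Proof. by rewrite oppr_eq0 pnatr_eq0 -lt0n. Qed.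

Lemma fe0 p : monic_of_degree d p -> fe d p 0 = 1.
Proof.
by case=> /monicP; rewrite lead_coefE => + sz; rewrite sz /fe bin0 expr0 subn0 mul1r divr1.
Qed.

Lemma coef_fe p k : (k <= d)%N -> p`_(d - k) = (-1) ^+ k * 'C(d, k)%:R * fe d p k.
Proof.
move=> kd; have C0 : 'C(d, k)%:R != 0 :> R by rewrite pnatr_eq0 -lt0n bin_gt0.
transitivity ((-1) ^+ k * (-1) ^+ k * p`_(d - k)); first by rewrite -expr2 sqrr_sign mul1r.
by rewrite /fe; move: ((-1) ^+ k) => e; field.
Qed.

Lemma coef_ffmul p q k : (k <= d)%N ->
  (ffmul d p q)`_(d - k) = (-1) ^+ k * 'C(d, k)%:R * (fe d p k * fe d q k).
Proof.
move=> kd; rewrite /ffmul coef_sum.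
have kd' : (k < d.+1)%N by [].
rewrite (bigD1 (Ordinal kd')) //= coefZ coefXn eqxx mulr1 big1 ?addr0 // => j.
rewrite -val_eqE /= => jk; rewrite coefZ coefXn; case: eqP => [e|_]; last by rewrite mulr0.
by have := ltn_ord j; move: jk; rewrite -(subKn kd) e subKn ?eqxx // -ltnS.
Qed.

Lemma fe_ffmul p q k : fe d (ffmul d p q) k = fe d p k * fe d q k.
Proof.
have [kd|kd] := leqP k d; last by rewrite /fe bin_small // invr0 !mulr0.
have C0 : 'C(d, k)%:R != 0 :> R by rewrite pnatr_eq0 -lt0n bin_gt0.
transitivity ((-1) ^+ k * (-1) ^+ k * (fe d p k * fe d q k)).
  by rewrite {1}/fe coef_ffmul //; move: ((-1) ^+ k) (fe d p k) (fe d q k) => e x y; field.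
by rewrite -expr2 sqrr_sign mul1r.
Qed.

Lemma monic_ffmul p q : monic_of_degree d p -> monic_of_degree d q ->
  monic_of_degree d (ffmul d p q).
Proof.
move=> mp mq; have top : (ffmul d p q)`_d = 1.
  by have := @coef_ffmul p q 0 isT; rewrite subn0 !fe0 // bin0 !mulr1.
have sz : size (ffmul d p q) = d.+1.
  apply/eqP; rewrite eqn_leq; apply/andP; split; last first.
    by rewrite ltnNge; apply/negP => le; have := oner_neq0 R; rewrite -top nth_default ?eqxx.
  apply: leq_trans (size_sum _ _ _) _; apply/bigmax_leqP => k _.
  by apply: leq_trans (size_scale_leq _ _) _; rewrite size_polyXn ltnS leq_subr.
by split; rewrite // monicE lead_coefE sz top.
Qed.

Lemma ffcumulantE p n :
  ffcumulant d p n = c ^+ n.-1 / (n.-1)`!%:R * part_log (fe d p) [set: 'I_n].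
Proof. by congr (_ * _); apply: eq_bigl => P; rewrite inE. Qed.

Lemma part_log_ffcumulant p n : (0 < n)%N ->
  part_log (fe d p) [set: 'I_n] = c^-1 ^+ n * ((n.-1)`!%:R * (c * ffcumulant d p n)).
Proof.
case: n => // n _; rewrite ffcumulantE /=.
have n0 : n`!%:R != 0 :> R by rewrite pnatr_eq0 -lt0n fact_gt0.
have cE : c ^+ n * c^-1 ^+ n = 1 by rewrite -exprMn divff ?expr1n.
rewrite exprS; move: (part_log _ _) cE c_neq0 n0.
move: n`!%:R (c ^+ n) (c^-1 ^+ n) => f x y; move: c => e X cE e0 f0.
transitivity ((x * y) * X); first by rewrite cE mul1r.
by field; rewrite e0 f0.
Qed.

(** Both sides have the same logarithm: the cumulants are the alternating partition sum
    by definition, and they are the weights of the cycles on the right. For n > d the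
    left side vanishes by the convention 1 / 0 = 0, and the cumulants are then those
    of this extended sequence. *)
Lemma fe_perm_sum p T (S : {set T}) : monic_of_degree d p ->
  fe d p #|S| = c^-1 ^+ #|S| * perm_sum (fun k => c * ffcumulant d p k) S.
Proof.
move=> mp; have H := part_log_set_exp (fe0 mp) T.
have H' := set_exp_scale c^-1 (perm_sum_set_exp T (fun k => c * ffcumulant d p k)).
apply: set_exp_uniq H H' S => V V0.
by rewrite (part_log_card (fe0 mp)) // part_log_ffcumulant // card_gt0.
Qed.

Lemma transitive_avgE (u v : nat -> R) n : (0 < n)%N ->
  transitive_sum (fun k => c * u k) (fun k => c * v k) [set: 'I_n] =
  (n.-1)`!%:R * c ^+ n.+1 * transitive_avg u v c n.
Proof.
move=> n0; rewrite /transitive_avg -mulrA mulrA; symmetry.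
have f0 : n.-1`!%:R != 0 :> R by rewrite pnatr_eq0 -lt0n fact_gt0.
have x0 : c ^+ n.+1 != 0 by rewrite expf_neq0.
by move: (transitive_sum _ _ _) f0 x0; move: (_`!%:R) (c ^+ _) => f x X f0 x0; field; rewrite f0 x0.
Qed.

(** The coefficients of the product are products of sums over permutations, and
    transitive pairs are the logarithm of such a product. *)
Lemma ffcumulant_ffmul p q n : monic_of_degree d p -> monic_of_degree d q -> (0 < n)%N ->
  ffcumulant d (ffmul d p q) n = transitive_avg (ffcumulant d p) (ffcumulant d q) c n.
Proof.
move=> mp mq n0; have mpq := monic_ffmul mp mq.
have H := part_log_set_exp (fe0 mpq) 'I_n.
have H' := set_exp_scale (c^-1 * c^-1) (transitive_sum_set_exp 'I_n
   (fun k => c * ffcumulant d p k) (fun k => c * ffcumulant d q k)).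
have T0 : [set: 'I_n] != set0 by rewrite -card_gt0 cardsT card_ord.
have H2 : set_exp (fun S => (c^-1 * c^-1) ^+ #|S| * transitive_sum
    (fun k => c * ffcumulant d p k) (fun k => c * ffcumulant d q k) S)
    (fun S : {set 'I_n} => fe d (ffmul d p q) #|S|).
  apply: eq_set_exp H' => // S.
  by rewrite fe_ffmul !fe_perm_sum // exprMn mulrACA.
have := set_exp_log H H2 T0.
rewrite part_log_ffcumulant // cardsT card_ord transitive_avgE //.
case: n {H H' H2 T0} n0 => // n _ /=.
have f0 : n`!%:R != 0 :> R by rewrite pnatr_eq0 -lt0n fact_gt0.
have x0 : c ^+ n.+1 != 0 by rewrite expf_neq0.
rewrite exprMn; move: (transitive_avg _ _ _ _) (ffcumulant _ _ _) => A B eqAB.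
have x1 : c ^+ n.+1 * c^-1 ^+ n.+1 = 1 by rewrite -exprMn divff ?expr1n.
have {eqAB} : (c ^+ n.+1 * c^-1 ^+ n.+1) * (n`!%:R * c * B) =
  (c ^+ n.+1 * c^-1 ^+ n.+1) * (c ^+ n.+1 * c^-1 ^+ n.+1) * (n`!%:R * c * A).
  by rewrite -!mulrA eqAB [c ^+ n.+2]exprS; ring.
rewrite x1 !mul1r; exact: (mulfI (mulf_neq0 f0 c_neq0)).
Qed.

Section Moments.
Variable p : {poly R}.
Hypothesis mp : monic_of_degree d p.

Local Notation rc := (real_complex R).

Lemma croots_monic :
  map_poly rc p = \prod_(z <- croots p) ('X - z%:P) /\ size (croots p) = d.
Proof.
have [mon sz] := mp.
have E : map_poly rc p = \prod_(z <- croots p) ('X - z%:P).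
  rewrite /croots; case: closed_field_poly_normal => r /= {1}->.
  by rewrite lead_coef_map (monicP mon) rmorph1 scale1r.
split=> //; have := congr1 (fun P : {poly _} => size P) E.
by rewrite size_map_poly sz size_prod_XsubC => -[].
Qed.

Lemma rev_prod_croots k :
  (rev_prod (croots p))`_k = rc ((-1) ^+ k * 'C(d, k)%:R * fe d p k).
Proof.
have [E sz] := croots_monic; have [kd|kd] := leqP k d.
  by rewrite -coef_fe // -(coef_map rc) E -coef_prod_XsubC_rev sz.
rewrite bin_small // mulr0 mul0r rmorph0 nth_default //.
by apply: leq_trans (size_rev_prod _) _; rewrite sz.
Qed.

(** The numbers (-1)^n n! binomial(d, n) e_n(p) are c^(-n) times the product of the sum of
    c^|sigma| kappa_sigma and the sum of c^|tau|. The pairs (sigma, tau) therefore compute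
    their logarithm, which is -d (n-1)! m_n(p) by Newton's identities. *)
Lemma pmoment_avg n : (0 < n)%N ->
  pmoment d p n = transitive_avg (ffcumulant d p) (fun=> 1) c n.
Proof.
move=> n0; have p0 : p != 0 by apply: monic_neq0; case: mp.
have d0 : d%:R != 0 :> R by rewrite pnatr_eq0 -lt0n.
have [E0 LE] := newton_set_exp 'I_n (croots p).
have psum k : \sum_(z <- croots p) z ^+ k = rc (d%:R * pmoment d p k).
  rewrite rmorphM /= pmomentE // rmorph_nat mulrA divff ?mul1r //.
  by rewrite pnatr_eq0 -lt0n.
pose E (S : {set 'I_n}) : R := #|S|`!%:R * ((-1) ^+ #|S| * 'C(d, #|S|)%:R) * fe d p #|S|.
pose L (S : {set 'I_n}) : R := (#|S|.-1)`!%:R * (c * pmoment d p #|S|).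
have rE (S : {set 'I_n}) : #|S|`!%:R * (rev_prod (croots p))`_#|S| = rc (E S).
  rewrite rev_prod_croots -[_`!%:R](rmorph_nat rc) -rmorphM.
  by rewrite [X in rc X = _]mulrA.
have rL (S : {set 'I_n}) : - ((#|S|.-1)`!%:R * \sum_(z <- croots p) z ^+ #|S|) = rc (L S).
  by rewrite psum -[_`!%:R](rmorph_nat rc) -rmorphM -rmorphN /L mulNr mulrN.
have H : set_exp L E.
  split=> [|S a aS]; first by rewrite /E cards0 fe0 // bin0 expr0 !mulr1.
  suff : rc (E S) = rc (\sum_(V : {set 'I_n} | (V \subset S) && (a \in V)) L V * E (S :\: V)).
    exact: fmorph_inj.
  rewrite -rE (LE _ _ aS) rmorph_sum.
  by apply: eq_bigr => V _; rewrite rE rL; exact: (esym (rmorphM rc _ _)).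
have H2 : set_exp (fun S => c^-1 ^+ #|S| * transitive_sum
    (fun k => c * ffcumulant d p k) (fun k => c * 1) S) E.
  apply: eq_set_exp (set_exp_scale c^-1 (transitive_sum_set_exp 'I_n
     (fun k => c * ffcumulant d p k) (fun k => c * 1))) => // S.
  rewrite /E fe_perm_sum // -(perm_sum_const R d S) mulrA mulrC; congr (_ * _).
  by rewrite mulr1.
have T0 : [set: 'I_n] != set0 by rewrite -card_gt0 cardsT card_ord.
have := set_exp_log H H2 T0; rewrite /L cardsT card_ord transitive_avgE //.
case: n n0 {E L rE rL H H2 T0 E0 LE} => // n _ /=.
have f0 : n`!%:R != 0 :> R by rewrite pnatr_eq0 -lt0n fact_gt0.
have x0 : c ^+ n.+1 * c^-1 ^+ n.+1 = 1 by rewrite -exprMn divff ?expr1n.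
move: (transitive_avg _ _ _ _) (pmoment _ _ _) => A B eqAB.
apply: (mulfI (mulf_neq0 f0 c_neq0)); rewrite -mulrA eqAB [c ^+ n.+2]exprS.
transitivity ((c ^+ n.+1 * c^-1 ^+ n.+1) * (n`!%:R * c * A)); first by ring.
by rewrite x0 mul1r.
Qed.

End Moments.

End ExactFormulas.

Lemma set0_notin_porbits (T : finType) (s : {perm T}) : set0 \notin porbits s.
Proof.
apply/negP => /imsetP[x _ e]; have := porbit_id s x.
by rewrite -e in_set0.
Qed.

Lemma set0_notin_NC n (P : {set {set 'I_n}}) : P \in NC n -> set0 \notin P.
Proof. by rewrite !inE => /andP[/and3P[_ _ ->]]. Qed.

(** The limit of T_n(a, b). The moments in terms of free cumulants are the case b = 1. *)
Definition nc_sum (R : realType) (a b : nat -> R) n : R :=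
  \sum_(P in NC n) block_prod a P * block_prod b (Kr P).

(** * The contribution of the one-block partition *)
Section FullBlock.
Variables (R : realType) (n : nat).
Hypothesis n_gt0 : (0 < n)%N.
Implicit Types (u v : nat -> R) (P : {set {set 'I_n}}).

Lemma card_block_full (V : {set 'I_n}) : #|V| = n -> V = setT.
Proof.
by move=> cV; apply/eqP; rewrite eqEcard subsetT cardsT card_ord cV leqnn.
Qed.

Lemma card_block_lt P (V : {set 'I_n}) : partition P setT ->
  P != [set [set: 'I_n]] -> V \in P -> (#|V| < n)%N.
Proof.
move=> partP neP VP; have [covP tI n0] := and3P partP.
have : (#|V| <= n)%N by rewrite -[X in (_ <= X)%N]card_ord max_card.
rewrite leq_eqVlt => /orP[/eqP/card_block_full eV|//].
case/eqP: neP; apply/setP => W; rewrite in_set1; apply/idP/eqP => [WP|->].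
  apply/eqP; apply: contraT => WV; have := trivIsetP tI _ _ WP VP.
  rewrite eV => /(_ WV); rewrite -setI_eq0 setIT => /eqP W0.
  by move: n0; rewrite -W0 WP.
by rewrite -eV.
Qed.

Lemma partition_full : [set [set: 'I_n]] \in NC n.
Proof.
rewrite !inE; apply/andP; split.
  apply/and3P; split; first by rewrite /cover big_set1.
    by rewrite /trivIset /cover !big_set1.
  rewrite inE eq_sym -card_gt0 cardsT card_ord //.
apply/forall_inP => V /set1P ->; apply/forall_inP => W /set1P ->.
by rewrite eqxx.
Qed.

Lemma nc_sum_full u v : nc_sum u v n =
  u n * block_prod v (Kr [set [set: 'I_n]]) +
  \sum_(P in NC n | P != [set [set: 'I_n]]) block_prod u P * block_prod v (Kr P).
Proof.
rewrite /nc_sum (bigD1 _ partition_full) /=; congr (_ * _ + _).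
by rewrite /block_prod big_set1 cardsT card_ord.
Qed.

Lemma block_prod1 (T : finType) (P : {set {set T}}) : block_prod (fun=> 1 : R) P = 1.
Proof. by rewrite /block_prod big1. Qed.

Lemma nc_sum_delta : nc_sum (fun j => (j == n)%:R) (fun=> 1 : R) n = 1.
Proof.
rewrite nc_sum_full eqxx block_prod1 mulr1 big1 ?addr0 // => P /andP[PNC neP].
have {}partP : partition P setT by move: PNC; rewrite !inE => /andP[].
have [x _] : exists x : 'I_n, true by exists (Ordinal n_gt0).
have VP : pblock P x \in P by rewrite pblock_mem // (cover_partition partP) inE.
have := card_block_lt partP neP VP.
by rewrite /block_prod (bigD1 _ VP) /= ltn_neqAle => /andP[/negPf -> _]; rewrite !mul0r.
Qed.

Definition trunc u j : R := if (j < n)%N then u j else 0.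

Lemma block_prod_trunc u P : partition P setT ->
  block_prod u P = block_prod (trunc u) P + u n * block_prod (fun j => (j == n)%:R) P.
Proof.
move=> partP; have [->|neP] := eqVneq P [set [set: 'I_n]].
  by rewrite /block_prod !big_set1 cardsT card_ord /trunc ltnn eqxx mulr1 add0r.
have [x _] : exists x : 'I_n, true by exists (Ordinal n_gt0).
have VP : pblock P x \in P by rewrite pblock_mem // (cover_partition partP) inE.
have lt := card_block_lt partP neP.
rewrite [X in _ = _ + _ * X](_ : _ = 0) ?mulr0 ?addr0; last first.
  by rewrite /block_prod (bigD1 _ VP) /= ltn_eqF ?lt // mul0r.
by apply: eq_bigr => V VinP; rewrite /trunc lt.
Qed.

(** T_n(u, v) is affine in u_n, since u_n occurs only for s a long cycle, and then it is
    the only factor from u. *)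
Lemma transitive_avg_trunc u v c :
  transitive_avg u v c n = transitive_avg (trunc u) v c n +
    u n * transitive_avg (fun j => (j == n)%:R) v c n.
Proof.
rewrite /transitive_avg mulrCA -mulrDr; congr (_ * _).
rewrite /transitive_sum mulr_sumr -big_split /=; apply: eq_bigr => s _.
rewrite mulr_sumr -big_split /=; apply: eq_bigr => t _.
rewrite mulrA -mulrDl; congr (_ * _).
by rewrite !cycle_prod_setT (block_prod_trunc u (partition_porbits s)) mulrDr mulrCA.
Qed.

End FullBlock.

Lemma nc_sum_inj (R : realType) (r r' : nat -> R) :
  (forall n, (0 < n)%N -> nc_sum r (fun=> 1) n = nc_sum r' (fun=> 1) n) ->
  forall n, (0 < n)%N -> r n = r' n.
Proof.
move=> eqm n; have [k] := ubnP n; elim: k n => // k IH n ltnk n0.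
have := eqm n n0; rewrite !nc_sum_full // block_prod1 !mulr1.
rewrite (eq_bigr (fun P => block_prod r' P * block_prod (fun=> 1) (Kr P))); first by move/addIr.
move=> P /andP[PNC neP]; congr (_ * _); apply: eq_bigr => V VP.
have partP : partition P setT by move: PNC; rewrite !inE => /andP[].
apply: IH; first by apply: leq_trans (card_block_lt partP neP VP) _; rewrite -ltnS.
by rewrite card_gt0; apply: contraNneq (set0_notin_NC PNC) => <-.
Qed.

From mathcomp Require Import all_classical all_reals all_analysis.
Import numFieldNormedType.Exports.

Local Open Scope classical_set_scope.
Local Open Scope ring_scope.

(** * First-order expansions of sequences *)
Section FirstOrder.
Variable R : realType.
Implicit Types (a b : nat -> R) (l m : R).

(** a d = l + l' / d + o(1/d). The pairs (l, l') obey the calculus of dual numbers, so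
    that first-order terms can be read off from algebraic expressions. *)
Definition first_order a l l' : Prop :=
  d%:R * (a d - l) @[d --> \oo] --> l'.

Lemma cvg_invn : (d%:R^-1 : R) @[d --> \oo] --> (0 : R).
Proof. by rewrite -cvg_shiftS; exact: cvg_harmonic. Qed.

Lemma first_order_cvg a l l' : first_order a l l' -> a d @[d --> \oo] --> l.
Proof.
move=> al; have : (l + d%:R^-1 * (d%:R * (a d - l))) @[d --> \oo] --> l + 0 * l'.
  by apply: cvgD; [exact: cvg_cst | apply: cvgM => //; exact: cvg_invn].
rewrite mul0r addr0; apply: cvg_trans; apply: near_eq_cvg.
near=> d; have d0 : d%:R != 0 :> R by rewrite pnatr_eq0 -lt0n; near: d; exists 1%N.
by rewrite mulKf // subrKC.
Unshelve. all: by end_near. Qed.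

Lemma first_order_cst l : first_order (fun=> l) l 0.
Proof.
rewrite /first_order (_ : (fun d : nat => _) = (fun=> 0)); first exact: cvg_cst.
by apply/funext => d; rewrite subrr mulr0.
Qed.

Lemma first_order_near a b l l' : (\forall d \near \oo, a d = b d) ->
  first_order a l l' -> first_order b l l'.
Proof.
move=> ab; apply: cvg_trans; apply: near_eq_cvg.
by near=> d; congr (_ * (_ - _)); near: d.
Unshelve. all: by end_near. Qed.

Lemma first_order_nearI (f a : nat -> R) l l' : f @ \oo --> l' ->
  (\forall d \near \oo, f d = d%:R * (a d - l)) -> first_order a l l'.
Proof. by move=> fl fE; apply: cvg_trans fl; apply: near_eq_cvg. Qed.

Lemma first_orderI (f : nat -> R) a l l' : f @ \oo --> l' ->
  (forall d, f d = d%:R * (a d - l)) -> first_order a l l'.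
Proof. by move=> fl /funext fE; rewrite /first_order -fE. Qed.

Lemma first_orderD a b l l' m m' : first_order a l l' -> first_order b m m' ->
  first_order (fun d => a d + b d) (l + m) (l' + m').
Proof.
by move=> al bm; apply: first_orderI (cvgD al bm) _ => d; rewrite ?fctE /=; ring.
Qed.

Lemma first_orderM a b l l' m m' : first_order a l l' -> first_order b m m' ->
  first_order (fun d => a d * b d) (l * m) (l' * m + l * m').
Proof.
move=> al bm; have blim := first_order_cvg bm.
by apply: first_orderI (cvgD (cvgM al blim) (cvgM (cvg_cst l) bm)) _ => d; rewrite ?fctE /=; ring.
Qed.

Lemma first_orderN a l l' : first_order a l l' -> first_order (fun d => - a d) (- l) (- l').
Proof.
by move=> al; apply: first_orderI (cvgN al) _ => d; rewrite ?fctE /=; ring.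
Qed.

Lemma first_orderB a b l l' m m' : first_order a l l' -> first_order b m m' ->
  first_order (fun d => a d - b d) (l - m) (l' - m').
Proof. by move=> al bm; apply: first_orderD al (first_orderN bm). Qed.

Lemma first_orderV a l l' : l != 0 -> first_order a l l' ->
  first_order (fun d => (a d)^-1) l^-1 (- l' / l ^+ 2).
Proof.
move=> l0 al; have alim := first_order_cvg al.
have anz : \forall d \near \oo, a d != 0 by exact: cvgr_neq0 alim l0.
have : (- (d%:R * (a d - l)) * (a d * l)^-1) @[d --> \oo] --> - l' * (l * l)^-1.
  apply: cvgM; first exact: cvgN.
  by apply: cvgV; [rewrite mulf_neq0 | apply: cvgM => //; exact: cvg_cst].
rewrite expr2; apply: cvg_trans; apply: near_eq_cvg.
near=> d; have ad0 : a d != 0 by near: d.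
by field; rewrite ad0 l0.
Unshelve. all: by end_near. Qed.

Lemma first_order_sum (I : Type) (r : seq I) (P : pred I) (a : I -> nat -> R) (l l' : I -> R) :
  (forall i, P i -> first_order (a i) (l i) (l' i)) ->
  first_order (fun d => \sum_(i <- r | P i) a i d) (\sum_(i <- r | P i) l i)
    (\sum_(i <- r | P i) l' i).
Proof.
move=> al; elim: r => [|i r IH].
  rewrite !big_nil; apply: first_order_near (first_order_cst 0).
  by near=> d; rewrite big_nil.
  Unshelve. all: try by end_near.
rewrite !big_cons; case: ifPn => Pi; last first.
  apply: first_order_near IH; near=> d; by rewrite big_cons (negPf Pi).
  Unshelve. all: try by end_near.
apply: first_order_near (first_orderD (al i Pi) IH); near=> d; by rewrite big_cons Pi.
Unshelve. all: by end_near. Qed.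

Lemma first_order_prod (I : finType) (A : {set I}) (a : I -> nat -> R) (l l' : I -> R) :
  (forall i, i \in A -> first_order (a i) (l i) (l' i)) ->
  first_order (fun d => \prod_(i in A) a i d) (\prod_(i in A) l i)
    (\sum_(i in A) l' i * \prod_(j in (A :\ i)%SET) l j).
Proof.
have [k] := ubnP #|A|; elim: k A => // k IH A ltk al.
have [->|/finset.set0Pn[i iA]] := eqVneq A finset.set0.
  rewrite !finset.big_set0; apply: first_order_near (first_order_cst 1).
  by near=> d; rewrite finset.big_set0.
  Unshelve. all: try by end_near.
rewrite (finset.big_setD1 i) //=; have {}IH := IH (A :\ i)%SET.
have lt : (#|(A :\ i)%SET| < k)%N by move: ltk; rewrite (cardsD1 i) iA.
have alB j : j \in (A :\ i)%SET -> first_order (a j) (l j) (l' j).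
  by rewrite !inE => /andP[_ /al].
have := first_orderM (al i iA) (IH lt alB).
have -> : l' i * (\prod_(j in (A :\ i)%SET) l j) +
   l i * \sum_(j in (A :\ i)%SET) l' j * \prod_(h in (A :\ i :\ j)%SET) l h =
   \sum_(j in A) l' j * \prod_(h in (A :\ j)%SET) l h.
  rewrite [RHS](finset.big_setD1 i) //=; congr (_ + _); rewrite mulr_sumr.
  apply: eq_bigr => j; rewrite !inE => /andP[ji jA].
  rewrite [in RHS](finset.big_setD1 i) /=; last by rewrite !inE eq_sym ji iA.
  rewrite mulrCA; congr (_ * (_ * _)); apply: eq_bigl => h.
  by rewrite !inE andbCA.
apply: first_order_near; near=> d; by rewrite [RHS](finset.big_setD1 i).
Unshelve. all: by end_near. Qed.

Lemma first_order_unique a l m l' m' : first_order a l l' -> first_order a m m' ->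
  l = m /\ l' = m'.
Proof.
move=> al am; have E : l = m.
  have := first_order_cvg al; have := first_order_cvg am.
  by move=> /cvg_lim <- // /cvg_lim <-.
split=> //; move: am; rewrite -E /first_order => am.
by rewrite -(cvg_lim _ al) // -(cvg_lim _ am).
Qed.

Lemma first_order_littleo a l l' : first_order a l l' ->
  ((fun d : nat => a d - (l + d%:R^-1 * l') : R^o)
    =o_\oo (fun d : nat => d%:R^-1 : R^o)).
Proof.
move=> al; apply/eqoP => e e0.
have /cvgrPdist_le/(_ e e0) := al; apply: filterS2 (nbhs_infty_gt 0).
move=> d d0 le; have d0' : d%:R != 0 :> R by rewrite pnatr_eq0 -lt0n.
rewrite [X in `|X| <= _](_ : _ = d%:R^-1 * - (l' - d%:R * (a d - l))); last by field.
by rewrite normrM normrN mulrC ler_wpM2r.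
Qed.

End FirstOrder.

(** * Asymptotics of the sums over transitive pairs *)
Section Asymptotics.
Variable R : realType.
Implicit Types (u v : nat -> nat -> R) (al be : nat -> R).

Lemma cvg_sumr (I : Type) (r : seq I) (P : pred I) (f : I -> nat -> R) (l : I -> R) :
  (forall i, P i -> f i d @[d --> \oo] --> l i) ->
  \sum_(i <- r | P i) f i d @[d --> \oo] --> \sum_(i <- r | P i) l i.
Proof. by move=> fl; apply: cvg_big => //; exact: add_continuous. Qed.

Lemma cvg_prodr (I : Type) (r : seq I) (P : pred I) (f : I -> nat -> R) (l : I -> R) :
  (forall i, P i -> f i d @[d --> \oo] --> l i) ->
  \prod_(i <- r | P i) f i d @[d --> \oo] --> \prod_(i <- r | P i) l i.
Proof. by move=> fl; apply: cvg_big => //; exact: mul_continuous. Qed.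

Lemma first_order_block_prod (T : finType) (P : {set {set T}}) u al al' :
  (forall j, (0 < j)%N -> first_order (u^~ j) (al j) (al' j)) -> finset.set0 \notin P ->
  first_order (fun d => block_prod (u d) P) (block_prod al P)
    (\sum_(V in P) al' #|V| * block_prod al (P :\ V)%SET).
Proof.
move=> ual n0; apply: first_order_prod => V VP; apply: ual.
by rewrite card_gt0; apply: contraNneq n0 => <-.
Qed.

(** The derivative of the non-crossing sum is the first part of the formula for the
    fluctuations, to which the annular sum is added back. *)
Lemma first_order_nc_sum u v al al' be be' n :
  (forall j, (0 < j)%N -> first_order (u^~ j) (al j) (al' j)) ->
  (forall j, (0 < j)%N -> first_order (v^~ j) (be j) (be' j)) ->
  first_order (fun d => nc_sum (u d) (v d) n) (nc_sum al be n)
    (fluctuation_mul al al' be be' n + annular_sum al be n).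
Proof.
move=> ual vbe; rewrite /fluctuation_mul subrK; apply: first_order_sum => P PNC.
have := first_orderM (first_order_block_prod ual (set0_notin_NC PNC))
  (first_order_block_prod vbe (set0_notin_porbits (gamma n * (part_perm P)^-1)%g)).
by rewrite mulr_suml mulr_sumr.
Qed.

Lemma cvg_block_prod (T : finType) (P : {set {set T}}) u al :
  (forall j, (0 < j)%N -> u d j @[d --> \oo] --> al j) -> finset.set0 \notin P ->
  block_prod (u d) P @[d --> \oo] --> block_prod al P.
Proof.
move=> ual n0; apply: cvg_prodr => V VP; apply: ual.
by rewrite card_gt0; apply: contraNneq n0 => <-.
Qed.

Lemma cvg_annular_sum u v al be n :
  (forall j, (0 < j)%N -> u d j @[d --> \oo] --> al j) ->
  (forall j, (0 < j)%N -> v d j @[d --> \oo] --> be j) ->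
  annular_sum (u d) (v d) n @[d --> \oo] --> annular_sum al be n.
Proof.
move=> ual vbe; apply: cvgM; first exact: cvg_cst.
apply: cvg_sumr => t _; apply: cvg_sumr => s _; apply: cvgM; last exact: cvg_cst.
by apply: cvgM; apply: cvg_block_prod => //; exact: set0_notin_porbits.
Qed.

(** The remainder is a polynomial in 1/d whose coefficients are finite sums of products
    of convergent sequences. *)
Lemma cvg_avg_remainder u v al be n :
  (forall j, (0 < j)%N -> u d j @[d --> \oo] --> al j) ->
  (forall j, (0 < j)%N -> v d j @[d --> \oo] --> be j) ->
  exists l : R, avg_remainder (u d) (v d) (- d%:R) n @[d --> \oo] --> l.
Proof.
move=> ual vbe.
exists ((n.-1)`!%:R^-1 * \sum_(e < n) 0 ^+ (n.-1 - e) * cycle_count_sum al be n e).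
apply: cvgM; first exact: cvg_cst.
apply: cvg_sumr => e _; apply: cvgM.
  have c0 : (fun d : nat => (- d%:R)^-1 : R) @ \oo --> (0 : R).
    rewrite -oppr0; under eq_cvg do rewrite invrN.
    by apply: cvgN; exact: cvg_invn.
  elim: (n.-1 - e)%N => [|k IH]; first by under eq_cvg do rewrite expr0; exact: cvg_cst.
  by under eq_cvg do rewrite exprS; rewrite exprS; exact: cvgM.
apply: cvg_sumr => s _; apply: cvg_sumr => t _.
by apply: cvgM; apply: cvg_block_prod => //; exact: set0_notin_porbits.
Qed.

(** The factor c^(-1) = -1/d is responsible for the minus sign in front of the annular
    sum. *)
Lemma transitive_avg_first_order u v al al' be be' n : (0 < n)%N ->
  (forall j, (0 < j)%N -> first_order (u^~ j) (al j) (al' j)) ->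
  (forall j, (0 < j)%N -> first_order (v^~ j) (be j) (be' j)) ->
  first_order (fun d => transitive_avg (u d) (v d) (- d%:R) n) (nc_sum al be n)
    (fluctuation_mul al al' be be' n).
Proof.
move=> n0 ual vbe.
have ulim j : (0 < j)%N -> u d j @[d --> \oo] --> al j by move=> /ual/first_order_cvg.
have vlim j : (0 < j)%N -> v d j @[d --> \oo] --> be j by move=> /vbe/first_order_cvg.
have lead := first_order_nc_sum (n := n) ual vbe.
have ann : first_order (fun d => - (d%:R^-1 * annular_sum (u d) (v d) n)) 0 (- annular_sum al be n).
  apply: first_order_nearI (cvgN (cvg_annular_sum (n := n) ulim vlim)) _.
  near=> d; have d0 : d%:R != 0 :> R by rewrite pnatr_eq0 -lt0n; near: d; exists 1%N.
  by rewrite /= subr0 mulrN mulVKf.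
have [l lim] := cvg_avg_remainder n ulim vlim.
have rem : first_order (fun d => d%:R^-1 ^+ 2 * avg_remainder (u d) (v d) (- d%:R) n) 0 0.
  rewrite -[X in first_order _ _ X](mul0r l).
  apply: first_order_nearI (cvgM (@cvg_invn R) lim) _.
  near=> d; have d0 : d%:R != 0 :> R by rewrite pnatr_eq0 -lt0n; near: d; exists 1%N.
  by rewrite /= subr0 expr2 -!mulrA mulVKf.
have := first_orderD (first_orderD lead ann) rem.
rewrite !addr0 addrK; apply: first_order_near.
near=> d; have d0 : - d%:R != 0 :> R.
  by rewrite oppr_eq0 pnatr_eq0 -lt0n; near: d; exists 1%N.
case: n n0 {lead ann rem lim} => // m _.
by rewrite transitive_avg_expansion // invrN sqrrN mulNr.
Unshelve. all: by end_near. Qed.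

End Asymptotics.

(** * From moments to cumulants *)
Section Inversion.
Variable R : realType.

(** Induction on n. The numbers T_n(k, 1) equal A + k_n B, where A involves only
    k_1, ..., k_(n-1) and B -> 1, so that k_n = (m_n - A) / B for large d. *)
Lemma cumulants_first_order (k m : nat -> nat -> R) (l l' : nat -> R) :
  (forall n, (0 < n)%N -> \forall d \near \oo,
     m d n = transitive_avg (k d) (fun=> 1) (- d%:R) n) ->
  (forall n, (0 < n)%N -> first_order (m^~ n) (l n) (l' n)) ->
  exists r r' : nat -> R, forall n, (0 < n)%N -> first_order (k^~ n) (r n) (r' n).
Proof.
move=> mE ml.
suff ex : forall n, (0 < n)%N -> exists x : R * R, first_order (k^~ n) x.1 x.2.
  have /choice[f fP] : forall n, exists x : R * R, (0 < n)%N -> first_order (k^~ n) x.1 x.2.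
    move=> i.
    have [i0|i0] := ltnP 0 i; last by exists (0, 0).
    by have [x xP] := ex i i0; exists x.
  by exists (fun n => (f n).1), (fun n => (f n).2).
move=> n; have [j] := ubnP n; elim: j n => // j IH n ltnj n0.
have /choice[f fP] : forall i, exists x : R * R, (0 < i)%N ->
    first_order (fun d => trunc n (k d) i) x.1 x.2.
  move=> i; rewrite /trunc.
  have [i_n|_] := ltnP i n; last by exists (0, 0) => _; exact: first_order_cst.
  have [i0|i0] := ltnP 0 i; last by exists (0, 0).
  by have [x xP] := IH i (leq_trans i_n (ltnSE ltnj)) i0; exists x.
have one i : (0 < i)%N -> first_order (fun=> 1 : R) ((fun=> 1) i) ((fun=> 0) i).
  by move=> _; exact: first_order_cst.
have H1 := transitive_avg_first_order n0 (al := fun i => (f i).1) (al' := fun i => (f i).2)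
   (u := fun d => trunc n (k d)) (v := fun d => (fun=> 1)) fP one.
have H2 := transitive_avg_first_order n0 (al := fun i => (i == n)%:R) (al' := fun=> 0)
   (u := fun d i => (i == n)%:R) (v := fun d => (fun=> 1))
   (fun i _ => first_order_cst (i == n)%:R) one.
rewrite nc_sum_delta // in H2.
have nz : (1 : R) != 0 by exact: oner_neq0.
have H := first_orderM (first_orderB (ml n n0) H1) (first_orderV nz H2).
move: H; move: (_ / 1) (_ / 1 + _) => x x' H; exists (x, x'); apply: first_order_near H.
have c_nz : \forall d \near \oo, transitive_avg (fun i => (i == n)%:R) (fun=> 1) (- d%:R) n != 0 :> R.
  exact: cvgr_neq0 (first_order_cvg H2) nz.
near=> d; have cd : transitive_avg (fun i => (i == n)%:R) (fun=> 1) (- d%:R) n != 0 :> R.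
  by near: d.
have -> : m d n = transitive_avg (k d) (fun=> 1) (- d%:R) n by near: d; exact: mE.
by rewrite (transitive_avg_trunc n0) addrAC subrr add0r mulfK.
Unshelve. all: by end_near. Qed.

End Inversion.

(** * Formal power series *)
Section PowerSeries.
Variable R : realType.

Lemma fs_mul_poly (a b : nat -> R) N k : (k < N)%N ->
  fs_mul a b k = ((\poly_(i < N) a i) * (\poly_(i < N) b i))`_k.
Proof.
move=> kN; rewrite coefM; apply: eq_bigr => i _; rewrite !coef_poly.
have iN : (i < N)%N by apply: leq_ltn_trans kN; rewrite -ltnS.
by rewrite iN (leq_ltn_trans (leq_subr i k) kN).
Qed.

(** Functions nat -> R already carry the pointwise ring structure; the alias carries
    the Cauchy product instead. *)
Definition fps : Type := nat -> R.

HB.instance Definition _ := gen_eqMixin fps.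
HB.instance Definition _ := gen_choiceMixin fps.

Definition fps_add (a b : fps) : fps := fun k => a k + b k.
Definition fps_opp (a : fps) : fps := fun k => - a k.
Definition fps_zero : fps := fun=> 0.
Definition fpsC (c : R) : fps := fun k => if k == 0%N then c else 0.

Fact fps_addA : associative fps_add.
Proof. by move=> a b c; apply/funext => k; exact: addrA. Qed.
Fact fps_addC : commutative fps_add.
Proof. by move=> a b; apply/funext => k; exact: addrC. Qed.
Fact fps_add0 : left_id fps_zero fps_add.
Proof. by move=> a; apply/funext => k; exact: add0r. Qed.
Fact fps_addN : left_inverse fps_zero fps_opp fps_add.
Proof. by move=> a; apply/funext => k; exact: addNr. Qed.

HB.instance Definition _ := GRing.isZmodule.Build fps fps_addA fps_addC fps_add0 fps_addN.

Fact fps_mulA : associative (@fs_mul R : fps -> fps -> fps).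
Proof.
move=> a b c; apply/funext => k.
rewrite /fs_mul; transitivity (((\poly_(i < k.+1) a i) * ((\poly_(i < k.+1) b i) * (\poly_(i < k.+1) c i)))`_k).
  rewrite coefM; apply: eq_bigr => i _; rewrite coef_poly ltn_ord; congr (_ * _).
  by apply: fs_mul_poly; rewrite ltnS leq_subr.
rewrite mulrA coefM; apply: eq_bigr => i _; rewrite coef_poly ltnS leq_subr.
by congr (_ * _); rewrite -fs_mul_poly.
Qed.

Fact fps_mulC : commutative (@fs_mul R : fps -> fps -> fps).
Proof.
by move=> a b; apply/funext => k; rewrite !(@fs_mul_poly _ _ k.+1) // mulrC.
Qed.

Fact fpsC_mul (c : R) (a : fps) k : fs_mul (fpsC c) a k = c * a k.
Proof.
rewrite /fs_mul big_ord_recl /= subn0 big1 ?addr0 // => i _.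
by rewrite /fpsC /= mul0r.
Qed.

Fact fps_mul1 : left_id (fpsC 1) (@fs_mul R : fps -> fps -> fps).
Proof. by move=> a; apply/funext => k; rewrite fpsC_mul mul1r. Qed.

Fact fps_mulDl : left_distributive (@fs_mul R : fps -> fps -> fps) fps_add.
Proof.
move=> a b c; apply/funext => k; rewrite /fs_mul /fps_add -big_split /=.
by apply: eq_bigr => i _; rewrite mulrDl.
Qed.

Fact fps_1neq0 : fpsC 1 != 0.
Proof.
apply/eqP => /(congr1 (fun a : fps => a 0%N)) /eqP.
by rewrite /fpsC /= oner_eq0.
Qed.

HB.instance Definition _ := GRing.Zmodule_isComNzRing.Build fps
  fps_mulA fps_mulC fps_mul1 fps_mulDl fps_1neq0.

Implicit Types a b : fps.

Lemma fpsD a b k : (a + b) k = a k + b k. Proof. by []. Qed.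
Lemma fpsN a k : (- a) k = - a k. Proof. by []. Qed.
Lemma fps1 k : (1 : fps) k = if k == 0%N then 1 else 0. Proof. by []. Qed.
Lemma fpsM a b k : (a * b) k = \sum_(i < k.+1) a i * b (k - i)%N. Proof. by []. Qed.
Lemma fpsCM c a k : (fpsC c * a) k = c * a k. Proof. exact: fpsC_mul. Qed.

Lemma fps_sum (I : Type) (r : seq I) (P : pred I) (F : I -> fps) k :
  (\sum_(i <- r | P i) F i) k = \sum_(i <- r | P i) F i k.
Proof. by apply: (big_morph (fun a : fps => a k)). Qed.

Lemma fs_expE a n : fs_exp a n = (a : fps) ^+ n.
Proof.
elim: n => [|n IH]; last by rewrite exprS -IH.
by apply/funext => k; rewrite expr0 /fs_exp /= fps1; case: eqP.
Qed.

Definition fpsX : fps := fun k => (k == 1)%N%:R.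

Lemma fpsXM0 a : (fpsX * a) 0%N = 0.
Proof. by rewrite fpsM big_ord_recl big_ord0 /fpsX mul0r addr0. Qed.

Lemma fpsXMS a k : (fpsX * a) k.+1 = a k.
Proof.
rewrite fpsM 2!big_ord_recl /= /fpsX mul0r add0r mul1r subn1 big1 ?addr0 // => i _.
by rewrite mul0r.
Qed.

Lemma fpsXnM a n k : (fpsX ^+ n * a) k = if (n <= k)%N then a (k - n)%N else 0.
Proof.
elim: n k => [|n IH] k; first by rewrite mul1r subn0.
by rewrite exprS -mulrA; case: k => [|k]; rewrite ?fpsXM0 // fpsXMS IH subSS.
Qed.

(** The derivation x d/dx. *)
Definition theta a : fps := fun k => k%:R * a k.

Lemma thetaM a b : theta (a * b) = theta a * b + a * theta b.
Proof.
apply/funext => k; rewrite fpsD /theta !fpsM mulr_sumr -big_split /=.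
apply: eq_bigr => i _; have ik : (i <= k)%N by rewrite -ltnS.
have -> : k%:R = i%:R + (k - i)%:R :> R by rewrite -natrD subnKC.
ring.
Qed.

Lemma thetaD a b : theta (a + b) = theta a + theta b.
Proof. by apply/funext => k; rewrite fpsD /theta fpsD mulrDr. Qed.

Lemma thetaN a : theta (- a) = - theta a.
Proof. by apply/funext => k; rewrite fpsN /theta fpsN mulrN. Qed.

Lemma theta_sum (I : Type) (r : seq I) (P : pred I) (F : I -> fps) :
  theta (\sum_(i <- r | P i) F i) = \sum_(i <- r | P i) theta (F i).
Proof.
by apply/funext => k; rewrite /theta !fps_sum mulr_sumr.
Qed.

Lemma thetaC c : theta (fpsC c) = 0.
Proof. by apply/funext => -[|k]; rewrite /theta ?mul0r // mulr0. Qed.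

Lemma thetaX : theta fpsX = fpsX.
Proof. by apply/funext => -[|[|k]]; rewrite /theta /fpsX ?mul0r ?mul1r // mulr0. Qed.

Lemma thetaXn a n : theta (a ^+ n.+1) = n.+1%:R * a ^+ n * theta a.
Proof.
elim: n => [|n IH]; first by rewrite expr1 !mul1r.
by rewrite exprS thetaM IH -[n.+2%:R]nat1r exprS; ring.
Qed.

(** A series with constant term 1 can be cancelled, also modulo x^N. *)
Lemma fps_cancel a b N : b 0%N = 1 -> (forall k, (k < N)%N -> (a * b) k = 0) ->
  forall k, (k < N)%N -> a k = 0.
Proof.
move=> b0 ab0 k; have [j] := ubnP k; elim: j k => // j IH k ltkj kN.
have := ab0 k kN; rewrite fpsM big_ord_recr /= subnn b0 mulr1 big1 ?add0r // => i _.
rewrite IH ?mul0r //; first by apply: leq_trans (ltn_ord i) _; rewrite -ltnS.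
exact: ltn_trans kN.
Qed.

Lemma fps_vanishM a b N : (forall k, (k < N)%N -> a k = 0) ->
  forall k, (k < N)%N -> (b * a) k = 0.
Proof.
move=> a0 k kN; rewrite fpsM big1 // => i _; rewrite a0 ?mulr0 //.
by apply: leq_ltn_trans kN; exact: leq_subr.
Qed.

End PowerSeries.

(** * The functional equation between moments and free cumulants *)
Section FunctionalEquation.
Variables (R : realType) (r : nat -> R).

Definition falling_factor (d : nat) k j : R := \prod_(i < k) (d%:R - (j + i)%:R).

Lemma ffact_falling d k j :
  (d ^_ (j + k))%:R = (d ^_ j)%:R * falling_factor d k j :> R.
Proof.
rewrite /falling_factor; elim: k => [|k IH]; first by rewrite big_ord0 addn0 mulr1.
rewrite addnS ffactnSr natrM IH big_ord_recr /= mulrA.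
have [le|lt] := leqP (j + k) d; first by rewrite natrB.
have /eqP := IH; rewrite ffact_small // eq_sym => /eqP ->.
by rewrite !mul0r.
Qed.

Section FixedDegree.
Variable d : nat.
Hypothesis d_gt0 : (0 < d)%N.
Local Notation c := (- d%:R : R).

Let d_neq0 : d%:R != 0 :> R. Proof. by rewrite pnatr_eq0 -lt0n. Qed.
Let c_neq0 : c != 0. Proof. by rewrite oppr_eq0. Qed.

(** The coefficients e_n of a formal polynomial of degree d with prescribed cumulants
    r_n. *)
Definition scaled_perm_sum n : R := c^-1 ^+ n * perm_sum (fun k => c * r k) [set: 'I_n]%SET.
Local Notation b := scaled_perm_sum.

Definition avg_moment : fps R :=
  fun n => if n is 0 then 1 else transitive_avg r (fun=> 1) c n.
Local Notation M := avg_moment.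

(** The reversed polynomial, the product of the 1 - z x over its formal roots z. The
    series M = [avg_moment] collects the moments of these roots. *)
Definition char_series : fps R := fun n => (-1) ^+ n * 'C(d, n)%:R * b n.
Local Notation Q := char_series.

Lemma scaled_perm_sumE (T : finType) (S : {set T}) :
  c^-1 ^+ #|S| * perm_sum (fun k => c * r k) S = b #|S|.
Proof.
have H (T' : finType) := set_exp_scale c^-1 (perm_sum_set_exp T' (fun k => c * r k)).
have := @set_exp_card _ (fun k => c^-1 ^+ k * (k.-1`!%:R * (c * r k)))
  (fun T' (U : {set T'}) => c^-1 ^+ #|U| * perm_sum (fun k => c * r k) U) H T S.
by rewrite cardsT card_ord.
Qed.

(** The cycle of a chosen point is split off. This relation to the cumulants is used
    besides Newton's identities, which relate the same coefficients to the moments. *)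
Lemma scaled_perm_sum_rec n :
  b n.+1 = \sum_(k < n.+1) 'C(n, k)%:R * k`!%:R * c^-1 ^+ k * r k.+1 * b (n - k)%N.
Proof.
rewrite (@set_exp_recursion _ (fun k => c^-1 ^+ k * (k.-1`!%:R * (c * r k))) b n).
  by apply: eq_bigr => k _; rewrite /= exprS; field; exact: d_neq0.
apply: eq_set_exp (set_exp_scale c^-1 (perm_sum_set_exp _ (fun k => c * r k))) => // S.
exact: scaled_perm_sumE.
Qed.

(** Newton's identities. *)
Lemma theta_char_series : theta Q = fpsC c * ((M - 1) * Q).
Proof.
pose e n := n`!%:R * Q n.
have H (T : finType) : set_exp (fun S : {set T} => c^-1 ^+ #|S| *
   transitive_sum (fun k => c * r k) (fun=> c * 1) S) (fun S => e #|S|).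
  apply: eq_set_exp (set_exp_scale c^-1 (transitive_sum_set_exp T
     (fun k => c * r k) (fun=> c * 1))) => // S.
  rewrite mulr1 perm_sum_const mulrA scaled_perm_sumE /e /char_series; ring.
have lE n : (0 < n)%N -> c^-1 ^+ n * transitive_sum (fun k => c * r k) (fun=> c * 1)
     [set: 'I_n]%SET = n.-1`!%:R * (c * M n).
  case: n => // n _; rewrite (@transitive_avgE _ d d_gt0 r (fun=> 1)) //=.
  have x0 : c^-1 ^+ n.+1 * c ^+ n.+1 = 1 by rewrite -exprMn mulVf ?expr1n.
  rewrite [c ^+ n.+2]exprS.
  transitivity ((c^-1 ^+ n.+1 * c ^+ n.+1) * (n`!%:R * (c * transitive_avg r (fun=> 1) c n.+1))).
    by ring.
  by rewrite x0 mul1r.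
have rec n : e n.+1 = \sum_(k < n.+1) 'C(n, k)%:R * (k`!%:R * (c * M k.+1) * e (n - k)%N).
  apply: (@set_exp_recursion _ (fun k => k.-1`!%:R * (c * M k)) e n).
  apply: eq_set_exp (H _) => // S S0.
  have := @set_exp_log_card R (fun T (U : {set T}) => c^-1 ^+ #|U| *
   transitive_sum (fun k => c * r k) (fun=> c * 1) U) e H _ S S0.
  by rewrite cardsT card_ord => ->; rewrite lE // card_gt0.
apply/funext => -[|n]; rewrite fpsCM fpsM.
  by rewrite /theta mul0r big_ord_recl big_ord0 addr0 fpsD fpsN fps1 /= subrr mul0r mulr0.
have f0 : n`!%:R != 0 :> R by rewrite pnatr_eq0 -lt0n fact_gt0.
apply: (mulfI f0); transitivity (e n.+1).
  by rewrite /e /theta factS natrM; ring.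
rewrite rec [in RHS]big_ord_recl /= fpsD fpsN fps1 /= subrr mul0r add0r mulr_sumr mulr_sumr.
apply: eq_bigr => k _; rewrite /bump /= add1n subSS fpsD fpsN fps1 /= subr0.
have kn : (k <= n)%N by rewrite -ltnS.
rewrite -(bin_fact kn) /e !natrM; ring.
Qed.

(** A deformation of the powers of M. Newton's identities theta Q = -d (M - 1) Q can be
    read as (d - theta) Q = d M Q, and multiplication of Q_j by
    (d-j)(d-j-1)...(d-j-k+1) / d^k as a product of operators (1 - (i + theta) / d). The
    recursion is what these operators do on the factor in front of Q. *)
Fixpoint correction (k : nat) : fps R :=
  if k is j.+1 then correction j * M
     - fpsC d%:R^-1 * (fpsC j%:R * correction j + theta (correction j))
  else 1.

Lemma correctionM k j :
  (correction k * Q) j = d%:R^-1 ^+ k * falling_factor d k j * Q j.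
Proof.
elim: k j => [|k IH] j.
  by rewrite mul1r /falling_factor big_ord0 expr0 !mul1r.
have E : correction k.+1 * Q = correction k * Q
   - fpsC d%:R^-1 * (fpsC k%:R * (correction k * Q) + theta (correction k * Q)).
  have dV : fpsC d%:R^-1 * fpsC c = -1.
    apply/funext => i; rewrite fpsCM fpsN fps1 /fpsC.
    by case: eqP => _; rewrite ?mulr0 ?oppr0 // mulrN mulVf.
  rewrite thetaM theta_char_series /=.
  have -> : correction k * (fpsC c * ((M - 1) * Q)) = fpsC c * (correction k * (M - 1) * Q) by ring.
  have -> : correction k * Q - fpsC d%:R^-1 * (fpsC k%:R * (correction k * Q) +
     (theta (correction k) * Q + fpsC c * (correction k * (M - 1) * Q))) =
     correction k * Q - fpsC d%:R^-1 * (fpsC k%:R * (correction k * Q) + theta (correction k) * Q)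
      - (fpsC d%:R^-1 * fpsC c) * (correction k * (M - 1) * Q) by ring.
  by rewrite dV; ring.
rewrite E fpsD fpsN fpsCM fpsD fpsCM /theta !IH /falling_factor big_ord_recr /= exprS natrD.
by field.
Qed.

(** The recursion of [scaled_perm_sum_rec] with the binomial coefficients of the degree
    absorbed: the quotients of falling factorials are produced by the corrections. *)
Lemma char_series_rec n :
  n.+1%:R * Q n.+1 = c * \sum_(k < n.+1) r k.+1 * (correction k.+1 * Q) (n - k)%N.
Proof.
have f0 : n`!%:R != 0 :> R by rewrite pnatr_eq0 -lt0n fact_gt0.
apply: (mulfI f0); rewrite /char_series mulr_sumr mulr_sumr scaled_perm_sum_rec.
transitivity ((-1) ^+ n.+1 * (d ^_ n.+1)%:R * \sum_(k < n.+1)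
   'C(n, k)%:R * k`!%:R * c^-1 ^+ k * r k.+1 * b (n - k)%N).
  by rewrite -bin_ffact factS !natrM; ring.
rewrite mulr_sumr; apply: eq_bigr => k _.
have kn : (k <= n)%N by rewrite -ltnS.
rewrite correctionM /char_series -(bin_fact kn).
have -> : (d ^_ n.+1)%:R = (d ^_ (n - k))%:R * falling_factor d k.+1 (n - k) :> R.
  by rewrite -ffact_falling addnS subnK.
have -> : (-1) ^+ n.+1 = (-1) ^+ (n - k) * (-1) ^+ k * -1 :> R.
  by rewrite -exprD subnK // exprSr.
rewrite -bin_ffact !natrM exprSr invrN [(- d%:R^-1) ^+ k]exprNn.
have s1 : (-1) ^+ k * (-1) ^+ k = 1 :> R by rewrite -expr2 sqrr_sign.
set rhs := (X in _ = X); transitivity ((-1) ^+ k * (-1) ^+ k * rhs); last by rewrite s1 mul1r.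
rewrite /rhs; move: ((-1) ^+ k) ((-1) ^+ (n - k)) (d%:R^-1 ^+ k) => e f g.
by field; exact: d_neq0.
Qed.

(** Comparing the two expressions for theta Q and cancelling Q gives the functional
    equation for finite d. *)
Lemma avg_moment_correction n N : (0 < n)%N -> (n <= N)%N ->
  M n = \sum_(k < N) r k.+1 * (fpsX R ^+ k.+1 * correction k.+1) n.
Proof.
move=> n0 nN.
pose D : fps R := (M - 1) - \sum_(k < N) fpsC (r k.+1) * (fpsX R ^+ k.+1 * correction k.+1).
suff D0 : D n = 0.
  have := D0; rewrite /D !fpsD !fpsN fps_sum fps1 -[n == 0%N]negbK -lt0n n0 /= subr0.
  by move/eqP; rewrite subr_eq0 => /eqP ->; apply: eq_bigr => k _; rewrite fpsCM.
apply: (@fps_cancel _ D Q N.+1) => [|k kN|]; last by rewrite ltnS.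
  rewrite /char_series /scaled_perm_sum bin0 !expr0 !mul1r.
  rewrite (_ : [set: 'I_0]%SET = finset.set0) ?perm_sum0 //.
  by apply/finset.setP => -[].
rewrite /D mulrBl mulr_suml fpsD fpsN fps_sum.
have dM : c * ((M - 1) * Q) k = k%:R * Q k by rewrite -fpsCM -theta_char_series.
apply: (mulfI c_neq0); rewrite mulr0 mulrBr dM.
case: k kN dM => [|m] mN dM.
  rewrite mul0r big1 ?mulr0 ?subrr // => k _.
  by rewrite -mulrA -mulrA fpsCM fpsXnM /= mulr0.
rewrite char_series_rec -mulrBr; apply/eqP; rewrite mulf_eq0; apply/orP; right.
rewrite subr_eq0; apply/eqP; rewrite ltnS in mN.
transitivity (\sum_(k < N | (k < m.+1)%N) r k.+1 * (correction k.+1 * Q) (m - k)%N).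
  exact: (big_ord_widen N (fun k => r k.+1 * (correction k.+1 * Q) (m - k)%N) mN).
rewrite big_mkcond; apply: eq_bigr => k _.
rewrite -mulrA -mulrA fpsCM fpsXnM ltnS subSS.
by case: ifP; rewrite ?mulr0.
Qed.

End FixedDegree.

(** The moments with free cumulants r. *)
Definition free_moment : fps R := fun n => if n is 0 then 1 else nc_sum r (fun=> 1) n.

Lemma cvg_fpsM (a b : nat -> fps R) (x y : fps R) :
  (forall n, a d n @[d --> \oo] --> x n) -> (forall n, b d n @[d --> \oo] --> y n) ->
  forall n, (a d * b d) n @[d --> \oo] --> (x * y) n.
Proof. by move=> ax by_ n; apply: cvg_sumr => i _; exact: cvgM. Qed.

Lemma cvg_avg_moment n : avg_moment d n @[d --> \oo] --> free_moment n.
Proof.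
case: n => [|n]; first exact: cvg_cst.
exact: (first_order_cvg (transitive_avg_first_order (ltn0Sn n)
  (u := fun=> r) (v := fun=> fun=> 1) (al := r) (be := fun=> 1)
  (fun j _ => first_order_cst (r j)) (fun j _ => first_order_cst 1))).
Qed.

Lemma cvg_correction k n : correction d k n @[d --> \oo] --> (free_moment ^+ k) n.
Proof.
elim: k n => [|k IH] n; first exact: cvg_cst.
rewrite exprSr /= -[X in _ --> X]subr0; apply: cvgB.
  by apply: cvg_fpsM => // i; exact: cvg_avg_moment.
rewrite -(mul0r (k%:R * (free_moment ^+ k) n + n%:R * (free_moment ^+ k) n)).
under eq_cvg do rewrite fpsCM fpsD fpsCM.
apply: cvgM; first exact: cvg_invn.
by apply: cvgD; apply: cvgM => //; exact: cvg_cst.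
Qed.

(** The limit d -> oo of the equation for finite d, where the k-th correction tends to
    the power M^k. *)
Lemma free_functional_equation n N : (0 < n)%N -> (n <= N)%N ->
  free_moment n = \sum_(k < N) r k.+1 * ((fpsX R * free_moment) ^+ k.+1) n.
Proof.
move=> n0 nN; apply: (@cvg_unique _ _ (avg_moment d n @[d --> \oo])) => //.
  exact: cvg_avg_moment.
have : \sum_(k < N) r k.+1 * (fpsX R ^+ k.+1 * correction d k.+1) n @[d --> \oo] -->
       \sum_(k < N) r k.+1 * (fpsX R ^+ k.+1 * free_moment ^+ k.+1) n.
  apply: cvg_sumr => k _; apply: cvgM; first exact: cvg_cst.
  apply: cvg_fpsM => i; [exact: cvg_cst | exact: cvg_correction].
under [X in _ --> X]eq_bigr do rewrite -exprMn.
apply: cvg_trans; apply: near_eq_cvg; near=> d.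
have d0 : (0 < d)%N by near: d; exists 1%N.
by rewrite (avg_moment_correction d0 n0 nN).
Unshelve. all: by end_near. Qed.

End FunctionalEquation.

(** * The derivative of the moments along a variation of the cumulants *)
Section Derivative.
Variables (R : realType) (r r' : nat -> R).

(** The coefficient of 1/d in the moments with free cumulants r + r' / d. The function
    [fluctuation_mul] contains the derivative of the non-crossing sum, and its annular
    part is compensated. *)
Definition moment_variation : fps R := fun n =>
  if n is 0 then 0 else fluctuation_mul r r' (fun=> 1) (fun=> 0) n + annular_sum r (fun=> 1) n.
Local Notation m := (free_moment r).
Local Notation dm := moment_variation.
Local Notation X := (fpsX R).

Lemma first_order_fpsM (a b : nat -> fps R) (x x' y y' : fps R) :
  (forall n, first_order (fun d => a d n) (x n) (x' n)) ->
  (forall n, first_order (fun d => b d n) (y n) (y' n)) ->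
  forall n, first_order (fun d => (a d * b d) n) ((x * y) n) ((x' * y + x * y') n).
Proof.
move=> ax by_ n; rewrite fpsD !fpsM -big_split /=.
by apply: first_order_sum => i _; exact: first_orderM.
Qed.

Lemma first_order_fpsX (a : nat -> fps R) (x x' : fps R) k :
  (forall n, first_order (fun d => a d n) (x n) (x' n)) ->
  forall n, first_order (fun d => (a d ^+ k.+1) n) ((x ^+ k.+1) n) ((k.+1%:R * x ^+ k * x') n).
Proof.
move=> ax; elim: k => [|k IH] n; first by rewrite expr0 !mul1r; exact: ax.
rewrite (_ : k.+2%:R * x ^+ k.+1 * x' = x' * x ^+ k.+1 + x * (k.+1%:R * x ^+ k * x')).
  exact: first_order_fpsM.
by rewrite -[k.+2%:R]nat1r exprS; ring.
Qed.

Lemma first_order_perturbation j :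
  first_order (fun d => r j + d%:R^-1 * r' j) (r j) (r' j).
Proof.
apply: first_order_nearI (cvg_cst (r' j)) _; near=> d.
have d0 : d%:R != 0 :> R by rewrite pnatr_eq0 -lt0n; near: d; exists 1%N.
by rewrite addrAC subrr add0r mulVKf.
Unshelve. all: by end_near. Qed.

Lemma first_order_free_moment n :
  first_order (fun d => free_moment (fun j => r j + d%:R^-1 * r' j) n) (m n) (dm n).
Proof.
case: n => [|n]; first exact: first_order_cst.
have H := first_order_nc_sum (n := n.+1) (u := fun d j => r j + d%:R^-1 * r' j)
  (v := fun=> fun=> 1) (al := r) (al' := r') (be := fun=> 1) (be' := fun=> 0).
by apply: H => j _; [exact: first_order_perturbation | exact: first_order_cst].
Qed.

Local Notation g := (X * m).

(** Comparison of the terms of order 1/d in the functional equation for r + r' / d. *)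
Lemma moment_variation_eq n N : (n <= N)%N ->
  dm n = \sum_(k < N) (r' k.+1 * (g ^+ k.+1) n +
                       r k.+1 * (k.+1%:R * g ^+ k * (X * dm)) n).
Proof.
case: n => [_|n nN].
  rewrite big1 // => k _.
  by rewrite exprS -mulrA fpsXM0 [_ * (X * _)]mulrCA fpsXM0 !mulr0 addr0.
pose rd d j := r j + d%:R^-1 * r' j.
have H1 := @first_order_free_moment n.+1.
have Xm i : first_order (fun d => (X * free_moment (rd d)) i) (g i) ((X * dm) i).
  case: i => [|i].
    rewrite !fpsXM0; apply: first_order_near (first_order_cst 0).
    by near=> d; rewrite fpsXM0.
    Unshelve. all: try by end_near.
  rewrite !fpsXMS; apply: first_order_near (@first_order_free_moment i).
  by near=> d; rewrite fpsXMS.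
  Unshelve. all: try by end_near.
have H2 : first_order (fun d => free_moment (rd d) n.+1)
   (\sum_(k < N) r k.+1 * (g ^+ k.+1) n.+1)
   (\sum_(k < N) (r' k.+1 * (g ^+ k.+1) n.+1 +
                       r k.+1 * (k.+1%:R * g ^+ k * (X * dm)) n.+1)).
  apply: first_order_near; last first.
    apply: first_order_sum => k _.
    have Xk := @first_order_fpsX _ _ _ k Xm n.+1.
    exact: first_orderM (@first_order_perturbation k.+1) Xk.
  by near=> d; rewrite (free_functional_equation (rd d) (ltn0Sn n) nN).
  Unshelve. all: try by end_near.
by have [_ ->] := first_order_unique H1 H2.
Qed.

(** Put g = x m, K = C'(g) for C(y) = sum_k r_k y^k, and A = sum_k r'_(k+1) g^k.
    Variation of the functional equation gives dm = A g + x K dm, and applying theta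
    to it gives theta m = K theta g, where theta g = g + x theta m. Thus
    (dm - A theta g)(1 - x K) = 0, and 1 - x K can be cancelled. *)
Lemma moment_variationE n :
  dm n = ((\sum_(k < n.+1) fpsC (r' k.+1) * g ^+ k) * theta g) n.
Proof.
set N := n.+1.
pose A : fps R := \sum_(k < N) fpsC (r' k.+1) * g ^+ k.
pose K : fps R := \sum_(k < N) fpsC (r k.+1) * (k.+1%:R * g ^+ k).
have v1 k : (k < N)%N -> (dm - (g * A + X * K * dm)) k = 0.
  move=> kN; rewrite fpsD fpsN (@moment_variation_eq k N); last exact: ltnW.
  apply/eqP; rewrite subr_eq0; apply/eqP.
  have -> : g * A + X * K * dm =
     \sum_(i < N) (fpsC (r' i.+1) * g ^+ i.+1 + fpsC (r i.+1) * (i.+1%:R * g ^+ i * (X * dm))).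
    rewrite /A /K !mulr_sumr mulr_suml -big_split /=; apply: eq_bigr => i _.
    by rewrite exprS; ring.
  by rewrite fps_sum; apply: eq_bigr => i _; rewrite fpsD !fpsCM.
have v2 k : (k < N)%N -> (m - (1 + \sum_(k < N) fpsC (r k.+1) * g ^+ k.+1)) k = 0.
  case: k => [|k] kN; rewrite fpsD fpsN fpsD fps_sum.
    rewrite big1 ?addr0 ?subrr // => i _.
    by rewrite exprS -mulrA mulrCA fpsXM0.
  rewrite (free_functional_equation r (ltn0Sn k) (ltnW kN)) fps1 /= add0r.
  apply/eqP; rewrite subr_eq0; apply/eqP.
  by apply: eq_bigr => i _; rewrite fpsCM.
have tg : theta g = g + X * theta m by rewrite thetaM thetaX.
have v3 k : (k < N)%N -> (theta m - K * theta g) k = 0.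
  move=> kN; have -> : theta m - K * theta g =
      theta (m - (1 + \sum_(k < N) fpsC (r k.+1) * g ^+ k.+1)).
    rewrite thetaD thetaN thetaD (_ : theta 1 = 0) ?add0r; last exact: thetaC.
    rewrite theta_sum /K mulr_suml; congr (_ - _); apply: eq_bigr => i _.
    by rewrite [in RHS]thetaM thetaC [theta (g ^+ _)]thetaXn; ring.
  by rewrite /theta v2 ?mulr0.
have key : (dm - A * theta g) * (1 - X * K) =
    (dm - (g * A + X * K * dm)) - A * X * (theta m - K * theta g).
  by rewrite tg; ring.
suff : (dm - A * theta g) n = 0.
  by rewrite fpsD fpsN => /eqP; rewrite subr_eq0 => /eqP.
apply: (@fps_cancel _ _ (1 - X * K) N) => // [|k kN].
  by rewrite fpsD fpsN fpsXM0 subr0.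
by rewrite key fpsD fpsN v1 // (fps_vanishM _ v3) ?subrr.
Qed.

End Derivative.

(** * Linear functionals on polynomials *)
Section LinearFunctional.
Variables (R : realType) (s : nat -> R).

Definition coef_functional (f : {poly R}) : R := \sum_(i < size f) f`_i * s i.

Lemma coef_functional_widen (f : {poly R}) N : (size f <= N)%N ->
  coef_functional f = \sum_(i < N) f`_i * s i.
Proof.
move=> fN; rewrite /coef_functional (big_ord_widen N (fun i => f`_i * s i) fN) big_mkcond /=.
by apply: eq_bigr => i _; case: ltnP => // le; rewrite nth_default ?mul0r.
Qed.

Lemma coef_functional_linear : GRing.linear_for *%R coef_functional.
Proof.
move=> a f h; pose N := maxn (size f) (size h).
have sz : (size (a *: f + h)%R <= N)%N.
  apply: leq_trans (size_polyD _ _) _; rewrite geq_max leq_maxr andbT.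
  by apply: leq_trans (size_scale_leq _ _) _; rewrite leq_maxl.
rewrite (coef_functional_widen sz) (coef_functional_widen (leq_maxl _ _ : size f <= N)%N).
rewrite (coef_functional_widen (leq_maxr _ _ : size h <= N)%N) mulr_sumr -big_split /=.
by apply: eq_bigr => i _; rewrite coefD coefZ mulrDl mulrA.
Qed.

HB.instance Definition _ := GRing.isLinear.Build R {poly R} R *%R coef_functional
  coef_functional_linear.

Lemma coef_functionalXn n : coef_functional 'X^n = s n.
Proof.
rewrite (@coef_functional_widen _ n.+1) ?size_polyXn // big_ord_recr /= coefXn eqxx mul1r.
by rewrite big1 ?add0r // => i _; rewrite coefXn ltn_eqF // mul0r.
Qed.

End LinearFunctional.

(** * Fluctuations of sequences of polynomials *)
Section FluctuationData.
Variable R : realType.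
Implicit Types (p q : nat -> {poly R}) (mu nu : probability (measurableTypeR R) R).

Lemma moment0 mu : moment mu 0 = 1.
Proof.
rewrite /moment; under eq_Rintegral do rewrite expr0.
rewrite Rintegral_cst //; transitivity (1 * fine (1%E : \bar R)); last exact: mul1r.
by congr (_ * fine _); exact: probability_setT.
Qed.

Lemma moment_nc_sum mu n : (0 < n)%N ->
  moment mu n = nc_sum (free_cumulant mu) (fun=> 1) n.
Proof.
move=> n0; rewrite free_cumulantE //; apply: eq_bigr => P _.
by rewrite block_prod1 mulr1.
Qed.

Lemma pmoment0 d (f : {poly R}) : (0 < d)%N -> monic_of_degree d f -> pmoment d f 0 = 1.
Proof.
move=> d0 mf; have [_ sz] := croots_monic mf.
rewrite /pmoment; under eq_bigr do rewrite expr0.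
by rewrite big_const_seq count_predT sz iter_addr_0 mulVf // pnatr_eq0 -lt0n.
Qed.

(** The limits of the cumulants are the free cumulants of mu, because the limits of the
    moments determine them through the non-crossing sums. *)
Lemma moments_to_cumulants p mu (mu' : {scalar {poly R}}) : infinitesimal_distribution p mu mu' ->
  exists rhat : nat -> R, forall n, (0 < n)%N ->
    first_order (fun d => ffcumulant d (p d) n) (free_cumulant mu n) (rhat n).
Proof.
case=> mon _ _ fluct _.
have avg n : (0 < n)%N -> \forall d \near \oo,
   pmoment d (p d) n = transitive_avg (ffcumulant d (p d)) (fun=> 1) (- d%:R) n.
  by move=> n0; near=> d; apply: pmoment_avg => //; [|apply: mon]; near: d; exists 1%N.
have [r [r' rP]] := cumulants_first_order (k := fun d => ffcumulant d (p d))
  (m := fun d => pmoment d (p d)) (l := moment mu) (l' := fun n => mu' 'X^n) avg fluct.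
exists r' => n n0; rewrite -(_ : r n = free_cumulant mu n); first exact: rP.
apply: nc_sum_inj n n0 => n n0; rewrite -moment_nc_sum //.
have H := transitive_avg_first_order (n := n) (u := fun d => ffcumulant d (p d))
  (v := fun=> fun=> 1) (al := r) (al' := r') (be := fun=> 1) (be' := fun=> 0) n0 rP
  (fun j _ => first_order_cst 1).
have H' : first_order (fun d => pmoment d (p d) n) (nc_sum r (fun=> 1) n)
    (fluctuation_mul r r' (fun=> 1) (fun=> 0) n).
  by apply: first_order_near H; near=> d; apply/esym; near: d; exact: avg.
by have [] := first_order_unique H' (fluct n n0).
Unshelve. all: by end_near. Qed.

Lemma cumulant_fluctuationsP p mu rhat :
  (forall n, (0 < n)%N ->
    first_order (fun d => ffcumulant d (p d) n) (free_cumulant mu n) (rhat n)) ->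
  cumulant_fluctuations p mu rhat.
Proof. by move=> H n n0; exact: first_order_littleo (H n n0). Qed.

End FluctuationData.

Theorem theorem4p9 (R : realType) (p q : nat -> {poly R})
    (mu nu rho : probability (measurableTypeR R) R)
    (mu' nu' : {scalar {poly R}})
    (p_real : forall d, (0 < d)%N -> real_rooted d (p d))
    (q_real : forall d, (0 < d)%N -> real_rooted d (q d))
    (mu_det : moment_determined mu)
    (nu_det : moment_determined nu)
    (p_inf : infinitesimal_distribution p mu mu')
    (q_inf : infinitesimal_distribution q nu nu')
    (nu_ge0 : nu [set x : R | x < 0] = 0%E)
    (rhoE : free_mult_conv mu nu rho) :
  let pq := fun d : nat => ffmul d (p d) (q d) in
  exists (rho' : {scalar {poly R}}) (rhat_p rhat_q rhat_pq : nat -> R),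
    [/\ infinitesimal_distribution pq rho rho',
        [/\ cumulant_fluctuations p mu rhat_p,
            cumulant_fluctuations q nu rhat_q &
            cumulant_fluctuations pq rho rhat_pq],
        forall k : nat,
          G_fun rho' k =
          - fs_mul (fs_comp (fun j => rhat_pq j.+1) (G_ rho))
                   (fs_derivV (G_ rho)) k
          - H_ rho k &
        forall n : nat, (0 < n)%N ->
          rhat_pq n = fluctuation_mul (free_cumulant mu) rhat_p
                                      (free_cumulant nu) rhat_q n].
Proof.
move=> pq; have [p_mon _ _ _ _] := p_inf; have [q_mon _ _ _ _] := q_inf.
have [rp rpP] := moments_to_cumulants p_inf.
have [rq rqP] := moments_to_cumulants q_inf.
have [rho_fin _ rho_cum] := rhoE.
pose rpq := fluctuation_mul (free_cumulant mu) rp (free_cumulant nu) rq.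
pose r := free_cumulant rho.
have pq_mon d : (0 < d)%N -> monic_of_degree d (pq d).
  by move=> d0; apply: monic_ffmul => //; [exact: p_mon | exact: q_mon].
have rpqP n : (0 < n)%N -> first_order (fun d => ffcumulant d (pq d) n) (r n) (rpq n).
  move=> n0; rewrite /r rho_cum //.
  have H := transitive_avg_first_order n0 rpP rqP.
  apply: first_order_near H; near=> d.
  have d0 : (0 < d)%N by near: d; exists 1%N.
  by rewrite ffcumulant_ffmul //; [exact: p_mon | exact: q_mon].
(* The first-order term of the moments: the annular sum with second factor 1 is h_n. *)
pose s n := moment_variation r rpq n - annular_sum r (fun=> 1) n.
have momP n : (0 < n)%N -> first_order (fun d => pmoment d (pq d) n) (moment rho n) (s n).
  move=> n0; rewrite moment_nc_sum //.
  have H := transitive_avg_first_order (n := n) (u := fun d => ffcumulant d (pq d))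
    (v := fun=> fun=> 1) (al := r) (al' := rpq) (be := fun=> 1) (be' := fun=> 0) n0 rpqP
    (fun j _ => first_order_cst 1).
  have -> : s n = fluctuation_mul r rpq (fun=> 1) (fun=> 0) n.
    by rewrite /s; case: (n) n0 => // j _; rewrite /moment_variation addrK.
  apply: first_order_near H; near=> d; have d0 : (0 < d)%N by near: d; exists 1%N.
  by rewrite (pmoment_avg d0) //; exact: pq_mon.
have s0 : s 0%N = 0 by rewrite /s /annular_sum /= !mul0r subr0.
exists (coef_functional s : {scalar {poly R}}), rp, rq, rpq; split => //.
- split => //.
  + case=> [|n]; last exact: first_order_cvg (momP n.+1 (ltn0Sn n)).
    rewrite moment0; apply: (@first_order_cvg _ _ _ 0).
    apply: first_order_near (first_order_cst 1); near=> d.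
    have d0 : (0 < d)%N by near: d; exists 1%N.
    by rewrite pmoment0 //; exact: pq_mon.
  + by move=> n n0; rewrite /= coef_functionalXn; exact: momP.
  + by rewrite -(expr0 'X) /= coef_functionalXn.
- by split; apply: cumulant_fluctuationsP.
(* In powers of x = 1/z, the Cauchy transform is g = x m, and d/dz is -x theta. *)
pose m := free_moment r; pose g : fps R := fpsX R * m.
have GE : G_ rho = g.
  apply/funext => -[|n]; rewrite /g ?fpsXM0 // fpsXMS /m.
  by case: n => [|n]; [exact: moment0 | exact: moment_nc_sum].
have dE : fs_derivV (G_ rho) = - (fpsX R * theta g).
  rewrite GE; apply/funext => -[|n]; rewrite fpsN; first by rewrite fpsXM0 oppr0.
  by rewrite fpsXMS.
have compE N k : (k < N)%N -> fs_comp (fun j => rpq j.+1) (G_ rho) k =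
    (\sum_(i < N) fpsC (rpq i.+1) * g ^+ i) k.
  move=> kN; rewrite /fs_comp GE fps_sum.
  rewrite (big_ord_widen N (fun i => rpq i.+1 * fs_exp g i k) kN) big_mkcond.
  apply: eq_bigr => i _; rewrite fpsCM fs_expE; case: ifP => // ik.
  by rewrite exprMn fpsXnM -ltnS ik mulr0.
case=> [|n].
  rewrite /H_ /= subr0 /fs_mul big_ord_recl big_ord0 addr0 /=.
  by rewrite mulr0 oppr0.
rewrite /G_fun /= coef_functionalXn /H_ /= dE.
have -> : fs_mul (fs_comp (fun j => rpq j.+1) (G_ rho)) (- (fpsX R * theta g)) n.+1 =
   - moment_variation r rpq n.
  pose a : fps R := fs_comp (fun j => rpq j.+1) (G_ rho).
  transitivity ((a * - (fpsX R * theta g)) n.+1) => //.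
  have -> : a * - (fpsX R * theta g) = - (fpsX R * (a * theta g)) by ring.
  rewrite fpsN fpsXMS moment_variationE; congr (- _).
  by rewrite !fpsM; apply: eq_bigr => i _; rewrite /a (compE n.+1).
rewrite opprK /s; congr (_ - _); rewrite /h_.
case: ifPn => n2; last by rewrite /annular_sum big_geq ?mulr0 // leqNgt.
by congr (_ * _); apply: eq_bigr => t _; apply: eq_bigr => sigma _; rewrite block_prod1 mulr1.
Unshelve. all: by end_near. Qed.
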